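(* For every integer $N\geq1$ there exist an integer $L_N\geq1$ and a constant $C_N>0$, both depending only on $N$, such that for every integer $d\geq1$ and every integer $1\leq n\leq d^4$ there exist complex coefficients $\alpha_\nu=\alpha_{\nu,d,n}$, $\beta_\nu=\beta_{\nu,d,n}$ and parameters $r_\nu=r_{\nu,d,n}$, $\widetilde r_\nu=\widetilde r_{\nu,d,n}$ in $(0,1)$, for $1\leq\nu\leq L_N$, such that $$\sum_{\nu=1}^{L_N}\bigl(|\alpha_\nu|+|\beta_\nu|\bigr)\leq C_N$$ and $$\sup_{\xi\in\mathbb T^d}\left|m_n^d(\xi)-\sum_{\nu=1}^{L_N}\alpha_\nu\widehat{g_{r_\nu}^d}(\xi)-\sum_{\nu=1}^{L_N}\beta_\nu\widehat{g_{\widetilde r_\nu}^d}(\xi-\mathbf h)\right|\leq C_N\min\{n,d\}^{-N}.$$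
   Context: $\mathbb T^d=\mathbb R^d/\mathbb Z^d$ and $\mathbf h=(\tfrac12,\ldots,\tfrac12)\in\mathbb T^d$. For integers $d\ge1$, $n\ge0$, $\mathcal B_n^d=\{x\in\mathbb Z^d: x_1^2+\cdots+x_d^2\leq n\}$ and $$m_n^d(\xi)=\frac1{|\mathcal B_n^d|}\sum_{x\in\mathcal B_n^d}e^{2\pi i x\cdot\xi},\qquad \xi\in\mathbb T^d.$$ For $0<r<1$, $\Theta(r)=\sum_{k\in\mathbb Z}r^{k^2}$ and $g_r^d(x)=\Theta(r)^{-d}r^{|x|^2}$ for $x\in\mathbb Z^d$, where $|x|^2=x_1^2+\cdots+x_d^2$. The Fourier transform of $g\in\ell^1(\mathbb Z^d)$ is $\widehat g(\xi)=\sum_{x\in\mathbb Z^d}g(x)e^{2\pi i x\cdot\xi}$, $\xi\in\mathbb T^d$. *)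

(* Defs.v *)
From HB Require Import structures.
From mathcomp Require Import all_boot all_order all_algebra.
From mathcomp Require Import finmap complex zify.
From mathcomp Require Import all_classical all_reals all_analysis.
From mathcomp.analysis Require Import showcase.summability.

Set Implicit Arguments.
Unset Strict Implicit.
Unset Printing Implicit Defensive.
Import Order.TTheory GRing.Theory Num.Theory.
Import numFieldNormedType.Exports.

Local Open Scope classical_set_scope.
Local Open Scope complex_scope.
Local Open Scope ring_scope.

Section Definitions.
Context {R : realType}.
Implicit Types (d n : nat) (r : R).

(* Z^d is 'rV[int]_d.  A point of T^d = R^d / Z^d is given by a representative
   xi : 'rV[R]_d; the functions on T^d below are Z^d-periodic functions of xi
   (ballmult_periodic, fourier_periodic), so a supremum over T^d is a supremum
   over 'rV[R]_d. *)

Definition normsq d (x : 'rV[int]_d) : int := \sum_(i < d) x 0 i ^+ 2.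

Definition dotp d (x : 'rV[int]_d) (xi : 'rV[R]_d) : R :=
  \sum_(i < d) (x 0 i)%:~R * xi 0 i.

(* t |-> e^{2 pi i t} *)
Definition expi2pi (t : R) : R[i] := cos (2 * pi * t) +i* sin (2 * pi * t).

Definition intball d n : set 'rV[int]_d := [set x | normsq x <= n%:Z].
Arguments intball : clear implicits.

(* fset_set A is A as a finite set, or fset0 when A is infinite; intball d n is
   finite (finite_intball). *)
Definition ballmult d n (xi : 'rV[R]_d) : R[i] :=
  (#|` fset_set (intball d n)|%:R)^-1 *
  \sum_(x <- fset_set (intball d n)) expi2pi (dotp x xi).

(* sum is the unconditional sum: the limit of the finite partial sums along the
   directed set of finite subsets of the index type (an arbitrary value if the
   family is not summable). *)
Definition theta r : R := sum (fun k : int => r ^ (k ^+ 2)).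

Definition gauss d r (x : 'rV[int]_d) : R := theta r ^- d * r ^ normsq x.

Definition fourier d (g : 'rV[int]_d -> R[i]) (xi : 'rV[R]_d) : R[i] :=
  sum (fun x : 'rV[int]_d => g x * expi2pi (dotp x xi) : R[i]^o).

Definition gausshat d r (xi : 'rV[R]_d) : R[i] :=
  fourier (fun x => (gauss r x)%:C) xi.

(* real-valued, unlike `|z| : R[i] *)
Definition cmod (z : R[i]) : R := Normc.normc z.

Definition halfvec d : 'rV[R]_d := const_mx 2^-1.

Lemma expi2piDint (t : R) (m : int) : expi2pi (t + m%:~R) = expi2pi t.
Proof.
have per s (k : nat) : expi2pi (s + k%:R) = expi2pi s.
  rewrite /expi2pi mulrDr (_ : 2 * pi * k%:R = pi *+ 2 *+ k); last first.
    by rewrite mulr_natr mulr_natl.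
  by rewrite (periodicn (@cosD2pi R)) (periodicn (@sinD2pi R)).
case: (intP m) => [|k|k]; first by rewrite addr0.
  exact: per.
by rewrite -[in RHS](subrK k.+1%:R t) per rmorphN.
Qed.

Lemma char_periodic d (x k : 'rV[int]_d) (xi : 'rV[R]_d) :
  expi2pi (dotp x (xi + map_mx intr k)) = expi2pi (dotp x xi).
Proof.
rewrite -(expi2piDint (dotp x xi) (\sum_(i < d) x 0 i * k 0 i)); congr expi2pi.
rewrite /dotp raddf_sum -big_split; apply: eq_bigr => i _ /=.
by rewrite !mxE mulrDr intrM.
Qed.

Lemma ballmult_periodic d n (k : 'rV[int]_d) (xi : 'rV[R]_d) :
  ballmult n (xi + map_mx intr k) = ballmult n xi.
Proof.
by congr (_ * _); apply: eq_bigr => x _; exact: char_periodic.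
Qed.

Lemma fourier_periodic d g (k : 'rV[int]_d) (xi : 'rV[R]_d) :
  fourier g (xi + map_mx intr k) = fourier g xi.
Proof.
apply: (congr1 (fun f : 'rV[int]_d -> R[i]^o => sum f)).
by apply/funext => x; rewrite char_periodic.
Qed.

Lemma finite_intball d n : finite_set (intball d n).
Proof.
pose f (u : {ffun 'I_d -> 'I_(n.*2.+1)}) : 'rV[int]_d :=
  \row_i ((u i : nat)%:Z - n%:Z).
apply: (@sub_finite_set _ _ (f @` setT)); last exact/finite_image.
move=> x; rewrite /intball /= => hx.
have hxi i : (absz (x ord0 i) <= n)%N.
  have hi : x 0 i ^+ 2 <= n%:Z.
    apply: le_trans hx; rewrite /normsq (bigD1 i) //= lerDl.
    by apply: sumr_ge0 => j _; exact: sqr_ge0.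
  by move: (x ord0 i) hi => z hz; nia.
exists [ffun i => inord (absz (x ord0 i + n%:Z))] => //.
apply/rowP => i; rewrite mxE ffunE; have := hxi i.
move: (x ord0 i) => z hz; rewrite inordK; last by rewrite -addnn; lia.
by rewrite gez0_abs ?addrK //; lia.
Qed.

End Definitions.

(* Main.v *)
Require Import Defs.
From HB Require Import structures.
From mathcomp Require Import all_boot all_order all_algebra.
From mathcomp Require Import finmap complex zify ring lra.
From mathcomp Require Import all_classical all_reals all_analysis.
From mathcomp.analysis Require Import showcase.summability.

Set Implicit Arguments.
Unset Strict Implicit.
Unset Printing Implicit Defensive.
Import Order.TTheory GRing.Theory Num.Theory.
Import numFieldNormedType.Exports.

Local Open Scope classical_set_scope.
Local Open Scope complex_scope.
Local Open Scope ring_scope.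

Local Notation Re := complex.Re.
Local Notation Im := complex.Im.


(* Let p be the law r^(k^2) / theta on the integers, truncated at |k| <= J for a huge J,
   with r chosen so that the mean of k^2 is n / d.  Up to normalisation, ballmult n xi is the
   coefficient sum of degree at most n of prod_i phi_(xi_i)(r z), where
   phi_xi(w) = sum_k p_k w^(k^2) e(k xi); it is computed by averaging over the Q-th roots of
   unity.  As k^2 and k have the same parity, replacing w by -w amounts to shifting xi by h.
   Put D = d r = B^18.  Weyl-type differencing bounds |phi_xi(w)|^2 by
   1 - c r min(1, |w^2 - 1| / (1 - r))^2, uniformly in xi, so only w near 1 and near -1
   matter.  Near 1, dividing by a quadratic approximation of phi_0 makes the product a
   polynomial in w - 1 bounded on a disc of radius (1 - r) / B^6, by comparison of
   |phi_xi| with |phi_0|.  On the arc of radius (1 - r) / B^8 it can therefore be replaced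
   by its Lagrange interpolant at real nodes x, with error B^(-2 T); at a real node
   it is a multiple of the Fourier transform of the Gaussian of parameter r (1 + x).
   The normalising factor, the same average at xi = 0, is bounded below by a central
   limit argument. *)

(** Roots of unity replace contour integrals, so Cauchy estimates and interpolation are statements
    about coefficients of polynomials; limits occur only when the finite products are compared with
    the true Gaussian transforms. All bounds must be uniform over 0 < r < 1: r is near 0 when n is
    much smaller than d, near 1 when n is much larger. Hence each carries a factor r, so that d
    coordinates contribute D = d r rather than d, and D is at least a multiple of min(n, d). The
    obstacle on the disc is that it is wider than (1 - r) / sqrt D, the scale on which the product
    varies; absolute values alone would allow growth exponential in a power of B. The quadratic
    normalisation removes this growth and leaves a cubic remainder, of total size D (B^(-6))^3 = 1.
    Its inverse, restored on the arc, decays like phi_0^d. The weights therefore have total mass of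
    the order of the normalising factor, and the coefficients stay bounded. The hypothesis n <= d^4
    bounds 1 - r from below by a power of 1 / B, which makes the minor-arc error exp(-c B^2)
    negligible against the width of the arc. *)

(** * Modulus, real and imaginary parts *)

Section ComplexModulus.
Context {R : realType}.
Implicit Types (x y z : R[i]) (a b : R).

Lemma cmod_ge0 z : 0 <= cmod z.
Proof. by case: z => a b; rewrite /cmod /= sqrtr_ge0. Qed.

Lemma cmodM x y : cmod (x * y) = cmod x * cmod y.
Proof. exact: Normc.normcM. Qed.

Lemma cmod1 : cmod (1 : R[i]) = 1. Proof. exact: Normc.normc1. Qed.

Lemma cmod0 : cmod (0 : R[i]) = 0. Proof. exact: Normc.normc0. Qed.

Lemma cmodV x : cmod x^-1 = (cmod x)^-1.
Proof. exact: Normc.normcV. Qed.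

Lemma cmodN x : cmod (- x) = cmod x.
Proof. exact: (@normcN _ (x : Rcomplex R)). Qed.

Lemma cmodD x y : cmod (x + y) <= cmod x + cmod y.
Proof. exact: (@le_normcD _ (x : Rcomplex R) (y : Rcomplex R)). Qed.

Lemma cmodB x y : cmod (x - y) <= cmod x + cmod y.
Proof. by rewrite -(cmodN y); exact: cmodD. Qed.

Lemma cmod_distC x y : cmod (x - y) = cmod (y - x).
Proof. by rewrite -cmodN opprB. Qed.

Lemma cmod_dist_trans y x z : cmod (x - z) <= cmod (x - y) + cmod (y - z).
Proof. by rewrite -[x - z](subrKA y) cmodD. Qed.

Lemma cmod_lerB x y : cmod x - cmod y <= cmod (x - y).
Proof. by rewrite lerBlDr -[in leLHS](subrK y x) cmodD. Qed.

Lemma cmodX x n : cmod (x ^+ n) = cmod x ^+ n.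
Proof.
by elim: n => [|n IH]; rewrite ?expr0 ?cmod1 // !exprS cmodM IH.
Qed.

Lemma cmod_sqr z : cmod z ^+ 2 = Re z ^+ 2 + Im z ^+ 2.
Proof. by case: z => a b; rewrite /cmod /= sqr_sqrtr // addr_ge0 ?sqr_ge0. Qed.

Lemma cmodR a : cmod a%:C = `|a|.
Proof.
by apply/eqP; rewrite -(@eqrXn2 _ 2) ?cmod_ge0 // cmod_sqr /= expr0n addr0 real_normK ?num_real.
Qed.

Lemma cmod_eq0 z : (cmod z == 0) = (z == 0).
Proof.
apply/eqP/eqP => [|->]; last exact: cmod0.
exact: Normc.eq0_normc.
Qed.

Lemma cmod_sum I (s : seq I) (P : pred I) (F : I -> R[i]) :
  cmod (\sum_(i <- s | P i) F i) <= \sum_(i <- s | P i) cmod (F i).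
Proof.
elim/big_rec2: _ => [|i a b _ h]; first by rewrite cmod0.
by apply: le_trans (cmodD _ _) _; rewrite lerD2l.
Qed.

Lemma cmod_prod I (s : seq I) (P : pred I) (F : I -> R[i]) :
  cmod (\prod_(i <- s | P i) F i) = \prod_(i <- s | P i) cmod (F i).
Proof. by apply: big_morph; [exact: cmodM|exact: cmod1]. Qed.

Lemma Re_le_cmod z : `|Re z| <= cmod z.
Proof.
by rewrite -[leRHS]ger0_norm ?cmod_ge0 // -ler_sqr ?nnegrE // !real_normK ?num_real // cmod_sqr
  lerDl sqr_ge0.
Qed.

Lemma Im_le_cmod z : `|Im z| <= cmod z.
Proof.
by rewrite -[leRHS]ger0_norm ?cmod_ge0 // -ler_sqr ?nnegrE // !real_normK ?num_real // cmod_sqr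
  lerDr sqr_ge0.
Qed.

Lemma cmod_le_ReIm z : cmod z <= `|Re z| + `|Im z|.
Proof.
rewrite -ler_sqr ?nnegrE ?cmod_ge0 ?addr_ge0 // cmod_sqr sqrrD !real_normK ?num_real //.
by rewrite -addrA lerD2l lerDr mulrn_wge0 // mulr_ge0.
Qed.

Lemma ReM x y : Re (x * y) = Re x * Re y - Im x * Im y.
Proof. by case: x => ? ?; case: y. Qed.

Lemma ImM x y : Im (x * y) = Re x * Im y + Im x * Re y.
Proof. by case: x => ? ?; case: y. Qed.

Lemma ReD x y : Re (x + y) = Re x + Re y.
Proof. by case: x => ? ?; case: y. Qed.

Lemma ImD x y : Im (x + y) = Im x + Im y.
Proof. by case: x => ? ?; case: y. Qed.

Lemma ReN x : Re (- x) = - Re x. Proof. by case: x. Qed.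

Lemma ImN x : Im (- x) = - Im x. Proof. by case: x. Qed.

Lemma ReB x y : Re (x - y) = Re x - Re y.
Proof. by rewrite ReD ReN. Qed.

Lemma ImB x y : Im (x - y) = Im x - Im y.
Proof. by rewrite ImD ImN. Qed.

Lemma Re_sum I (s : seq I) (P : pred I) (F : I -> R[i]) :
  Re (\sum_(i <- s | P i) F i) = \sum_(i <- s | P i) Re (F i).
Proof. by apply: big_morph => //; exact: ReD. Qed.

Lemma Im_sum I (s : seq I) (P : pred I) (F : I -> R[i]) :
  Im (\sum_(i <- s | P i) F i) = \sum_(i <- s | P i) Im (F i).
Proof. by apply: big_morph => //; exact: ImD. Qed.

Lemma ReMr a z : Re (a%:C * z) = a * Re z.
Proof. by rewrite ReM /= mul0r subr0. Qed.

Lemma ImMr a z : Im (a%:C * z) = a * Im z.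
Proof. by rewrite ImM /= mul0r addr0. Qed.

Lemma complex_eqP x y : Re x = Re y -> Im x = Im y -> x = y.
Proof. by case: x y => ? ? [? ?] /= -> ->. Qed.

Lemma rcM a b : (a * b)%:C = a%:C * b%:C :> R[i].
Proof. exact: rmorphM. Qed.

Lemma rcD a b : (a + b)%:C = a%:C + b%:C :> R[i].
Proof. exact: rmorphD. Qed.

Lemma rcB a b : (a - b)%:C = a%:C - b%:C :> R[i].
Proof. exact: rmorphB. Qed.

Lemma rcX a n : (a ^+ n)%:C = a%:C ^+ n :> R[i].
Proof. exact: rmorphXn. Qed.

Lemma rcV a : a^-1%:C = (a%:C)^-1 :> R[i].
Proof. exact: fmorphV. Qed.

Lemma rc_sum I (s : seq I) (P : pred I) (F : I -> R) :
  (\sum_(i <- s | P i) F i)%:C = \sum_(i <- s | P i) (F i)%:C :> R[i].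
Proof. exact: rmorph_sum. Qed.

Lemma rc_nat n : n%:R%:C = n%:R :> R[i].
Proof. exact: rmorph_nat. Qed.

Lemma cmod_nat n : cmod (n%:R : R[i]) = n%:R.
Proof. by rewrite -rc_nat cmodR ger0_norm. Qed.

Lemma conjc_eqV z : cmod z = 1 -> z^*%C = z^-1.
Proof.
move=> h; rewrite invc_norm normc_def -/(cmod _).
rewrite (_ : Num.sqrt _ = cmod z); last by case: (z).
by rewrite h expr1n invr1 mul1r.
Qed.

Lemma conjcM x y : (x * y)^*%C = x^*%C * y^*%C.
Proof. by case: x y => ? ? [? ?]; apply: complex_eqP => /=; ring. Qed.

Lemma conjc_sum I (s : seq I) (P : pred I) (F : I -> R[i]) :
  (\sum_(i <- s | P i) F i)^*%C = \sum_(i <- s | P i) (F i)^*%C.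
Proof.
apply: (big_morph (fun z : R[i] => z^*%C)); last by rewrite conjc0.
by case=> ? ? [? ?]; apply: complex_eqP => /=; rewrite ?opprD.
Qed.

Lemma cmod_sqr_mulJ z : (cmod z ^+ 2)%:C = z * z^*%C.
Proof.
rewrite cmod_sqr; case: z => a b; apply: complex_eqP => /=; ring.
Qed.

Lemma unit_pow_dist z n : cmod z <= 1 -> cmod (z ^+ n - 1) <= n%:R * cmod (z - 1).
Proof.
move=> h; elim: n => [|n IH]; first by rewrite expr0 subrr cmod0 mul0r.
rewrite exprS (_ : z * z ^+ n - 1 = z * (z ^+ n - 1) + (z - 1)); last by ring.
apply: le_trans (cmodD _ _) _; rewrite cmodM -natr1 mulrDl mul1r lerD2r.
by apply: le_trans IH; rewrite ler_piMl ?cmod_ge0.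
Qed.

Lemma unit_dist_le2 x y : cmod x = 1 -> cmod y = 1 -> cmod (x - y) <= 2.
Proof. by move=> hx hy; apply: le_trans (cmodB _ _) _; rewrite hx hy. Qed.

End ComplexModulus.

(** * Roots of unity: coefficient filter, Parseval, a Lorentzian sum *)

Section RootsOfUnity.
Context {R : realType}.
Implicit Types (s t : R) (Q : nat).
Local Notation C := R[i].

Lemma cmod_expi2pi t : cmod (expi2pi t) = 1.
Proof.
by apply/eqP; rewrite -(@eqrXn2 _ 2) ?cmod_ge0 // cmod_sqr /= cos2Dsin2 expr1n.
Qed.

Lemma expi2piD s t : expi2pi (s + t) = expi2pi s * expi2pi t.
Proof.
apply: complex_eqP; rewrite ?ReM ?ImM /= mulrDr ?cosD ?sinD //; ring.
Qed.

Lemma expi2pi0 : expi2pi (0 : R) = 1.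
Proof. by apply: complex_eqP; rewrite /= mulr0 ?cos0 ?sin0. Qed.

Lemma expi2pi_neq0 t : expi2pi t != 0.
Proof. by rewrite -cmod_eq0 cmod_expi2pi oner_eq0. Qed.

Lemma expi2piMn t n : expi2pi (t * n%:R) = expi2pi t ^+ n.
Proof.
elim: n => [|n IH]; first by rewrite mulr0 expi2pi0 expr0.
by rewrite -natr1 mulrDr mulr1 expi2piD IH exprSr.
Qed.

Lemma expi2pi_half : expi2pi (2^-1 : R) = -1.
Proof.
apply: complex_eqP; rewrite /= mulrAC divff ?pnatr_eq0 // mul1r ?cospi ?sinpi //.
by rewrite oppr0.
Qed.

Lemma expi2pi_neq1 t : 0 < t < 1 -> expi2pi t != 1.
Proof.
move=> /andP[t0 t1]; apply/eqP => h.
have s0 : 0 < sin (pi * t).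
  apply: sin_gt0_pi; rewrite ?in_itv /=; rewrite mulr_gt0 ?pi_gt0 //=.
  by rewrite gtr_pMr ?pi_gt0.
have : Re (expi2pi t) = 1 by rewrite h.
rewrite /= -mulrA mulrC mulr_natr cos_mulr2n => hc.
have := cos2Dsin2 (pi * t); nra.
Qed.

Definition omega Q : C := expi2pi (Q%:R^-1 : R).

Lemma cmod_omega Q : cmod (omega Q) = 1.
Proof. exact: cmod_expi2pi. Qed.

Lemma cmod_omegaX Q j : cmod (omega Q ^+ j) = 1.
Proof. by rewrite cmodX cmod_omega expr1n. Qed.

Lemma omegaXE Q j : omega Q ^+ j = expi2pi (j%:R / Q%:R).
Proof. by rewrite -expi2piMn mulrC. Qed.

Lemma omega_expQ Q : (0 < Q)%N -> omega Q ^+ Q = 1.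
Proof.
move=> Q0; rewrite omegaXE divff ?pnatr_eq0 -?lt0n //.
by rewrite -[1]add0r -[X in 0 + X]/(1%:~R) expi2piDint expi2pi0.
Qed.

Lemma omega_half P : (0 < P)%N -> omega (P + P) ^+ P = -1.
Proof.
move=> P0; rewrite omegaXE natrD -mulr2n -[_ *+ 2]mulr_natr invfM mulrA divff.
  by rewrite mul1r expi2pi_half.
by rewrite pnatr_eq0 -lt0n.
Qed.

Lemma omega_prim Q : (0 < Q)%N -> Q.-primitive_root (omega Q).
Proof.
move=> Q0; apply/andP; split => //; apply/forallP => i.
rewrite unity_rootE; have := ltn_ord i; rewrite leq_eqVlt => /orP[/eqP ->|iQ].
  by rewrite omega_expQ // !eqxx.
rewrite (ltn_eqF iQ) eqbF_neg omegaXE expi2pi_neq1 //.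
by rewrite divr_gt0 ?ltr0n //= ltr_pdivrMr ?ltr0n // mul1r ltr_nat.
Qed.

Lemma omega_ortho Q k : (0 < Q)%N -> ~~ (Q %| k)%N ->
  \sum_(j < Q) (omega Q ^+ j) ^+ k = 0.
Proof.
move=> Q0 hk; under eq_bigr do rewrite exprAC.
have h1 : omega Q ^+ k != 1 by rewrite -(prim_order_dvd (omega_prim Q0)).
apply: (mulfI (_ : omega Q ^+ k - 1 != 0)); first by rewrite subr_eq0.
by rewrite -subrX1 -exprM mulnC exprM omega_expQ // expr1n subrr mulr0.
Qed.

Lemma omega_orthoV Q i m : (i < Q)%N -> (m < Q)%N ->
  \sum_(j < Q) (omega Q ^+ j) ^+ i * (omega Q ^+ j) ^- m = (i == m)%:R * Q%:R.
Proof.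
move=> iQ mQ; have Q0 : (0 < Q)%N by apply: leq_ltn_trans mQ.
have w0 j : omega Q ^+ j != 0 by rewrite expf_neq0 // expi2pi_neq0.
have [->|im] := eqVneq i m.
  rewrite (eq_bigr (fun=> 1)) ?sumr_const ?card_ord ?mul1r // => j _.
  by rewrite divff // expf_neq0.
rewrite mul0r.
(* As omega^Q = 1, the inverse power is traded for the exponent Q - m; i + (Q - m) lies strictly
   between 0 and 2 Q and is divisible by Q only if i = m. *)
rewrite -[RHS](@omega_ortho Q (i + (Q - m))) //.
  apply: eq_bigr => j _; rewrite exprD expfB //; congr (_ * _).
  by rewrite -(exprM _ j Q) mulnC (exprM _ Q) omega_expQ // expr1n div1r.
apply/negP => /dvdnP [q hq].
have : (q * Q < 2 * Q)%N by lia.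
rewrite ltn_mul2r Q0 /=; case: q hq => [|[|q]] //= hq _.
  by move: hq; lia.
by move/eqP: im; lia.
Qed.

(** The discrete Cauchy integral for a coefficient. It is exact because the exponents of p, all
    below Q, are distinct modulo Q. *)
Lemma root_filter Q (p : {poly C}) m (x : C) : (size p <= Q)%N -> (m < Q)%N ->
  \sum_(j < Q) p.[x * omega Q ^+ j] * (omega Q ^+ j) ^- m = Q%:R * (p`_m * x ^+ m).
Proof.
move=> sp mQ.
have e (j : 'I_Q) : p.[x * omega Q ^+ j] * (omega Q ^+ j) ^- m =
    \sum_(i < Q) (p`_i * x ^+ i) * ((omega Q ^+ j) ^+ i * (omega Q ^+ j) ^- m).
  rewrite (horner_coef_wide _ sp) mulr_suml; apply: eq_bigr => i _.
  by rewrite exprMn !mulrA.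
rewrite (eq_bigr _ (fun j _ => e j)) exchange_big /=.
under eq_bigr do rewrite -mulr_sumr.
rewrite (bigD1 (Ordinal mQ)) //= [X in _ + X = _]big1 => [|i im].
  by rewrite addr0 omega_orthoV // eqxx mul1r mulrC.
rewrite omega_orthoV // (_ : (_ == _) = false) ?mul0r ?mulr0 //.
by apply/negbTE; apply: contra im => /eqP h; apply/eqP/val_inj.
Qed.

Lemma root_parseval Q (c : 'I_Q -> R) :
  \sum_(j < Q) cmod (\sum_(m < Q) (c m)%:C * (omega Q ^+ j) ^+ m) ^+ 2
  = Q%:R * \sum_(m < Q) c m ^+ 2.
Proof.
apply: (@complexI R); rewrite rc_sum.
have e (j : 'I_Q) : (cmod (\sum_(m < Q) (c m)%:C * (omega Q ^+ j) ^+ m) ^+ 2)%:C =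
    \sum_(m < Q) \sum_(l < Q)
      ((c m)%:C * (c l)%:C) * ((omega Q ^+ j) ^+ m * (omega Q ^+ j) ^- l).
  rewrite cmod_sqr_mulJ conjc_sum mulr_suml; apply: eq_bigr => m _.
  rewrite mulr_sumr; apply: eq_bigr => l _.
  rewrite conjcM conjc_real conjc_eqV; last by rewrite cmodX cmod_omegaX expr1n.
  by rewrite mulrACA.
rewrite (eq_bigr _ (fun j _ => e j)) exchange_big /= rcM rc_nat rc_sum mulr_sumr.
apply: eq_bigr => m _; rewrite exchange_big (bigD1 m) //= [X in _ + X = _]big1 ?addr0 => [|l lm].
  by rewrite -mulr_sumr omega_orthoV // eqxx mul1r mulrC -rcM.
rewrite -mulr_sumr omega_orthoV // (_ : (_ == _) = false) ?mul0r ?mulr0 //.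
by apply/negbTE; rewrite eq_sym; apply: contra lm => /eqP h; apply/eqP/val_inj.
Qed.

(* Parseval for the geometric polynomial sum_k (1 - W)^k z^k, whose squared modulus
   dominates a multiple of the Lorentzian. *)
Lemma sum_lorentzian Q (W : R) : 0 < W < 1 -> (1 - W) ^+ Q <= 2^-1 ->
  \sum_(j < Q) (1 + cmod (omega Q ^+ j - 1) ^+ 2 / W ^+ 2)^-1 <= Q%:R * (4 * W).
Proof.
move=> /andP[W0 W1] hQ; set t := 1 - W in hQ.
have t0 : 0 < t by rewrite subr_gt0.
have Q0 : (0 < Q)%N by case: Q hQ => //; rewrite expr0; lra.
have eqn (j : 'I_Q) : cmod (1 - t%:C * omega Q ^+ j) ^+ 2
    = W ^+ 2 + t * cmod (omega Q ^+ j - 1) ^+ 2.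
  have : cmod (omega Q ^+ j) ^+ 2 = 1 by rewrite cmod_omegaX expr1n.
  rewrite !cmod_sqr !ReB !ImB ReMr ImMr /=.
  by move: (Re _) (Im _) => x y h; rewrite /t; nra.
have geo (j : 'I_Q) : \sum_(m < Q) (t ^+ m)%:C * (omega Q ^+ j) ^+ m
    = (1 - t ^+ Q)%:C / (1 - t%:C * omega Q ^+ j).
  have nz : 1 - t%:C * omega Q ^+ j != 0.
    rewrite -cmod_eq0 -sqrf_eq0 eqn gt_eqF //.
    by rewrite ltr_pwDl ?exprn_gt0 // mulr_ge0 ?sqr_ge0 // ltW.
  apply: (mulIf nz); rewrite divfK // mulrC.
  under eq_bigr do rewrite rcX -exprMn.
  rewrite -opprB mulNr -subrX1 opprB exprMn -exprM mulnC exprM omega_expQ //.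
  by rewrite expr1n mulr1 (rcB 1 (t ^+ Q)) (rcX t Q).
have le1 (j : 'I_Q) : (1 + cmod (omega Q ^+ j - 1) ^+ 2 / W ^+ 2)^-1 <=
    4 * W ^+ 2 * cmod (\sum_(m < Q) (t ^+ m)%:C * (omega Q ^+ j) ^+ m) ^+ 2.
  rewrite geo cmodM cmodV exprMn exprVn eqn cmodR.
  set x := cmod (_ - 1) ^+ 2; have x0 : 0 <= x by exact: sqr_ge0.
  have -> : 1 + x / W ^+ 2 = (W ^+ 2 + x) / W ^+ 2.
    by field; rewrite gt_eqF.
  have W2 : 0 < W ^+ 2 by rewrite exprn_gt0.
  have d0 : 0 < W ^+ 2 + t * x by rewrite ltr_pwDl // mulr_ge0 // ltW.
  have d1 : 0 < W ^+ 2 + x by rewrite ltr_pwDl.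
  rewrite invf_div.
  apply: (@le_trans _ _ (W ^+ 2 / (W ^+ 2 + t * x))).
    rewrite ler_pM2l // lef_pV2 ?posrE // lerD2l ler_piMl // /t; lra.
  rewrite [leRHS]mulrA ler_pM2r ?invr_gt0 // mulrAC ler_peMl ?(ltW W2) //.
  have -> : `|1 - t ^+ Q| ^+ 2 = (1 - t ^+ Q) ^+ 2 by rewrite real_normK ?num_real.
  by move: hQ; set q := _ ^+ Q; nra.
apply: le_trans (ler_sum _ (fun j _ => le1 j)) _.
rewrite -mulr_sumr (@root_parseval Q (fun m => t ^+ m)).
have gs : (1 - t ^+ 2) * \sum_(m < Q) (t ^+ m) ^+ 2 <= 1.
  under eq_bigr do rewrite exprAC.
  rewrite -opprB mulNr -subrX1 opprB lerBlDr lerDl exprn_ge0 ?sqr_ge0 //.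
move: gs; set S := \sum_(m < Q) _; move=> gs.
have S0 : 0 <= S by apply: sumr_ge0 => m _; exact: sqr_ge0.
have WS : W * S <= 1.
  apply: le_trans gs; apply: ler_wpM2r => //; rewrite /t; nra.
rewrite mulrCA ler_wpM2l // expr2 -!mulrA ler_wpM2l //.
by rewrite -[leRHS]mulr1 ler_wpM2l // ltW.
Qed.

(** With an even number of points, -1 is one of the roots and negation permutes them; this is why Q
    has the form P + P. *)
Lemma sum_omega_opp P (F : C -> R[i]) : (0 < P)%N ->
  \sum_(j < P + P) F (- omega (P + P) ^+ j) = \sum_(j < P + P) F (omega (P + P) ^+ j).
Proof.
move=> P0; rewrite !big_split_ord /= addrC; congr (_ + _);
  by apply: eq_bigr => j _; rewrite exprD omega_half // ?mulN1r ?opprK.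
Qed.

End RootsOfUnity.

(** * Generating functions of a finite law near 1 *)

Section FiniteLaw.
Context {R : realType} {I : finType}.
Implicit Types (p c : I -> R) (a : I -> nat) (kap : R).
Local Notation C := R[i].

Lemma cmod_sqr_sum p (y : I -> C) :
  cmod (\sum_i (p i)%:C * y i) ^+ 2 =
  \sum_i \sum_j p i * p j * Re (y i * (y j)^*%C).
Proof.
rewrite cmod_sqr Re_sum Im_sum !expr2 !big_distrlr -big_split /=.
apply: eq_bigr => i _; rewrite -big_split /=; apply: eq_bigr => j _.
by rewrite !ReMr !ImMr; case: (y i) (y j) => ? ? [? ?] /=; ring.
Qed.

Lemma sum_sum1 p : \sum_i p i = 1 -> \sum_i \sum_j p i * p j = 1.
Proof. by move=> p1; rewrite -big_distrlr /= p1 mulr1. Qed.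

(** Variance identity: the double sum is the mean squared distance of two independent copies of y.
    For nonnegative p its terms are nonnegative, so decay of the mean follows from any convenient
    set of pairs. *)
Lemma cmod_sqr_mean p (y : I -> C) : \sum_i p i = 1 ->
  (forall i, cmod (y i) = 1) ->
  cmod (\sum_i (p i)%:C * y i) ^+ 2 =
  1 - 2^-1 * \sum_i \sum_j p i * p j * cmod (y i - y j) ^+ 2.
Proof.
move=> p1 hy; rewrite cmod_sqr_sum -[X in X - _](sum_sum1 p1) mulr_sumr -sumrB.
apply: eq_bigr => i _; rewrite mulr_sumr -sumrB; apply: eq_bigr => j _.
have : cmod (y i) ^+ 2 = 1 by rewrite hy expr1n.
have : cmod (y j) ^+ 2 = 1 by rewrite hy expr1n.
rewrite !cmod_sqr; case: (y i) (y j) => u v [s t] /= h1 h2.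
have -> : (u - s) ^+ 2 + (v - t) ^+ 2 = 2 - 2 * (u * s + v * t) by lra.
by field.
Qed.

Definition genfun p a c (x : C) : C := \sum_i (p i * c i)%:C * x ^+ a i.

(** Moment tilted by (1 + kap)^a, which dominates |x|^a on the disc |x - 1| <= kap. *)
Definition emom p a n kap : R := \sum_i p i * (a i)%:R ^+ n * (1 + kap) ^+ a i.

Lemma emom_ge0 p a n kap : (forall i, 0 <= p i) -> 0 <= kap -> 0 <= emom p a n kap.
Proof.
move=> p0 k0; apply: sumr_ge0 => i _; apply: mulr_ge0.
  by apply: mulr_ge0 => //; exact: exprn_ge0.
by apply: exprn_ge0; apply: addr_ge0.
Qed.

Lemma Re_unit_pow_ge (u : C) m : cmod u = 1 -> 1 - m%:R * cmod (u - 1) <= Re (u ^+ m).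
Proof.
move=> u1; have h := @unit_pow_dist _ u m; rewrite u1 lexx in h.
have h2 := Re_le_cmod (u ^+ m - 1); rewrite ReB /= in h2.
by move: h2 (h isT); rewrite ler_norml; lra.
Qed.

(** The unit vector u = x / |x| is within 4 kap of 1, so the real part can be negative only if 4 kap
    m > 1, and then the trivial bound |x|^m may be multiplied by (4 kap m)^3. The third power is
    chosen to give an error cubic in [kap]. *)
Lemma Re_pow_ge (x : C) kap m : cmod (x - 1) <= kap -> kap <= 2^-1 ->
  - (cmod x ^+ m * (4 * kap * m%:R) ^+ 3) <= Re (x ^+ m).
Proof.
move=> hx hk; have k0 : 0 <= kap by apply: le_trans hx; exact: cmod_ge0.
have xl : 1 - kap <= cmod x.
  have := cmod_lerB 1 x; rewrite cmod1 cmod_distC; lra.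
have x0 : 0 < cmod x by lra.
have xu : `|cmod x - 1| <= kap.
  rewrite ler_norml; have := cmod_lerB x 1; rewrite cmod1; lra.
pose u : C := ((cmod x)^-1)%:C * x.
have u1 : cmod u = 1.
  by rewrite cmodM cmodR gtr0_norm ?invr_gt0 // mulVf // gt_eqF.
have hu : cmod (u - 1) <= 4 * kap.
  have -> : u - 1 = ((cmod x)^-1)%:C * (x - (cmod x)%:C).
    by rewrite mulrBr -rcM mulVf ?gt_eqF.
  rewrite cmodM cmodR gtr0_norm ?invr_gt0 // mulrC ler_pdivrMr //.
  apply: (@le_trans _ _ (2 * kap)); last by nra.
  apply: le_trans (cmod_dist_trans 1 _ _) _.
  have -> : 1 - (cmod x)%:C = (1 - cmod x)%:C :> C by rewrite rcB.
  rewrite cmodR distrC; lra.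
have xe : x = (cmod x)%:C * u by rewrite mulrA -rcM divff ?mul1r // gt_eqF.
rewrite [in X in _ <= X]xe [(_ * u) ^+ m]exprMn -rcX ReMr.
rewrite -mulrN; apply: ler_wpM2l; first by rewrite exprn_ge0 // ltW.
have [h|h] := leP (4 * kap * m%:R) 1.
  apply: (@le_trans _ _ 0); first by rewrite oppr_le0 exprn_ge0 // !mulr_ge0.
  apply: le_trans (Re_unit_pow_ge m u1); rewrite subr_ge0; apply: le_trans h.
  by rewrite mulrC ler_wpM2r.
apply: (@le_trans _ _ (-1)); first by rewrite lerN2 exprn_ege1 // ltW.
have := Re_le_cmod (u ^+ m); rewrite cmodX u1 expr1n ler_norml; lra.
Qed.

Lemma eqW_le (x y : R) : x = y -> x <= y.
Proof. by move=> ->. Qed.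

Lemma Re_pow_conj_ge (x : C) kap (a b : nat) : cmod (x - 1) <= kap -> kap <= 2^-1 ->
  - ((1 + kap) ^+ a * (1 + kap) ^+ b * (64 * kap ^+ 3) * (a%:R ^+ 3 + b%:R ^+ 3))
  <= Re (x ^+ a * (x ^+ b)^*%C).
Proof.
move=> hx hk; have k0 : 0 <= kap by apply: le_trans hx; exact: cmod_ge0.
have xu : cmod x <= 1 + kap.
  have := cmod_lerB x 1; rewrite cmod1; lra.
wlog ba : a b / (b <= a)%N.
  move=> h; have [/h //|/ltnW/h {}h] := leqP b a.
  have -> : Re (x ^+ a * (x ^+ b)^*%C) = Re (x ^+ b * (x ^+ a)^*%C).
    by case: (x ^+ a) (x ^+ b) => ? ? [? ?] /=; ring.
  by apply: le_trans h; apply: eqW_le; ring.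
have -> : Re (x ^+ a * (x ^+ b)^*%C) = cmod x ^+ b * cmod x ^+ b * Re (x ^+ (a - b)).
  rewrite -{1}(subnK ba) exprD -mulrA -cmod_sqr_mulJ mulrC ReMr cmodX.
  by rewrite -expr2.
apply: le_trans (_ : _ <= - (cmod x ^+ a * cmod x ^+ b * (4 * kap * (a - b)%:R) ^+ 3)) _.
  rewrite lerN2 -[leRHS]mulrA.
  apply: ler_pM.
  - by rewrite mulr_ge0 // exprn_ge0 // cmod_ge0.
  - by rewrite exprn_ge0 // !mulr_ge0.
  - by apply: ler_pM; rewrite ?exprn_ge0 ?cmod_ge0 // lerXn2r // nnegrE ?cmod_ge0 //; lra.
  - rewrite (_ : _ ^+ 3 = 64 * kap ^+ 3 * (a - b)%:R ^+ 3); last by ring.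
    apply: ler_wpM2l; first by rewrite mulr_ge0 // exprn_ge0.
    apply: (@le_trans _ _ (a%:R ^+ 3)); last by rewrite lerDl exprn_ge0.
    by rewrite lerXn2r ?nnegrE // ler_nat leq_subr.
rewrite -{1}(subnK ba) exprD.
rewrite (_ : _ * _ * _ * _ = cmod x ^+ b * cmod x ^+ b * (cmod x ^+ (a - b) * (4 * kap * (a -
  b)%:R) ^+ 3)); last by ring.
rewrite -mulrN; apply: ler_wpM2l; last exact: Re_pow_ge.
by rewrite mulr_ge0 // exprn_ge0 // cmod_ge0.
Qed.

(* For real c the two squares differ by the sum of
   p_i p_j (c_i c_j - 1) Re (x^a_i conj(x)^a_j) with x = 1 + z, and this real part is
   nonnegative up to an error cubic in z. *)
Lemma genfun_sqr_le p a c (z : C) kap : (forall i, 0 <= p i) ->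
  (forall i, `|c i| <= 1) -> cmod z <= kap -> kap <= 2^-1 ->
  cmod (genfun p a c (1 + z)) ^+ 2 <=
  cmod (genfun p a (fun=> 1) (1 + z)) ^+ 2
   + 256 * kap ^+ 3 * emom p a 3 kap * emom p a 0 kap.
Proof.
move=> p0 c1 hz hk; have hx : cmod (1 + z - 1) <= kap by rewrite addrC addKr.
rewrite /genfun !cmod_sqr_sum.
have -> : 256 * kap ^+ 3 * emom p a 3 kap * emom p a 0 kap =
  \sum_i \sum_j p i * p j * (128 * kap ^+ 3 * ((1 + kap) ^+ a i * (1 + kap) ^+ a j)
     * ((a i)%:R ^+ 3 + (a j)%:R ^+ 3)).
  pose f i j := 128 * kap ^+ 3 * ((p i * (a i)%:R ^+ 3 * (1 + kap) ^+ a i)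
                            * (p j * (a j)%:R ^+ 0 * (1 + kap) ^+ a j)).
  transitivity (\sum_i \sum_j (f i j + f j i)).
    under eq_bigr do rewrite big_split; rewrite big_split /=.
    have e : \sum_i \sum_j f i j = 128 * kap ^+ 3 * emom p a 3 kap * emom p a 0 kap.
      rewrite /emom -mulrA big_distrlr mulr_sumr; apply: eq_bigr => i _.
      by rewrite mulr_sumr.
    by rewrite [X in _ + X]exchange_big /= e; ring.
  by apply: eq_bigr => i _; apply: eq_bigr => j _; rewrite /f !expr0; ring.
rewrite -big_split; apply: ler_sum => i _; rewrite -big_split; apply: ler_sum => j _.
rewrite !mulr1 /= [leLHS](_ : _ = p i * p j * (c i * c j * Re ((1 + z) ^+ a i * ((1 + z) ^+ a
  j)^*%C))); last by ring.
rewrite -mulrDr; apply: ler_wpM2l; first by rewrite mulr_ge0.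
have := Re_pow_conj_ge (a i) (a j) hx hk.
set A := _ * _ * _ * _; set r := Re _ => hA.
have -> : 128 * kap ^+ 3 * ((1 + kap) ^+ a i * (1 + kap) ^+ a j)
     * ((a i)%:R ^+ 3 + (a j)%:R ^+ 3) = 2 * A by rewrite /A; ring.
have A0 : 0 <= A.
  have k0 : 0 <= kap by apply: le_trans hz; exact: cmod_ge0.
  by rewrite /A !mulr_ge0 // ?addr_ge0 // ?exprn_ge0 // addr_ge0.
have cc : `|c i * c j| <= 1 by rewrite normrM mulr_ile1.
move: cc; rewrite ler_norml; move: (c i * c j) => g; nra.
Qed.

Lemma pow1D_taylor2 (z : C) kap (a : nat) : cmod z <= kap ->
  cmod ((1 + z) ^+ a - (1 + a%:R * z + 'C(a, 2)%:R * z ^+ 2)) <=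
  a%:R ^+ 3 * kap ^+ 3 * (1 + kap) ^+ a.
Proof.
move=> hz; have k0 : 0 <= kap by apply: le_trans hz; exact: cmod_ge0.
elim: a => [|a IH].
  by rewrite !expr0 bin0n !mul0r !addr0 subrr cmod0 mulr1 expr0n mul0r.
(* The remainders satisfy E_(a+1) = (1 + z) E_a + C(a, 2) z^3, and a^3 + a^2 <= (a + 1)^3 closes the
   induction. *)
rewrite (_ : _ - _ = (1 + z) * ((1 + z) ^+ a - (1 + a%:R * z + 'C(a, 2)%:R * z ^+ 2))
   + 'C(a, 2)%:R * z ^+ 3); last first.
  by rewrite exprS binS bin1 natrD -natr1; ring.
apply: le_trans (cmodD _ _) _; rewrite (cmodM (1 + z)) (cmodM _ (z ^+ 3)) cmod_nat (cmodX z 3).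
have x1 : cmod (1 + z) <= 1 + kap.
  by apply: le_trans (cmodD _ _) _; rewrite cmod1 lerD2l.
have h1 : cmod (1 + z) * cmod ((1 + z) ^+ a - (1 + a%:R * z + 'C(a, 2)%:R * z ^+ 2)) <=
  (1 + kap) * (a%:R ^+ 3 * kap ^+ 3 * (1 + kap) ^+ a).
  by apply: ler_pM; rewrite ?cmod_ge0.
have h2 : 'C(a, 2)%:R * cmod z ^+ 3 <= a%:R ^+ 2 * kap ^+ 3 * (1 + kap) ^+ a.+1.
  rewrite -[leLHS]mulr1; apply: ler_pM.
  - by rewrite mulr_ge0 // exprn_ge0 // cmod_ge0.
  - by [].
  - apply: ler_pM; rewrite ?exprn_ge0 ?cmod_ge0 // ?lerXn2r ?nnegrE ?cmod_ge0 //.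
    rewrite -natrX ler_nat bin2 (leq_trans (half_leq (leq_mul (leqnn a) (leq_pred a)))) //.
    by rewrite -mulnn; apply: leq_trans (half_leq (leqnn _)) _; rewrite -divn2 leq_div.
  - by rewrite exprn_ege1 // lerDl.
apply: le_trans (lerD h1 h2) _.
rewrite [leLHS](_ : _ = (a%:R ^+ 3 + a%:R ^+ 2) * (kap ^+ 3 * (1 + kap) ^+ a.+1)); last first.
  by rewrite (exprS (1 + kap) a); ring.
rewrite -mulrA ler_wpM2r //; first by rewrite mulr_ge0 // exprn_ge0 // addr_ge0.
rewrite -natr1; have := ler0n R a; move: (a%:R) => t; nra.
Qed.

Lemma genfun_taylor2 p a (z : C) kap : (forall i, 0 <= p i) -> \sum_i p i = 1 ->
  cmod z <= kap ->
  cmod (genfun p a (fun=> 1) (1 + z)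
     - (1 + (\sum_i p i * (a i)%:R)%:C * z + (\sum_i p i * 'C(a i, 2)%:R)%:C * z ^+ 2))
  <= kap ^+ 3 * emom p a 3 kap.
Proof.
move=> p0 p1 hz.
have -> : 1 + (\sum_i p i * (a i)%:R)%:C * z + (\sum_i p i * 'C(a i, 2)%:R)%:C * z ^+ 2
    = \sum_i (p i)%:C * (1 + (a i)%:R * z + 'C(a i, 2)%:R * z ^+ 2).
  transitivity ((\sum_i p i)%:C + (\sum_i p i * (a i)%:R)%:C * z +
    (\sum_i p i * 'C(a i, 2)%:R)%:C * z ^+ 2); first by rewrite p1.
  rewrite !rc_sum !mulr_suml -!big_split; apply: eq_bigr => i _ /=.
  by rewrite !rcM !rc_nat; ring.
rewrite /genfun /emom -sumrB mulr_sumr.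
apply: le_trans (cmod_sum _ _ _) _; apply: ler_sum => i _.
rewrite mulr1 -mulrBr cmodM cmodR ger0_norm //.
rewrite [leRHS](_ : _ = p i * ((a i)%:R ^+ 3 * kap ^+ 3 * (1 + kap) ^+ a i)); last by ring.
by rewrite ler_wpM2l // pow1D_taylor2.
Qed.

End FiniteLaw.

(** * Weyl differencing for quadratic phases *)

Section UnitPowers.
Context {R : realType}.
Local Notation C := R[i].
Implicit Types (b c w e eta : C).

Lemma ler_subsum_nat (F : nat -> R) m n N : (forall i, 0 <= F i) -> (m <= n <= N)%N ->
  \sum_(m <= i < n) F i <= \sum_(0 <= i < N) F i.
Proof.
move=> F0 /andP[mn nN]; rewrite [leRHS](big_cat_nat (n := n)) //=.
rewrite [X in _ <= X + _](big_cat_nat (n := m)) //=.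
have := sumr_ge0 (index_iota 0 m) (P := xpredT) (F := F) (fun i _ => F0 i).
have := sumr_ge0 (index_iota n N) (P := xpredT) (F := F) (fun i _ => F0 i).
by lra.
Qed.

Lemma sumr_const_natr (x : R) m n : \sum_(m <= i < n) x = (n - m)%:R * x.
Proof. by rewrite sumr_const_nat mulr_natl. Qed.

Lemma sum_nat_shift (F : nat -> R) m n :
  \sum_(m <= k < m + n) F k = \sum_(0 <= k < n) F (m + k)%N.
Proof.
by rewrite -{1}[m]add0n big_addn addKn; apply: eq_bigr => k _; rewrite addnC.
Qed.

Lemma sum_nat_double (F : nat -> R) n :
  \sum_(0 <= i < n.*2) F i = \sum_(0 <= i < n) (F i.*2 + F i.*2.+1).
Proof.
elim: n => [|n IH]; first by rewrite !big_geq.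
by rewrite doubleS !big_nat_recr //= IH addrA.
Qed.

(** In b^m - 1 = (b - 1) S, the geometric sum S differs from m by at most m^2 |b - 1| / 2 <= m /
    2. *)
Lemma unit_pow_dist_ge b m : cmod b = 1 -> m%:R * cmod (b - 1) <= 1 ->
  m%:R * cmod (b - 1) / 2 <= cmod (b ^+ m - 1).
Proof.
move=> b1 h.
have hS n : cmod (\sum_(i < n) b ^+ i - n%:R) <= n%:R ^+ 2 * cmod (b - 1) / 2.
  elim: n => [|n IH]; first by rewrite big_ord0 subrr cmod0 expr0n !mul0r.
  rewrite big_ord_recr -natr1 /= (_ : _ - _ = (\sum_(i < n) b ^+ i - n%:R) + (b ^+ n - 1)); last by ring.
  apply: le_trans (cmodD _ _) _.
  have := @unit_pow_dist _ b n; rewrite b1 lexx => /(_ isT) h1.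
  move: h1 IH (cmod_ge0 (b - 1)); rewrite -(natr1 n);
    move: (n%:R) (cmod (b - 1)) (cmod _) (cmod _) => t x u v; nra.
have hm := hS m.
have l : m%:R / 2 <= cmod (\sum_(i < m) b ^+ i).
  have := cmod_lerB m%:R (\sum_(i < m) b ^+ i); rewrite cmod_nat cmod_distC => h2.
  move: hm h2 h (ler0n R m) (cmod_ge0 (b - 1)); move: (m%:R) => t; nra.
by rewrite subrX1 cmodM mulrAC mulrC ler_wpM2l // cmod_ge0.
Qed.

Lemma sqr_dist_half (x y z : C) :
  2^-1 * cmod (x - y) ^+ 2 <= cmod (x - z) ^+ 2 + cmod (y - z) ^+ 2.
Proof.
have := cmod_dist_trans z x y; rewrite (cmod_distC z y).
move: (cmod_ge0 (x - z)) (cmod_ge0 (y - z)) (cmod_ge0 (x - y)).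
move: (cmod (x - z)) (cmod (y - z)) (cmod (x - y)) => u v t u0 v0 t0 h.
have : t ^+ 2 <= (u + v) ^+ 2 by rewrite lerXn2r ?nnegrE ?addr_ge0.
by have := sqr_ge0 (u - v); lra.
Qed.

(** If K |b - 1| <= 1, the terms k and k + K cannot both be small, since c b^k and c b^(k + K) are
    |b^K - 1| apart. Otherwise the geometric sum of the c b^k has modulus at most 2 / |b - 1| <= 2
    K, which leaves at least half of the total 8 K. *)
Lemma sum_unit_pow_dist b c K : cmod b = 1 -> cmod c = 1 -> (0 < K)%N ->
  K%:R / 8 * Num.min 1 (K%:R * cmod (b - 1)) ^+ 2 <=
  \sum_(0 <= k < 4 * K) cmod (c * b ^+ k - 1) ^+ 2.
Proof.
move=> b1 c1 K0; have K0R : 0 < K%:R :> R by rewrite ltr0n.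
set x := cmod (b - 1); have x0 : 0 <= x by exact: cmod_ge0.
have [h|h] := leP (K%:R * x) 1.
  apply: (@le_trans _ _ (\sum_(0 <= k < K + K) cmod (c * b ^+ k - 1) ^+ 2)); last first.
    by apply: ler_subsum_nat => [k|]; [exact: sqr_ge0|lia].
  rewrite (big_cat_nat (n := K)) //=; last by lia.
  rewrite [X in _ + X](_ : _ = \sum_(0 <= k < K) cmod (c * b ^+ (k + K) - 1) ^+ 2); last first.
    by rewrite -{1}[K]add0n big_addn addnK.
  rewrite -big_split /=.
  apply: (@le_trans _ _ (\sum_(0 <= k < K) 2^-1 * (K%:R * x / 2) ^+ 2)).
    by rewrite sumr_const_natr subn0; nra.
  apply: ler_sum => k _; apply: le_trans (sqr_dist_half _ _ _).
  rewrite ler_wpM2l // lerXn2r ?nnegrE ?cmod_ge0 //; first by rewrite !mulr_ge0.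
  rewrite exprD mulrA -[X in X - _]mulr1 -mulrBr !cmodM cmodX b1 c1 expr1n !mul1r.
  by rewrite cmod_distC unit_pow_dist_ge.
rewrite expr1n mulr1.
have e k : cmod (c * b ^+ k - 1) ^+ 2 = 2 - 2 * Re (c * b ^+ k).
  have : cmod (c * b ^+ k) ^+ 2 = 1 by rewrite cmodM cmodX b1 c1 !expr1n mulr1 expr1n.
  rewrite !cmod_sqr ReB ImB /=; move: (Re _) (Im _) => u v; nra.
under eq_bigr do rewrite e.
rewrite sumrB -mulr_sumr -Re_sum -mulr_sumr sumr_const_natr subn0 big_mkord.
set S := \sum_(_ < _) _.
have hS : cmod (c * S) * x <= 2.
  rewrite /x -cmodM (_ : c * S * (b - 1) = c * ((b - 1) * S)); last by ring.
  by rewrite -subrX1 cmodM c1 mul1r unit_dist_le2 ?cmodX ?b1 ?expr1n ?cmod1.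
have := Re_le_cmod (c * S); rewrite ler_norml => /andP[_ hr].
have : cmod (c * S) <= 2 * K%:R by nra.
by rewrite natrM; lra.
Qed.

(** If 4 K |eta - 1| <= 1, the powers with m >= K have moved away from 1 by at least K |eta - 1| /
    2. Otherwise the powers of exponents 2 i + 1 and 2 i + 2 are more than 1 / (4 K) apart, so one
    of them is at least 1 / (8 K) away from 1. *)
Lemma sum_min_unit_pow eta K : cmod eta = 1 -> (0 < K)%N ->
  K%:R / 64 * Num.min 1 (K%:R ^+ 2 * cmod (eta - 1)) ^+ 2 <=
  \sum_(0 <= m < 4 * K) Num.min 1 (K%:R * cmod (eta ^+ m.+1 - 1)) ^+ 2.
Proof.
move=> e1 K0; have K1R : 1 <= K%:R :> R by rewrite ler1n.
have mn0 (t : R) : 0 <= t -> 0 <= Num.min 1 t by move=> t0; rewrite le_min ler01.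
set y := cmod (eta - 1); have y0 : 0 <= y by exact: cmod_ge0.
have M0 : 0 <= Num.min 1 (K%:R ^+ 2 * y) by rewrite mn0 // mulr_ge0 // exprn_ge0.
have [h|h] := leP (4 * K%:R * y) 1.
  apply: (@le_trans _ _ (\sum_(K <= m < 4 * K) 4^-1 * Num.min 1 (K%:R ^+ 2 * y) ^+ 2)).
    rewrite sumr_const_natr natrB ?natrM; last by lia.
    by move: (Num.min _ _) M0 => M M0; nra.
  apply: le_trans (@ler_subsum_nat _ K (4 * K) _ _ _); first last.
  - by lia.
  - by move=> m; rewrite sqr_ge0.
  rewrite !big_nat; apply: ler_sum => m /andP[m1 m2].
  rewrite (_ : 4^-1 = 2^-1 ^+ 2 :> R); last by field.
  rewrite -exprMn lerXn2r ?nnegrE ?mulr_ge0 ?mn0 ?mulr_ge0 ?cmod_ge0 ?exprn_ge0 //.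
  have hm : m.+1%:R * y / 2 <= cmod (eta ^+ m.+1 - 1).
    apply: unit_pow_dist_ge => //; apply: le_trans h; rewrite ler_wpM2r //.
    by rewrite -natrM ler_nat.
  have hK : K%:R <= m.+1%:R :> R by rewrite ler_nat; lia.
  rewrite le_min; apply/andP; split.
    have : Num.min 1 (K%:R ^+ 2 * y) <= 1 by rewrite ge_min lexx.
    by lra.
  have : Num.min 1 (K%:R ^+ 2 * y) <= K%:R ^+ 2 * y by rewrite ge_min lexx orbT.
  move: (Num.min _ _) hm hK => M; move: (m.+1%:R) (cmod _) => t u h1 h2 h3.
  have : K%:R * y / 2 <= u by nra.
  by nra.
apply: (@le_trans _ _ (K%:R / 64)).
  rewrite ler_piMr ?divr_ge0 // expr_le1 // ge_min lexx //.
rewrite (_ : 4 * K = (2 * K).*2)%N; last by lia.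
rewrite sum_nat_double.
apply: (@le_trans _ _ (\sum_(0 <= i < 2 * K) 64^-1)).
  by rewrite sumr_const_natr subn0 natrM; lra.
apply: ler_sum => i _.
have : y <= cmod (eta ^+ i.*2.+1 - 1) + cmod (eta ^+ i.*2.+2 - 1).
  have -> : y = cmod (eta ^+ i.*2.+2 - eta ^+ i.*2.+1).
    by rewrite exprS -[X in _ - X]mul1r -mulrBl cmodM cmodX e1 expr1n mulr1.
  by apply: le_trans (cmod_dist_trans 1 _ _) _; rewrite (cmod_distC 1) [leLHS]addrC.
have key (t : R) : 8^-1 <= t -> 64^-1 <= Num.min 1 t ^+ 2.
  move=> ht; rewrite (_ : 64^-1 = 8^-1 ^+ 2 :> R); last by field.
  rewrite lerXn2r ?nnegrE ?invr_ge0 ?mn0 //; first by lra.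
  by rewrite le_min ht andbT; lra.
move: (cmod_ge0 (eta ^+ i.*2.+1 - 1)) (cmod_ge0 (eta ^+ i.*2.+2 - 1)).
move: (cmod (eta ^+ i.*2.+1 - 1)) (cmod (eta ^+ i.*2.+2 - 1)) => u v u0 v0 huv.
have [hu|hu] := leP (8^-1) (K%:R * u).
  by apply: le_trans (key _ hu) _; rewrite lerDl sqr_ge0.
have [hv|hv] := leP (8^-1) (K%:R * v).
  by apply: le_trans (key _ hv) _; rewrite lerDr sqr_ge0.
nra.
Qed.

(* For fixed m the summand is |u b^k - 1|^2 with b = (w^2)^(m+1) and |u| = 1, so e plays
   no role in the bound. *)
Lemma sum_quadratic_phase w e K : cmod w = 1 -> cmod e = 1 -> (0 < K)%N ->
  K%:R ^+ 2 / 512 * Num.min 1 (K%:R ^+ 2 * cmod (w ^+ 2 - 1)) ^+ 2 <=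
  \sum_(0 <= m < 4 * K) \sum_(0 <= k < 4 * K)
    cmod (w ^+ ((k + m.+1) ^ 2) * e ^+ (k + m.+1) - w ^+ (k ^ 2) * e ^+ k) ^+ 2.
Proof.
move=> w1 e1 K0; have K0R : 0 <= K%:R :> R by [].
have h1 := @sum_min_unit_pow (w ^+ 2) K _ K0.
rewrite cmodX w1 expr1n in h1.
apply: le_trans (_ : K%:R / 8 * (K%:R / 64 * Num.min 1 (K%:R ^+ 2 * cmod (w ^+ 2 - 1)) ^+ 2) <= _).
  by apply: eqW_le; field.
apply: le_trans (ler_wpM2l _ (h1 erefl)) _; first by rewrite divr_ge0.
rewrite mulr_sumr; apply: ler_sum => m _.
have h2 := @sum_unit_pow_dist ((w ^+ 2) ^+ m.+1) (w ^+ (m.+1 ^ 2) * e ^+ m.+1) K _ _ K0.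
apply: le_trans (h2 _ _) _; rewrite ?cmodM ?cmodX ?w1 ?e1 ?expr1n ?mulr1 //.
apply: eqW_le; apply: eq_bigr => k _; congr (_ ^+ 2).
rewrite (_ : w ^+ ((k + m.+1) ^ 2) * e ^+ (k + m.+1) - w ^+ (k ^ 2) * e ^+ k =
  (w ^+ (k ^ 2) * e ^+ k) * (w ^+ (m.+1 ^ 2) * e ^+ m.+1 * ((w ^+ 2) ^+ m.+1) ^+ k - 1)).
  by rewrite cmodM (cmodM (w ^+ _)) !cmodX w1 e1 !expr1n !mul1r.
rewrite mulrBr mulr1 -!exprM (_ : (k + m.+1) ^ 2 = k ^ 2 + m.+1 ^ 2 + 2 * (m.+1 * k))%N; last by lia.
rewrite (exprD w (k ^ 2 + m.+1 ^ 2)) (exprD w (k ^ 2)) (exprD e);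
  move: (w ^+ (k ^ 2)) (w ^+ (m.+1 ^ 2)) (w ^+ (2 * (m.+1 * k))) => A B D.
move: (e ^+ k) (e ^+ m.+1) => E F; ring.
Qed.

End UnitPowers.

(** * Elementary real inequalities and sums of r^(k^2) *)

Section RealInequalities.
Context {R : realType}.
Implicit Types (r t u kap : R).

Lemma bernoulli_le t m : t <= 1 -> 1 - m%:R * t <= (1 - t) ^+ m.
Proof.
move=> t1; elim: m => [|m IH]; first by rewrite mul0r subr0 expr0.
rewrite exprSr -natr1; have t0 : 0 <= 1 - t by lra.
apply: le_trans (ler_wpM2r t0 IH).
have := ler0n R m; nra.
Qed.

(** Bernoulli's inequality gives only 0 when m t = 1; it is applied to half the exponent, rounded
    up, and the resulting bound 1/4 is squared. *)
Lemma pow_subr1_ge t m : 0 <= t <= 2^-1 -> m%:R * t <= 1 -> 16^-1 <= (1 - t) ^+ m.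
Proof.
move=> /andP[t0 t1] hm.
have b : 4^-1 <= (1 - t) ^+ (m.+1)./2.
  apply: le_trans (bernoulli_le _ _); last by lra.
  have h : (m.+1)./2%:R * 2 <= m%:R + 1 :> R.
    by rewrite -natrM natr1 ler_nat muln2 -[leqRHS]odd_double_half leq_addl.
  by nra.
have hp : (1 - t) ^+ ((m.+1)./2.*2) <= (1 - t) ^+ m.
  apply: ler_wiXn2l; rewrite ?subr_ge0; first by lra.
    by lra.
  by have := odd_double_half m.+1; case: (odd _) => /=; lia.
apply: le_trans hp; rewrite -muln2 exprM (_ : 16^-1 = 4^-1 ^+ 2 :> R); last by field.
by rewrite lerXn2r ?nnegrE ?exprn_ge0 ?subr_ge0 //; lra.
Qed.

Lemma pow_subr1_geM t m c : 0 <= t <= 2^-1 -> m%:R * t <= 1 ->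
  16^-1 ^+ c <= (1 - t) ^+ (m * c).
Proof.
move=> t0 /(pow_subr1_ge t0) h.
by rewrite exprM lerXn2r ?nnegrE ?exprn_ge0 ?subr_ge0 //; lra.
Qed.

Lemma exprn_le_fact_expR u n : 0 <= u -> u ^+ n <= n`!%:R * expR u.
Proof.
move=> u0; case: n => [|n]; first by rewrite expr0 fact0 mul1r -expR0 ler_expR.
have := @expR_ge1Dxn R u n u0; rewrite addrC -lerBrDr => h.
rewrite mulrC -ler_pdivrMr ?ltr0n ?fact_gt0 //; apply: le_trans h _.
by rewrite lerBlDr lerDl.
Qed.

(** The intermediate bound 2 n / (1 + t n) is made for induction: its increments dominate the
    summands and it stays below 2 / t. *)
Lemma sum_lorentz_nat t J : 0 < t -> \sum_(1 <= k < J.+1) (1 + t ^+ 2 * k%:R ^+ 2)^-1 <= 2 / t.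
Proof.
move=> t0.
have h n : \sum_(1 <= k < n.+1) (1 + t ^+ 2 * k%:R ^+ 2)^-1 <= 2 * n%:R / (1 + t * n%:R).
  elim: n => [|n IH]; first by rewrite big_geq // mulr0 mul0r.
  rewrite big_nat_recr //= -natr1; apply: le_trans (lerD IH (lexx _)) _.
  have n0 := ler0n R n; move: (n%:R) n0 => m m0.
  have d1 : 0 < 1 + t * m by nra.
  have d2 : 0 < 1 + t * (m + 1) by nra.
  have d3 : 0 < 1 + t ^+ 2 * (m + 1) ^+ 2 by nra.
  rewrite -lerBrDl.
  have -> : 2 * (m + 1) / (1 + t * (m + 1)) - 2 * m / (1 + t * m)
     = 2 / ((1 + t * (m + 1)) * (1 + t * m)).
    by field; rewrite !gt_eqF.
  rewrite ler_pdivlMr ?mulr_gt0 // mulrC ler_pdivrMr //.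
  have := sqr_ge0 (t * (m + 1) - 1).
  have : 0 <= t * (1 + t * (m + 1)) by rewrite mulr_ge0 // ltW.
  by lra.
apply: le_trans (h J) _; have d1 : 0 < 1 + t * J%:R by have := ler0n R J; nra.
by rewrite ler_pdivrMr // mulrAC ler_pdivlMr //; nra.
Qed.

(** With u = t k^2, dividing by the extra factor 1 + u leaves a Lorentzian in k, which is
    summable. *)
Lemma poly_exp_lorentz u n : 0 <= u ->
  u ^+ n * (1 + u) <= (2 ^+ n * n`!%:R + 2 ^+ n.+1 * n.+1`!%:R) * expR (u / 2).
Proof.
move=> u0; have v0 : 0 <= u / 2 by rewrite divr_ge0.
rewrite mulrDr mulr1 -exprSr mulrDl.
have h m : u ^+ m <= 2 ^+ m * m`!%:R * expR (u / 2).
  rewrite -{1}(@divfK _ 2 _ u) ?pnatr_eq0 // exprMn mulrC -mulrA ler_wpM2l ?exprn_ge0 //.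
  exact: exprn_le_fact_expR.
exact: lerD.
Qed.

(** The constant of [poly_exp_lorentz], times 4 from the bound on the powers in [sum_sqpow_moment],
    times 2 from [sum_lorentz_nat]. *)
Definition momC (n : nat) : R := 8 * (2 ^+ n * n`!%:R + 2 ^+ n.+1 * n.+1`!%:R).

Lemma momC_ge0 n : 0 <= momC n.
Proof. by rewrite /momC mulr_ge0 // addr_ge0 // mulr_ge0 // exprn_ge0. Qed.

(** As k >= 1, one factor r (1 + kap) <= 2 r can be split off; it keeps the bound proportional to r
    as r tends to 0. Each remaining factor is at most exp(-t / 2), because kap <= t / 4. *)
Lemma sum_sqpow_moment n J r kap (t := 1 - r) : 0 < r < 1 -> 0 <= kap <= t / 4 ->
  \sum_(1 <= k < J.+1) (k ^ 2)%:R ^+ n * (r * (1 + kap)) ^+ (k ^ 2) <=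
  momC n * r / t ^+ n / Num.sqrt t.
Proof.
move=> /andP[r0 r1] /andP[k0 k1]; have t0 : 0 < t by rewrite subr_gt0.
have t1 : t < 1 by rewrite /t; lra.
have s0 : 0 < Num.sqrt t by rewrite sqrtr_gt0.
set x := r * (1 + kap); have x0 : 0 < x by rewrite mulr_gt0 //; lra.
have xr : x <= 2 * r by rewrite /x mulrC ler_wpM2r // ?ltW //; lra.
have xe : x <= expR (- (t / 2)).
  apply: le_trans (expR_ge1Dx _); rewrite /x; move: k1; rewrite /t; nra.
have e1 : expR (t / 2) <= 2.
  apply: (@le_trans _ _ (expR 2^-1)); first by rewrite ler_expR; lra.
  have := @expR_ge1Dx R (- 2^-1); rewrite expRN => h.
  by rewrite -[leLHS]invrK invf_ple ?posrE ?invr_gt0 ?expR_gt0 //; lra.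
set c := 2 ^+ n * n`!%:R + 2 ^+ n.+1 * n.+1`!%:R : R.
have h k : (1 <= k)%N -> (k ^ 2)%:R ^+ n * x ^+ (k ^ 2) <=
   (4 * c * r / t ^+ n) * (1 + Num.sqrt t ^+ 2 * k%:R ^+ 2)^-1.
  move=> k1'; rewrite sqr_sqrtr ?(ltW t0) // (_ : k%:R ^+ 2 = (k ^ 2)%:R :> R); last by rewrite natrX.
  set m := (k ^ 2)%N; have m1 : (0 < m)%N by rewrite expn_gt0 k1'.
  have xm : x ^+ m <= 2 * r * (2 * expR (- (t * m%:R / 2))).
    rewrite -(prednK m1) exprS; apply: ler_pM; rewrite ?exprn_ge0 ?(ltW x0) //.
    apply: (@le_trans _ _ (expR (- (t / 2)) ^+ m.-1)).
      by rewrite lerXn2r ?nnegrE ?expR_ge0 // ltW.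
    rewrite -expRM_natl -(natr1 m.-1).
    rewrite (_ : - (t * (m.-1%:R + 1) / 2) = - (t / 2) + m.-1%:R * - (t / 2)); last by field.
    rewrite expRD expRN mulrA ler_peMl ?expR_ge0 //.
    by rewrite ler_pdivlMr ?expR_gt0 // mul1r.
  have u0 : 0 <= t * m%:R by rewrite mulr_ge0 // ltW.
  have h2 := @poly_exp_lorentz (t * m%:R) n u0; rewrite -/c in h2.
  have d0 : 0 < 1 + t * m%:R by lra.
  rewrite ler_pdivlMr // ler_pdivlMr ?exprn_gt0 //.
  rewrite [leLHS](_ : _ = ((t * m%:R) ^+ n * (1 + t * m%:R)) * x ^+ m); last first.
    by rewrite [(t * _) ^+ n]exprMn; ring.
  apply: le_trans (_ : _ <= c * expR (t * m%:R / 2) * (2 * r * (2 * expR (- (t * m%:R / 2))))) _.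
    by apply: ler_pM; rewrite ?mulr_ge0 ?exprn_ge0 ?(ltW x0) ?(ltW d0).
  rewrite expRN; have := expR_gt0 (t * m%:R / 2); move: (expR _) => E E0.
  by apply: eqW_le; field; rewrite gt_eqF.
rewrite big_nat; apply: le_trans (_ : _ <= \sum_(1 <= k < J.+1) (4 * c * r / t ^+ n) * (1 +
  Num.sqrt t ^+ 2 * k%:R ^+ 2)^-1) _.
  by rewrite [leRHS]big_nat; apply: ler_sum => k /andP[k1' _]; exact: h.
rewrite -mulr_sumr; apply: le_trans (ler_wpM2l _ (sum_lorentz_nat J s0)) _.
  have c0 : 0 <= c by rewrite /c addr_ge0 // mulr_ge0 // exprn_ge0.
  by rewrite divr_ge0 ?exprn_ge0 ?(ltW t0) // mulr_ge0 ?(ltW r0) // mulr_ge0.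
by apply: eqW_le; rewrite /momC -/c; field; rewrite !gt_eqF // exprn_gt0.
Qed.

End RealInequalities.

(** * The truncated Gaussian law: normalisation, moments, decay *)

Section GaussianLaw.
Context {R : realType}.
Local Notation C := R[i].
Implicit Types (r xi : R) (w : C).

(** The integers of [-J, J] are indexed by ordinals, with the origin at index J. The argument is a
    [nat], so that shifts [J + k] can be written without bounds. *)
Definition ks (J i : nat) : int := i%:Z - J%:Z.

Definition asq (J i : nat) : nat := (absz (ks J i) ^ 2)%N.

Definition thetaJ J r : R := \sum_(i < J.*2.+1) r ^+ asq J i.

Definition pJ J r (i : 'I_J.*2.+1) : R := r ^+ asq J i / thetaJ J r.

Definition phase (J : nat) xi w (i : nat) : C :=
  w ^+ asq J i * expi2pi ((ks J i)%:~R * xi).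

Lemma sum_sym J (f : nat -> R) :
  \sum_(i < J.*2.+1) f (absz (ks J i)) = f 0%N + 2 * \sum_(1 <= k < J.+1) f k.
Proof.
rewrite -(big_mkord xpredT (fun i => f (absz (ks J i)))) (big_cat_nat (n := J)) //=; last by lia.
rewrite big_nat_rev /= add0n.
have -> : \sum_(0 <= i < J) f (absz (ks J (J - i.+1))) = \sum_(1 <= k < J.+1) f k.
  rewrite big_add1 /= !big_nat; apply: eq_bigr => i /andP[_ hi].
  by congr f; rewrite /ks; lia.
have -> : \sum_(J <= i < J.*2.+1) f (absz (ks J i)) = f 0%N + \sum_(1 <= k < J.+1) f k.
  rewrite -{1}[J]add0n big_addn (_ : J.*2.+1 - J = J.+1)%N; last by lia.
  rewrite big_nat_recl // add0n; congr (f _ + _); first by rewrite /ks; lia.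
  rewrite big_add1 /=; apply: eq_bigr => i _; congr f; rewrite /ks; lia.
by ring.
Qed.

Lemma asq_shift J k : asq J (J + k) = (k ^ 2)%N.
Proof. by rewrite /asq /ks; congr (_ ^ 2)%N; lia. Qed.

Lemma ks_shift J k : ks J (J + k) = k%:Z.
Proof. by rewrite /ks; lia. Qed.

Lemma thetaJE J r : thetaJ J r = 1 + 2 * \sum_(1 <= k < J.+1) r ^+ (k ^ 2).
Proof. exact: (sum_sym J (fun k => r ^+ (k ^ 2))). Qed.

Lemma thetaJ_ge1 J r : 0 <= r -> 1 <= thetaJ J r.
Proof.
move=> r0; rewrite thetaJE lerDl mulr_ge0 // sumr_ge0 // => k _.
by rewrite exprn_ge0.
Qed.

Lemma pJ_ge0 J r i : 0 <= r -> 0 <= @pJ J r i.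
Proof.
move=> r0; rewrite divr_ge0 ?exprn_ge0 //.
by rewrite (le_trans ler01) // thetaJ_ge1.
Qed.

Lemma pJ_sum1 J r : 0 <= r -> \sum_i @pJ J r i = 1.
Proof.
move=> r0; rewrite -mulr_suml divff // gt_eqF //.
by rewrite (lt_le_trans ltr01) // thetaJ_ge1.
Qed.

(** Keeps the pairs suited to differencing: k is the base point, m + 1 the difference, and 8 K <= J
    keeps both indices in range. *)
Lemma ler_double_subsum J K (F : nat -> nat -> R) : (forall i j, 0 <= F i j) ->
  (8 * K <= J)%N ->
  \sum_(0 <= m < 4 * K) \sum_(0 <= k < 4 * K) F (J + (k + m.+1))%N (J + k)%N <=
  \sum_(i < J.*2.+1) \sum_(j < J.*2.+1) F i j.
Proof.
move=> F0 hK; rewrite exchange_big /= [leRHS]exchange_big /=.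
rewrite -(big_mkord xpredT (fun j => \sum_(i < J.*2.+1) F i j)).
have G0 j : 0 <= \sum_(i < J.*2.+1) F i j by apply: sumr_ge0.
have hJ : (J <= J + 4 * K <= J.*2.+1)%N by lia.
apply: le_trans (@ler_subsum_nat R (fun j => \sum_(i < J.*2.+1) F i j) _ _ _ G0 hJ).
rewrite sum_nat_shift !big_nat; apply: ler_sum => k /andP[_ hk].
rewrite -(big_mkord xpredT (fun i => F i _)).
have hJ2 : (J + k.+1 <= J + k.+1 + 4 * K <= J.*2.+1)%N by lia.
apply: le_trans (@ler_subsum_nat R (fun i => F i (J + k)%N) _ _ _ (fun i => F0 _ _) hJ2).
rewrite sum_nat_shift; apply: ler_sum => m _.
by rewrite (_ : J + (k + m.+1) = J + k.+1 + m)%N //; lia.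
Qed.

(** Let rho be the weight at 2 m - 1. The m weights in [m, 2 m) are at least rho, those below m are
    at most 1. Hence rho times the total mass is at most twice the mass of |k| >= m, where k^2 >=
    m^2. *)
Lemma mean_lower J r m : 0 < r < 1 -> (0 < m)%N -> (m.*2.-1 <= J)%N ->
  m%:R ^+ 2 * r ^+ (m.*2.-1 ^ 2) / 2 <= \sum_i @pJ J r i * (asq J i)%:R.
Proof.
move=> /andP[r0 r1] m0 hm; have th0 : 0 < thetaJ J r.
  by rewrite (lt_le_trans ltr01) // thetaJ_ge1 // ltW.
have -> : \sum_i @pJ J r i * (asq J i)%:R =
    (2 * \sum_(1 <= k < J.+1) (k ^ 2)%:R * r ^+ (k ^ 2)) / thetaJ J r.
  rewrite /pJ; under eq_bigr do rewrite mulrAC.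
  rewrite -mulr_suml; congr (_ / _).
  rewrite (eq_bigr (fun i : 'I_J.*2.+1 => (asq J i)%:R * r ^+ asq J i)) => [|i _]; last by rewrite mulrC.
  by rewrite (sum_sym J (fun k => (k ^ 2)%:R * r ^+ (k ^ 2))) mul0r add0r.
rewrite ler_pdivlMr // thetaJE.
set rho := r ^+ _; have rho0 : 0 < rho by rewrite exprn_gt0.
have rho1 : rho <= 1 by rewrite exprn_ile1 // ltW.
have mJ : (m <= J.+1)%N by lia.
rewrite !(big_cat_nat (n := m) (m := 1) (p := J.+1)) //=.
set A := \sum_(1 <= k < m) r ^+ (k ^ 2); set B := \sum_(m <= k < J.+1) r ^+ (k ^ 2).
have hA : A <= m%:R - 1.
  apply: le_trans (_ : _ <= \sum_(1 <= k < m) 1) _.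
    by apply: ler_sum => k _; rewrite exprn_ile1 // ltW.
  by rewrite sumr_const_natr mulr1 natrB.
have hB : m%:R * rho <= B.
  rewrite (_ : m%:R = (m.*2 - m)%:R); last by congr (_%:R); lia.
  rewrite -sumr_const_natr /B [leRHS](big_cat_nat (n := m.*2)) //=; [|lia|lia].
  rewrite -[leLHS]addr0 lerD ?sumr_ge0 // => [|k _]; last by rewrite exprn_ge0 // ltW.
  rewrite !big_nat; apply: ler_sum => k /andP[_ hk].
  by rewrite ler_wiXn2l ?(ltW r0) ?(ltW r1) // leq_sqr; lia.
have hM : m%:R ^+ 2 * B <= \sum_(m <= k < J.+1) (k ^ 2)%:R * r ^+ (k ^ 2).
  rewrite /B mulr_sumr !big_nat; apply: ler_sum => k /andP[hk _].
  rewrite ler_wpM2r ?exprn_ge0 ?(ltW r0) // natrX lerXn2r ?nnegrE // ler_nat //.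
have hA0 : 0 <= \sum_(1 <= k < m) (k ^ 2)%:R * r ^+ (k ^ 2).
  by apply: sumr_ge0 => k _; apply: mulr_ge0 => //; apply: exprn_ge0; exact: ltW.
apply: le_trans (_ : _ <= m%:R ^+ 2 * (2 * B)) _; last by lra.
rewrite [leLHS](_ : _ = m%:R ^+ 2 * (rho / 2 * (1 + 2 * (A + B)))); last by ring.
apply: ler_wpM2l; first by rewrite exprn_ge0.
have m1 : 1 <= m%:R :> R by rewrite ler1n.
have B0 : 0 <= B by apply: le_trans hB; rewrite mulr_ge0 // ltW.
have rB : rho * B <= B by rewrite ler_piMl.
have rA : rho * A <= rho * (m%:R - 1) by rewrite ler_wpM2l // ltW.
by lra.
Qed.

Section Scale.
Context (J : nat) (r : R).
Hypothesis r01 : 0 < r < 1.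
Hypothesis hJ : 64 <= (1 - r) * J%:R ^+ 2.
Local Notation t := (1 - r).
Local Notation s := (Num.sqrt t).

Let r0 : 0 < r. Proof. by case/andP: r01. Qed.
Let t0 : 0 < t. Proof. by case/andP: r01 => ? ?; rewrite subr_gt0. Qed.
Let t1 : t < 1. Proof. have := r0; lra. Qed.
Let s0 : 0 < s. Proof. by rewrite sqrtr_gt0. Qed.
Let s2 : s ^+ 2 = t. Proof. by rewrite sqr_sqrtr // ltW. Qed.
Let s1 : s < 1.
Proof. by rewrite -(expr_lt1 (n := 2)) ?s2 ?ltW. Qed.

(** K is the integer part of t^(-1/2), the scale on which r^(k^2) stays of constant size when r >=
    1/2; by [hJ] the truncation lies beyond 8 K. *)
Lemma scale_exists : exists K : nat, [/\ (0 < K)%N, K%:R ^+ 2 * t <= 1,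
  1 <= 4 * K%:R ^+ 2 * t, 1 <= 2 * K%:R * s & (8 * K <= J)%N].
Proof.
have si0 : 0 <= s^-1 by rewrite invr_ge0 ltW.
have /andP[h1 h2] := truncn_itv si0; set K := Num.truncn _ in h1 h2.
have K0 : (0 < K)%N.
  rewrite lt0n; apply/eqP => K0; move: h2; rewrite K0 => h2.
  have : 1 < s^-1 by rewrite invf_gt1.
  by lra.
have K1 : 1 <= K%:R :> R by rewrite ler1n.
have Ks : K%:R * s <= 1 by rewrite -ler_pdivlMr ?div1r.
have Ks2 : 1 <= 2 * K%:R * s.
  rewrite -ler_pdivrMr // div1r; apply: le_trans (ltW h2) _; rewrite -natr1; lra.
exists K; split => //.
- by rewrite -s2 -exprMn expr_le1 // mulr_ge0 // ltW.
- rewrite -s2 (_ : 4 * K%:R ^+ 2 * s ^+ 2 = (2 * K%:R * s) ^+ 2); last by ring.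
  by rewrite exprn_ege1.
- rewrite -(ler_nat R) natrM -(@ler_pM2r _ s) //.
  apply: le_trans (_ : _ <= 8) _; first by rewrite -mulrA; lra.
  rewrite -ler_sqr ?nnegrE ?mulr_ge0 ?(ltW s0) // exprMn s2; have := hJ; lra.
Qed.

Definition thetaM : R := 1 + 2 * @momC R 0.

Lemma thetaM_ge1 : 1 <= thetaM.
Proof. by rewrite lerDl mulr_ge0 // momC_ge0. Qed.

Lemma thetaJ_upper : thetaJ J r <= thetaM / s.
Proof.
rewrite thetaJE /thetaM (_ : _ / s = s^-1 + 2 * (momC 0 / s)); last by ring.
apply: lerD.
  by rewrite invf_ge1 // ltW.
rewrite ler_wpM2l //.
have := @sum_sqpow_moment R 0 J r 0 r01.
rewrite lexx divr_ge0 ?(ltW t0) // => /(_ isT).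
rewrite addr0 mulr1 expr0 divr1; under eq_bigr do rewrite expr0 mul1r.
move=> h; apply: le_trans h _; rewrite ler_wpM2r ?invr_ge0 ?(ltW s0) //.
by rewrite ler_piMr ?momC_ge0 //; have := t0; lra.
Qed.

Lemma rpow_lower (K k c : nat) : 2^-1 <= r -> K%:R ^+ 2 * t <= 1 -> (k <= c * K)%N ->
  16^-1 ^+ (c ^ 2) <= r ^+ (k ^ 2).
Proof.
move=> hr hK kK; apply: (@le_trans _ _ (r ^+ (K ^ 2 * c ^ 2))).
  rewrite -[X in X ^+ (K ^ 2 * _)](subKr 1 r).
  by apply: pow_subr1_geM; rewrite ?natrX // (ltW t0) /=; lra.
apply: ler_wiXn2l; rewrite ?(ltW r0) //; first by have := t0; lra.
by rewrite mulnC -expnMn leq_sqr.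
Qed.

Lemma thetaJ_lower : (16 * s)^-1 <= thetaJ J r.
Proof.
have [K [K0 Ks1 Ks2 Ks3 KJ]] := scale_exists.
have [hr|hr] := leP 2^-1 r; last first.
  apply: le_trans (thetaJ_ge1 J (ltW r0)); rewrite invf_le1 ?mulr_gt0 //.
  have : 2^-1 <= s; last by lra.
  by rewrite -ler_sqr ?nnegrE ?(ltW s0) // s2; lra.
rewrite thetaJE; apply: (@le_trans _ _ (K%:R / 8)).
  rewrite -[leLHS]mul1r ler_pdivrMr ?mulr_gt0 //; lra.
have h : \sum_(1 <= k < K.+1) 16^-1 <= \sum_(1 <= k < J.+1) r ^+ (k ^ 2) :> R.
  apply: le_trans (_ : \sum_(1 <= k < K.+1) r ^+ (k ^ 2) <= _).
    rewrite !big_nat; apply: ler_sum => k /andP[_ hk].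
    by rewrite -[16^-1]expr1 -(exp1n 2); apply: (@rpow_lower K); rewrite ?mul1n.
  rewrite [leRHS](big_cat_nat (n := K.+1)) //=; [|lia].
  by rewrite lerDl sumr_ge0 // => k _; rewrite exprn_ge0 // ltW.
by move: h; rewrite sumr_const_natr subSS subn0; lra.
Qed.

Lemma thetaJ_gt0 : 0 < thetaJ J r.
Proof. by rewrite (lt_le_trans ltr01) // thetaJ_ge1 // ltW. Qed.

(** The factor t^(-1/2) of the sum cancels against [thetaJ], which is of at least that order. For n
    > 0 the atom k = 0 does not count, whence the factor r. *)
Lemma moment_upper n kap : (0 < n)%N -> 0 <= kap <= t / 4 ->
  emom (@pJ J r) (asq J) n kap <= 32 * @momC R n * r / t ^+ n.
Proof.
move=> n0 hk.
have -> : emom (@pJ J r) (asq J) n kap =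
    (2 * \sum_(1 <= k < J.+1) (k ^ 2)%:R ^+ n * (r * (1 + kap)) ^+ (k ^ 2)) / thetaJ J r.
  rewrite /emom /pJ; transitivity (\sum_(i < J.*2.+1) ((asq J i)%:R ^+ n * (r * (1 + kap)) ^+ asq
    J i) / thetaJ J r).
    by apply: eq_bigr => i _; rewrite exprMn; ring.
  rewrite -mulr_suml; congr (_ / _).
  rewrite (sum_sym J (fun k => (k ^ 2)%:R ^+ n * (r * (1 + kap)) ^+ (k ^ 2))).
  by rewrite expr0n (gtn_eqF n0) mul0r add0r.
have h := @sum_sqpow_moment R n J r kap r01 hk.
have h2 := thetaJ_lower; have th0 := thetaJ_gt0.
rewrite ler_pdivrMr //.
apply: le_trans (ler_wpM2l _ h) _; first by [].
set X := @momC R n * r / t ^+ n.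
have X0 : 0 <= X.
  by rewrite divr_ge0 ?exprn_ge0 ?mulr_ge0 ?momC_ge0 ?(ltW r0) ?(ltW t0).
have e : s^-1 <= 16 * thetaJ J r.
  by move: h2; rewrite invfM; lra.
rewrite (_ : 32 * @momC R n * r / t ^+ n = 32 * X); last by rewrite /X !mulrA.
have := ler_wpM2l X0 e; lra.
Qed.

Lemma mean_lower_scale : 16^-1 ^+ 4 / 8 * (r / t) <= \sum_i @pJ J r i * (asq J i)%:R.
Proof.
have [K [K0 Ks1 Ks2 Ks3 KJ]] := scale_exists.
set g := 16^-1 ^+ 4 : R.
have g0 : 0 <= g by rewrite exprn_ge0.
have g1 : g <= 1 by rewrite exprn_ile1 //; lra.
(* For r < 1/2 the choice m = 1 suffices, the factor r being the weight at 1; otherwise m is the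
   scale K. *)
have [hr|hr] := leP 2^-1 r; last first.
  have J1 : (1.*2.-1 <= J)%N by clear -K0 KJ; lia.
  apply: le_trans (@mean_lower J r 1 r01 isT J1).
  have -> : 1%:R ^+ 2 * r ^+ (1.*2.-1 ^ 2) / 2 = r / 2 by rewrite expr1n mul1r.
  have rt : r / t <= 2 * r by rewrite ler_pdivrMr //; have := r0; clear g g0 g1; nra.
  have rt0 : 0 <= r / t by rewrite divr_ge0 ?(ltW r0) ?(ltW t0).
  have := ler_piMl rt0 g1; clearbody g; lra.
have hg : g <= r ^+ (K.*2.-1 ^ 2).
  by apply: (@rpow_lower K _ 2) => //; clear; lia.
clearbody g.
have J1 : (K.*2.-1 <= J)%N by clear -K0 KJ; lia.
apply: le_trans (@mean_lower J r K r01 K0 J1).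
apply: (@le_trans _ _ (K%:R ^+ 2 * g / 2)); last by rewrite ler_wpM2r // ler_wpM2l // exprn_ge0.
rewrite mulrA ler_pdivrMr //.
have : g * r <= g * (4 * K%:R ^+ 2 * t) by rewrite ler_wpM2l //; have := t0; lra.
by lra.
Qed.

Lemma phase_unit xi w i : cmod w = 1 -> cmod (phase J xi w i) = 1.
Proof. by move=> w1; rewrite cmodM cmodX w1 expr1n cmod_expi2pi mul1r. Qed.

Lemma phase_shift xi w k : phase J xi w (J + k) = w ^+ (k ^ 2) * expi2pi xi ^+ k.
Proof.
by rewrite /phase asq_shift ks_shift -expi2piMn mulrC [_ * xi]mulrC mulrC.
Qed.

(** 132 = 2 * 8^2 + 4: two weights at distance at most 8 K from the centre, each at least 16^(-64)
    before normalisation, and a numerical factor 16^(-4). *)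
Definition decayC : R := 16^-1 ^+ 132 / thetaM ^+ 2.

(* The defect 1 - |E y|^2 is a weighted sum of |y_i - y_j|^2; the pairs at distance
   O(K) from the centre, with K about (1 - r)^(-1/2), already give the bound. *)
Lemma phase_decay xi w : cmod w = 1 ->
  cmod (\sum_i (@pJ J r i)%:C * phase J xi w i) ^+ 2 <=
  1 - decayC * r * Num.min 1 (cmod (w ^+ 2 - 1) / t) ^+ 2.
Proof.
move=> w1; rewrite (cmod_sqr_mean (pJ_sum1 J (ltW r0))); last first.
  by move=> i; exact: phase_unit.
rewrite lerD2l lerN2.
have [K [K0 Ks1 Ks2 Ks3 KJ]] := scale_exists.
have th0 := thetaJ_gt0; have thu := thetaJ_upper; have M1 := thetaM_ge1.
have M0 : 0 < thetaM by lra.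
pose F i j := r ^+ asq J i / thetaJ J r * (r ^+ asq J j / thetaJ J r) *
  cmod (phase J xi w i - phase J xi w j) ^+ 2.
have F0 i j : 0 <= F i j.
  by rewrite /F mulr_ge0 ?sqr_ge0 // mulr_ge0 // divr_ge0 ?exprn_ge0 ?(ltW r0) ?(ltW th0).
set y := cmod (w ^+ 2 - 1); have y0 : 0 <= y by exact: cmod_ge0.
rewrite -[X in _ <= _ * X]/(\sum_(i < J.*2.+1) \sum_(j < J.*2.+1) F i j).
set S := \sum_(i < _) _; set mu := Num.min 1 _.
have yt0 : 0 <= y / t by rewrite divr_ge0 // ltW.
have mu1 : mu <= 1 by rewrite ge_min lexx.
have muy : mu <= y / t by rewrite ge_min lexx orbT.
have mu0 : 0 <= mu by rewrite le_min ler01.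
set g := 16^-1 ^+ 64 : R.
have g0 : 0 <= g by rewrite exprn_ge0.
have g1 : g <= 1 by rewrite exprn_ile1 //; lra.
have -> : decayC = g ^+ 2 * 16^-1 ^+ 4 / thetaM ^+ 2.
  by rewrite /decayC /g -exprM -exprD.
have [hr|hr] := leP 2^-1 r.
  have hp k : (k <= 8 * K)%N -> g / thetaJ J r <= r ^+ asq J (J + k) / thetaJ J r.
    move=> hk; rewrite asq_shift ler_wpM2r ?invr_ge0 ?(ltW th0) //.
    exact: (@rpow_lower K k 8).
  clearbody g.
  have hS : (g / thetaJ J r) ^+ 2 * (K%:R ^+ 2 / 512 * Num.min 1 (K%:R ^+ 2 * y) ^+ 2) <= S.
    apply: le_trans (ler_double_subsum F0 KJ).
    have e1 : cmod (expi2pi xi) = 1 by exact: cmod_expi2pi.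
    apply: le_trans (ler_wpM2l _ (sum_quadratic_phase w1 e1 K0)) _; first exact: sqr_ge0.
    rewrite mulr_sumr !big_nat; apply: ler_sum => m /andP[_ hm].
    rewrite mulr_sumr !big_nat; apply: ler_sum => k /andP[_ hk].
    rewrite /F !phase_shift ler_wpM2r ?sqr_ge0 // expr2.
    have gt : 0 <= g / thetaJ J r by rewrite divr_ge0 // ltW.
    by apply: ler_pM => //; apply: hp; clear -hm hk; lia.
  have hmin : mu / 4 <= Num.min 1 (K%:R ^+ 2 * y).
    rewrite le_min; apply/andP; split; first by lra.
    have : y / t <= 4 * K%:R ^+ 2 * y.
      by rewrite ler_pdivrMr // mulrAC ler_peMl.
    by lra.
  have hth : g / (2 * thetaM * K%:R) <= g / thetaJ J r.
    rewrite ler_wpM2l // lef_pV2 ?posrE ?mulr_gt0 ?ltr0n //.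
    apply: le_trans thu _; rewrite ler_pdivrMr //.
    rewrite (_ : _ * s = thetaM * (2 * K%:R * s)); last by ring.
    by rewrite ler_peMr // ltW.
  have KR : 0 < K%:R :> R by rewrite ltr0n.
  have q0 : 0 <= K%:R ^+ 2 / 512 :> R by apply: divr_ge0; [exact: sqr_ge0|exact: ler0n].
  have h1 : (g / (2 * thetaM * K%:R)) ^+ 2 * (K%:R ^+ 2 / 512 * (mu / 4) ^+ 2) <= S.
    clearbody S mu; apply: (le_trans _ hS); apply: ler_pM.
    - exact: sqr_ge0.
    - by apply: mulr_ge0; [exact: q0|exact: sqr_ge0].
    - have gt : 0 <= g / (2 * thetaM * K%:R) by rewrite divr_ge0 // !mulr_ge0 // ltW.
      by rewrite lerXn2r ?nnegrE // (le_trans gt).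
    - apply: ler_wpM2l; first exact: q0.
      rewrite lerXn2r ?nnegrE ?divr_ge0 //.
      by rewrite le_min ler01 mulr_ge0 ?sqr_ge0.
  have e1 : (g / (2 * thetaM * K%:R)) ^+ 2 * (K%:R ^+ 2 / 512 * (mu / 4) ^+ 2) =
    2 * (g ^+ 2 * 16^-1 ^+ 4 / thetaM ^+ 2 * mu ^+ 2).
    by field; rewrite !gt_eqF.
  have X0 : 0 <= g ^+ 2 * 16^-1 ^+ 4 / thetaM ^+ 2 * mu ^+ 2.
    by rewrite !mulr_ge0 ?sqr_ge0 ?invr_ge0 ?sqr_ge0 ?exprn_ge0.
  rewrite e1 in h1.
  rewrite [leLHS](_ : _ = (g ^+ 2 * 16^-1 ^+ 4 / thetaM ^+ 2 * mu ^+ 2) * r); last by rewrite mulrAC.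
  move: (g ^+ 2 * 16^-1 ^+ 4 / thetaM ^+ 2 * mu ^+ 2) X0 h1 => X X0 h1.
  have : X * r <= X by rewrite ler_piMr //; have := t0; lra.
  by lra.
(* For r < 1/2 only the atoms at 1 and -1 are compared with the one at 0. The numbers w e and w / e
   cannot both be close to 1, since their product is w^2. *)
have J1 : (J.-1 < J.*2.+1)%N by clear; lia.
have J2 : (J < J.*2.+1)%N by clear; lia.
have Jp : (0 < J)%N by clear -K0 KJ; lia.
have J3 : (J.+1 < J.*2.+1)%N by clear -Jp; lia.
have hS : F J.+1 J + F J.-1 J <= S.
  have hj (i : 'I_J.*2.+1) : F i J <= \sum_(j < J.*2.+1) F i j.
    by rewrite (bigD1 (Ordinal J2)) //= lerDl sumr_ge0.
  rewrite /S (bigD1 (Ordinal J3)) //= [X in _ <= _ + X](bigD1 (Ordinal J1)) /=; last first.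
    by rewrite -val_eqE /=; clear -Jp; lia.
  rewrite addrA; apply: le_trans (_ : _ <= \sum_(j < J.*2.+1) F J.+1 j + \sum_(j < J.*2.+1) F J.-1 j) _.
    exact: lerD (hj (Ordinal J3)) (hj (Ordinal J1)).
  by rewrite lerDl sumr_ge0 // => i _; rewrite sumr_ge0.
have a1 : asq J J.+1 = 1%N by rewrite /asq /ks; clear -Jp; lia.
have a0 : asq J J = 0%N by rewrite /asq /ks; clear -Jp; lia.
have k1 : ks J J.+1 = 1 by rewrite /ks; clear -Jp; lia.
have k0 : ks J J = 0 by rewrite /ks; clear -Jp; lia.
have km : ks J J.-1 = -1.
  by rewrite /ks -[X in _ - X%:Z](prednK Jp); clear; move: (J.-1) => j; lia.
have am : asq J J.-1 = 1%N by rewrite /asq km.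
set e := expi2pi xi.
have e1 : cmod e = 1 by exact: cmod_expi2pi.
have e0 : e != 0 by exact: expi2pi_neq0.
have ev : expi2pi (- xi) = e^-1.
  by apply: (mulfI e0); rewrite -expi2piD subrr expi2pi0 divff.
move: hS; rewrite /F /phase a1 a0 am k1 k0 km !expr0 !expr1 mul0r expi2pi0 mulr1.
rewrite mulN1r mul1r ev (_ : 1%:~R * xi = xi) -?/e -?mulrDr => [hS|]; last by rewrite mulr1z mul1r.
have hy : y ^+ 2 / 2 <= cmod (w * e - 1) ^+ 2 + cmod (w / e - 1) ^+ 2.
  have : y <= cmod (w * e - 1) + cmod (w / e - 1).
    rewrite /y (_ : w ^+ 2 - 1 = (w * e - 1) + (w * e) * (w / e - 1)); last by field.
    by apply: le_trans (cmodD _ _) _; rewrite (cmodM (w * e)) cmodM w1 e1 !mul1r.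
  move: (cmod_ge0 (w * e - 1)) (cmod_ge0 (w / e - 1)).
  move: (cmod (w * e - 1)) (cmod (w / e - 1)) => u v u0 v0 h.
  have : y ^+ 2 <= (u + v) ^+ 2 by rewrite lerXn2r ?nnegrE ?addr_ge0.
  by have := sqr_ge0 (u - v); lra.
have hs : 2^-1 <= s by rewrite -ler_sqr ?nnegrE ?(ltW s0) // s2; lra.
have thM : thetaJ J r <= 2 * thetaM.
  apply: le_trans thu _; rewrite ler_pdivrMr //.
  by rewrite mulrAC ler_peMl ?(ltW M0) //; lra.
have hpp : r / (4 * thetaM ^+ 2) <= r / thetaJ J r / thetaJ J r.
  rewrite -mulrA -invfM ler_wpM2l ?(ltW r0) // lef_pV2 ?posrE ?mulr_gt0 ?exprn_gt0 //.
  rewrite (_ : 4 * thetaM ^+ 2 = (2 * thetaM) * (2 * thetaM)); last by ring.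
  by apply: ler_pM => //; exact: ltW.
have h1 : r / (4 * thetaM ^+ 2) * (y ^+ 2 / 2) <= S.
  apply: (le_trans _ hS); apply: ler_pM => //.
    by rewrite divr_ge0 ?(ltW r0) // mulr_ge0 ?sqr_ge0.
  by rewrite divr_ge0 ?sqr_ge0.
have hmu : mu <= 2 * y.
  apply: le_trans muy _; rewrite ler_pdivrMr //.
  by rewrite mulrAC ler_peMl //; lra.
have hmu2 : mu ^+ 2 <= 4 * y ^+ 2.
  rewrite (_ : 4 * y ^+ 2 = (2 * y) ^+ 2); last by ring.
  by rewrite lerXn2r ?nnegrE ?mulr_ge0.
have rM0 : 0 <= r / thetaM ^+ 2 by rewrite divr_ge0 ?sqr_ge0 // ltW.
have gg : g ^+ 2 * 16^-1 ^+ 4 <= 64^-1.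
  apply: (@le_trans _ _ (1 * 16^-1 ^+ 4)); last by lra.
  by rewrite ler_wpM2r ?exprn_ge0 // expr_le1.
rewrite [leLHS](_ : _ = (g ^+ 2 * 16^-1 ^+ 4) * (r / thetaM ^+ 2 * mu ^+ 2)); last by ring.
apply: le_trans (_ : _ <= 64^-1 * (r / thetaM ^+ 2 * mu ^+ 2)) _.
  by rewrite ler_wpM2r // mulr_ge0 ?sqr_ge0.
have h2 := ler_wpM2l rM0 hmu2.
move: h1; rewrite (_ : r / (4 * thetaM ^+ 2) * (y ^+ 2 / 2) = (r / thetaM ^+ 2 * y ^+ 2) / 8);
  last first.
  by field; rewrite gt_eqF.
move: h2; rewrite mulrCA; lra.
Qed.

End Scale.
End GaussianLaw.

(** * Parity of k, behaviour near w = -1, a priori bound on 1 - r *)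

Section GaussianLawParity.
Context {R : realType}.
Local Notation C := R[i].
Implicit Types (r xi : R) (w x : C).

(** Cosines instead of exponentials: by symmetry of the law the sum is the same ([phi1E]), and the
    coefficients become real of modulus at most 1, as [genfun_sqr_le] requires. *)
Definition phi1 J r xi x : C :=
  genfun (@pJ R J r) (asq J) (fun i => cos (2 * pi * ((ks J i)%:~R * xi))) x.

Definition phi0 J r x : C := genfun (@pJ R J r) (asq J) (fun=> 1) x.

Lemma phi1E J r xi x : phi1 J r xi x = \sum_i (@pJ R J r i)%:C * phase J xi x i.
Proof.
have hrev (i : 'I_J.*2.+1) : ks J (rev_ord i) = - ks J i.
  by rewrite /ks /=; have := ltn_ord i; lia.
have harev (i : 'I_J.*2.+1) : asq J (rev_ord i) = asq J i.
  by rewrite /asq hrev abszN.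
pose f (i : 'I_J.*2.+1) := (@pJ R J r i)%:C * phase J xi x i.
have e2 : \sum_i f i + \sum_i f (rev_ord i) = 2 * phi1 J r xi x.
  rewrite -big_split mulr_sumr; apply: eq_bigr => i _ /=.
  rewrite /f /pJ /phase harev hrev mulrNz mulNr.
  set a := r ^+ _ / _; set z := x ^+ _; set t := _%:~R * xi.
  have -> : (a * cos (2 * pi * t))%:C * z = a%:C * z * (cos (2 * pi * t))%:C.
    by rewrite rcM; ring.
  have -> : 2 * (a%:C * z * (cos (2 * pi * t))%:C) = a%:C * z * (expi2pi t + expi2pi (- t)).
    rewrite [RHS]mulrC mulrCA [in RHS]mulrC; congr (_ * _).
    apply: complex_eqP; rewrite ?ReM ?ImM ?ReD ?ImD /= mulrN ?cosN ?sinN; ring.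
  by rewrite !mulrDr !mulrA.
have e3 : \sum_i f (rev_ord i) = \sum_i f i.
  by rewrite [RHS](reindex_inj rev_ord_inj).
have n2 : 2 != 0 :> C by rewrite pnatr_eq0.
by apply: (mulfI n2); rewrite -e2 e3 mulr_natl.
Qed.

Lemma phi1_0 J r x : phi1 J r 0 x = phi0 J r x.
Proof.
by apply: eq_bigr => i _; rewrite mulr0 mulr0 cos0.
Qed.

Lemma phi1_opp J r xi x : phi1 J r xi (- x) = phi1 J r (xi - 2^-1) x.
Proof.
rewrite !phi1E; apply: eq_bigr => i _; congr (_ * _); rewrite /phase.
have key (k : int) : expi2pi (k%:~R * (- 2^-1) : R) = (-1) ^+ (absz k ^ 2).
  rewrite -signr_odd oddX /= signr_odd.
  have h m : expi2pi (- 2^-1 * m%:R : R) = (-1) ^+ m.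
    rewrite expi2piMn; congr (_ ^+ _).
    have hn : expi2pi (2^-1 : R) != 0 by exact: expi2pi_neq0.
    apply: (mulfI hn); rewrite -expi2piD subrr expi2pi0 expi2pi_half.
    by rewrite mulrNN mulr1.
  case: k => m; first by rewrite mulrC; exact: h.
  rewrite NegzE rmorphN mulrNN -[2^-1]opprK mulrN mulrC.
  have hn : expi2pi (- 2^-1 * m.+1%:R : R) != 0 by exact: expi2pi_neq0.
  apply: (mulfI hn); rewrite -expi2piD subrr expi2pi0 h.
  by rewrite abszN absz_nat -exprMn mulrNN mulr1 expr1n.
rewrite mulrDr expi2piD key /asq (exprNn x).
by move: (expi2pi _) (_ ^+ _) (x ^+ _) => a b c; ring.
Qed.

(** Even m means an odd difference m + 1, hence indices of opposite parity; half of the pairs of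
    [ler_double_subsum] remain. *)
Lemma sumr_odd_even_shift (F : nat -> nat -> R) J K c : (forall i j, 0 <= F i j) ->
  (8 * K <= J)%N ->
  (forall k m, (k < 4 * K)%N -> (m < 4 * K)%N -> ~~ odd m ->
    c <= F (J + (k + m.+1))%N (J + k)%N) ->
  (2 * K * (4 * K))%:R * c <= \sum_(i < J.*2.+1) \sum_(j < J.*2.+1) F i j.
Proof.
move=> F0 hK hc; apply: le_trans (ler_double_subsum F0 hK).
rewrite [X in \sum_(0 <= m < X) _](_ : (4 * K = (2 * K).*2)%N); last by clear; lia.
rewrite sum_nat_double.
apply: (@le_trans _ _ (\sum_(0 <= i < 2 * K) \sum_(0 <= k < (2 * K).*2) c)).
  by apply: eqW_le; rewrite !sumr_const_natr !subn0 mulrA -natrM; congr (_%:R * _); clear; lia.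
apply: ler_sum_nat => i /andP[_ hi].
rewrite -[leLHS]addr0; apply: lerD; last by apply: sumr_ge0 => k _.
rewrite (_ : (2 * K).*2 = 4 * K)%N; last by clear; lia.
apply: ler_sum_nat => k /andP[_ hk].
by apply: hc; rewrite ?odd_double //; clear -hi hk; lia.
Qed.

Context (J : nat) (r : R).
Hypothesis r01 : 0 < r < 1.
Hypothesis hJ : 64 <= (1 - r) * J%:R ^+ 2.
Local Notation t := (1 - r).
Local Notation s := (Num.sqrt t).

(** At w = -1 the bound of [phase_decay] is void, since w^2 = 1. What makes phi0 small there is the
    probability that two independent copies of k have opposite parities. It is bounded below as in
    [phase_decay]: at scale K if r >= 1/2, by the atoms at 0 and 1 otherwise. *)
Lemma parity_mass : @decayC R * r <=
  \sum_(i < J.*2.+1) \sum_(j < J.*2.+1)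
    pJ r i * pJ r j * (odd (asq J i) (+) odd (asq J j))%:R.
Proof.
have /andP[r0 r1] := r01.
have t0 : 0 < t by rewrite subr_gt0.
have s0 : 0 < s by rewrite sqrtr_gt0.
have s2 : s ^+ 2 = t by rewrite sqr_sqrtr // ltW.
have [K [K0 Ks1 Ks2 Ks3 KJ]] := scale_exists r01 hJ.
have th0 := thetaJ_gt0 J r01; have thu := thetaJ_upper J r01; have M1 := thetaM_ge1 (R := R).
have M0 : 0 < @thetaM R by lra.
pose F i j := r ^+ asq J i / thetaJ J r * (r ^+ asq J j / thetaJ J r) *
  (odd (asq J i) (+) odd (asq J j))%:R.
have F0 i j : 0 <= F i j.
  by rewrite /F mulr_ge0 // mulr_ge0 // divr_ge0 ?exprn_ge0 ?(ltW r0) ?(ltW th0).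
rewrite -[leRHS]/(\sum_(i < J.*2.+1) \sum_(j < J.*2.+1) F i j).
set S := \sum_(i < _) _.
set g := 16^-1 ^+ 64 : R.
have g0 : 0 <= g by rewrite exprn_ge0.
have g1 : g <= 1 by rewrite exprn_ile1 //; lra.
have -> : @decayC R = g ^+ 2 * 16^-1 ^+ 4 / @thetaM R ^+ 2.
  by rewrite /decayC /g -exprM -exprD.
have c1 : 16^-1 ^+ 4 <= 4^-1 :> R by lra.
have c0 : 0 <= 16^-1 ^+ 4 :> R by rewrite exprn_ge0.
set c := 16^-1 ^+ 4 : R; rewrite -/c in c0 c1.
have rM0 : 0 <= r / @thetaM R ^+ 2 by rewrite divr_ge0 ?sqr_ge0 // ltW.
have KR : 0 < K%:R :> R by rewrite ltr0n.
have [hr|hr] := leP 2^-1 r.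
  have hp k : (k <= 8 * K)%N -> g / thetaJ J r <= r ^+ asq J (J + k) / thetaJ J r.
    move=> hk; rewrite asq_shift ler_wpM2r ?invr_ge0 ?(ltW th0) //.
    exact: (@rpow_lower _ _ r01 K k 8).
  clearbody g c.
  have gt : 0 <= g / thetaJ J r by rewrite divr_ge0 // ltW.
  have hS : (2 * K * (4 * K))%:R * (g / thetaJ J r) ^+ 2 <= S.
    apply: sumr_odd_even_shift => // k m hk hm om.
    rewrite /F !asq_shift !oddX /= oddD oddS (negbTE om) addbT addNb addbb mulr1.
    rewrite expr2 -!(asq_shift J); apply: ler_pM => //; apply: hp; clear -hk hm; lia.
  have hth : g / (2 * @thetaM R * K%:R) <= g / thetaJ J r.
    rewrite ler_wpM2l // lef_pV2 ?posrE ?mulr_gt0 //.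
    apply: le_trans thu _; rewrite ler_pdivrMr //.
    rewrite (_ : _ * s = @thetaM R * (2 * K%:R * s)); last by ring.
    by rewrite ler_peMr // ltW.
  have gt' : 0 <= g / (2 * @thetaM R * K%:R) by rewrite divr_ge0 // !mulr_ge0 // ltW.
  clearbody S.
  apply: (le_trans _ hS).
  apply: (@le_trans _ _ ((2 * K * (4 * K))%:R * (g / (2 * @thetaM R * K%:R)) ^+ 2)).
    rewrite !natrM (_ : _ * _ ^+ 2 = 2 * (g ^+ 2 / @thetaM R ^+ 2)); last first.
      by field; rewrite !gt_eqF.
    have X0 : 0 <= g ^+ 2 / @thetaM R ^+ 2 by rewrite divr_ge0 ?sqr_ge0.
    rewrite [leLHS](_ : _ = c * r * (g ^+ 2 / @thetaM R ^+ 2)); last by ring.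
    rewrite ler_wpM2r //; nra.
  by rewrite ler_wpM2l // lerXn2r ?nnegrE.
have J2 : (J < J.*2.+1)%N by clear; lia.
have Jp : (0 < J)%N by clear -K0 KJ; lia.
have J3 : (J.+1 < J.*2.+1)%N by clear -Jp; lia.
have hS : F J.+1 J <= S.
  rewrite /S (bigD1 (Ordinal J3)) //= (bigD1 (Ordinal J2)) //= -addrA lerDl addr_ge0 //.
    by rewrite sumr_ge0.
  by apply: sumr_ge0 => i _; apply: sumr_ge0.
have a1 : asq J J.+1 = 1%N by rewrite /asq /ks; clear -Jp; lia.
have a0 : asq J J = 0%N by rewrite /asq /ks; clear -Jp; lia.
move: hS; rewrite /F a1 a0 expr0 expr1 /= mulr1 mul1r => hS.
apply: (le_trans _ hS).
have hs : 2^-1 <= s by rewrite -ler_sqr ?nnegrE ?(ltW s0) // s2; lra.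
have thM : thetaJ J r <= 2 * @thetaM R.
  apply: le_trans thu _; rewrite ler_pdivrMr //.
  by rewrite mulrAC ler_peMl ?(ltW M0) //; lra.
have hpp : r / (4 * @thetaM R ^+ 2) <= r / thetaJ J r / thetaJ J r.
  rewrite -mulrA -invfM ler_wpM2l ?(ltW r0) // lef_pV2 ?posrE ?mulr_gt0 ?exprn_gt0 //.
  rewrite (_ : 4 * @thetaM R ^+ 2 = (2 * @thetaM R) * (2 * @thetaM R)); last by ring.
  by apply: ler_pM => //; exact: ltW.
apply: (le_trans _ hpp).
rewrite (_ : r / (4 * @thetaM R ^+ 2) = 4^-1 * (r / @thetaM R ^+ 2)); last by field; rewrite gt_eqF.
rewrite [leLHS](_ : _ = (g ^+ 2 * c) * (r / @thetaM R ^+ 2)); last by ring.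
rewrite ler_wpM2r //; apply: le_trans c1; rewrite ler_piMl // expr_le1 //.
Qed.

(** For a and b of opposite parity, (-u)^a - (-u)^b is up to sign u^a + u^b, and |u^a + u^b|^2 = 4 -
    |u^a - u^b|^2 is close to 4 for u near 1. [parity_mass] weighs such pairs; the second moment
    bounds the loss. *)
Lemma phi0_near_neg1 (u : C) : cmod u = 1 ->
  cmod (phi0 J r (- u)) ^+ 2 <=
  1 - 2 * @decayC R * r + 32 * @momC R 2 * r / t ^+ 2 * cmod (u - 1) ^+ 2.
Proof.
have /andP[r0 r1] := r01.
have t0 : 0 < t by rewrite subr_gt0.
move=> u1; pose y (i : 'I_J.*2.+1) := (- u) ^+ asq J i.
have -> : phi0 J r (- u) = \sum_i (pJ r i)%:C * y i.
  by apply: eq_bigr => i _; rewrite mulr1.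
rewrite (cmod_sqr_mean (pJ_sum1 J (ltW r0))); last first.
  by move=> i; rewrite cmodX cmodN u1 expr1n.
set D := cmod (u - 1) ^+ 2; have D0 : 0 <= D by exact: sqr_ge0.
have hm : \sum_(i < J.*2.+1) pJ r i * (asq J i)%:R ^+ 2 <= 32 * @momC R 2 * r / t ^+ 2.
  have k0 : (0 : R) <= 0 <= t / 4 by apply/andP; split => //; rewrite divr_ge0 // ltW.
  have hmu := moment_upper r01 hJ (n := 2) isT k0; apply: (le_trans _ hmu); apply: eqW_le.
  by apply: eq_bigr => i _; rewrite addr0 expr1n mulr1.
have hp := parity_mass.
have p0 i : 0 <= @pJ R J r i by apply: pJ_ge0; exact: ltW.
have e : \sum_(i < J.*2.+1) \sum_(j < J.*2.+1) pJ r i * pJ r j *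
    ((asq J i)%:R ^+ 2 + (asq J j)%:R ^+ 2) = 2 * \sum_(i < J.*2.+1) pJ r i * (asq J i)%:R ^+ 2.
  pose f (i : 'I_J.*2.+1) : R := pJ r i * (asq J i)%:R ^+ 2.
  pose q (i : 'I_J.*2.+1) : R := pJ r i.
  have q1 : \sum_i q i = 1 by rewrite pJ_sum1 // ltW.
  have e1 : \sum_i \sum_j f i * q j = \sum_i f i by rewrite -big_distrlr /= q1 mulr1.
  have e2 : \sum_i \sum_j q i * f j = \sum_i f i by rewrite -big_distrlr /= q1 mul1r.
  transitivity (\sum_i \sum_j f i * q j + \sum_i \sum_j q i * f j).
    rewrite -big_split; apply: eq_bigr => i _; rewrite -big_split /=.
    by apply: eq_bigr => j _; rewrite /f /q; ring.
  by rewrite e1 e2; ring.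
have hS : 4 * (@decayC R * r) - D * (2 * \sum_(i < J.*2.+1) pJ r i * (asq J i)%:R ^+ 2) <=
  \sum_(i < J.*2.+1) \sum_(j < J.*2.+1) pJ r i * pJ r j * cmod (y i - y j) ^+ 2.
  apply: le_trans (lerD (ler_wpM2l _ hp) (lexx _)) _; first by [].
  rewrite -e !mulr_sumr -sumrB; apply: ler_sum => i _.
  rewrite !mulr_sumr -sumrB; apply: ler_sum => j _.
  rewrite [leLHS](_ : _ = pJ r i * pJ r j * (4 * (odd (asq J i) (+) odd (asq J j))%:R
      - D * ((asq J i)%:R ^+ 2 + (asq J j)%:R ^+ 2))); last by ring.
  apply: ler_wpM2l; first by apply: mulr_ge0; exact: p0.
  have hd : cmod (u ^+ asq J i - u ^+ asq J j) ^+ 2 <=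
     D * ((asq J i)%:R ^+ 2 + (asq J j)%:R ^+ 2).
    move: (asq J i) (asq J j) => a b; wlog ab : a b / (b <= a)%N.
      move=> h; have [/h //|/ltnW/h {}h] := leqP b a.
      by rewrite cmod_distC [X in _ <= D * X]addrC.
    have -> : u ^+ a - u ^+ b = u ^+ b * (u ^+ (a - b) - 1).
      by rewrite mulrBr mulr1 -exprD subnKC.
    rewrite cmodM cmodX u1 expr1n mul1r.
    have h := @unit_pow_dist _ u (a - b); rewrite u1 lexx in h.
    apply: (@le_trans _ _ ((a%:R * cmod (u - 1)) ^+ 2)).
      rewrite lerXn2r ?nnegrE ?mulr_ge0 ?cmod_ge0 //; apply: le_trans (h isT) _.
      by rewrite ler_wpM2r ?cmod_ge0 // ler_nat leq_subr.
    by rewrite exprMn mulrC ler_wpM2l // lerDl sqr_ge0.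
  have A0 : 0 <= D * ((asq J i)%:R ^+ 2 + (asq J j)%:R ^+ 2).
    by rewrite mulr_ge0 // addr_ge0 // sqr_ge0.
  have [ob|ob] := boolP (odd (asq J i) (+) odd (asq J j)); last first.
    by rewrite mulr0 add0r; apply: le_trans (sqr_ge0 _); rewrite oppr_le0.
  have -> : cmod (y i - y j) ^+ 2 = cmod (u ^+ asq J i + u ^+ asq J j) ^+ 2.
    rewrite /y !(exprNn u) -(signr_odd _ (asq J i)) -(signr_odd _ (asq J j)).
    move: (ob); case: (odd _); case: (odd _) => //= _; rewrite ?expr0 ?expr1 ?mul1r ?mulN1r.
      by rewrite -opprD cmodN.
    by rewrite opprK.
  have p1 : cmod (u ^+ asq J i + u ^+ asq J j) ^+ 2 + cmod (u ^+ asq J i - u ^+ asq J j) ^+ 2 = 4.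
    have : cmod (u ^+ asq J i) ^+ 2 = 1 by rewrite cmodX u1 !expr1n.
    have : cmod (u ^+ asq J j) ^+ 2 = 1 by rewrite cmodX u1 !expr1n.
    rewrite !cmod_sqr; case: (u ^+ _) (u ^+ _) => a b [a' b'] /= h1 h2; lra.
  by rewrite mulr1; lra.
have := ler_wpM2l D0 hm; move: hS; rewrite (mulrC D (_ / _)); lra.
Qed.

(** If m0^2 (1 - r) <= 1, then [mean_lower] would force a mean above X. The bound on 1 - r depends
    on the mean only, which breaks a circle: r depends on J, and J must be large in terms of 1 -
    r. *)
Lemma scale_lower m0 (X : R) : (1 < m0)%N -> (m0.*2 <= J)%N ->
  \sum_i @pJ R J r i * (asq J i)%:R <= X -> 2 * X < m0%:R ^+ 2 * 16^-1 ^+ 4 ->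
  1 < m0%:R ^+ 2 * t.
Proof.
have /andP[r0 r1] := r01.
have t0 : 0 < t by rewrite subr_gt0.
move=> m1 mJ hX hm; rewrite ltNge; apply/negP => h.
have m2 : 4 <= m0%:R ^+ 2 :> R by rewrite -natrX (ler_nat R 4) (@leq_sqr 2).
have hr : 2^-1 <= r by nra.
have J1 : (m0.*2.-1 <= J)%N by clear -mJ; lia.
have m00 : (0 < m0)%N by clear -m1; lia.
have := @mean_lower R J r m0 r01 m00 J1.
have hq : 16^-1 ^+ 4 <= r ^+ (m0.*2.-1 ^ 2).
  by apply: (@rpow_lower _ _ r01 m0 _ 2) => //; clear; lia.
have := ler_wpM2l (sqr_ge0 (m0%:R : R)) hq.
move: hm; set g := 16^-1 ^+ 4 : R; clearbody g => hm; lra.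
Qed.

End GaussianLawParity.

(** * The parameter r with prescribed mean *)

Section MeanSolution.
Context {R : realType}.

(** Multiplied by [thetaJ], the equation is polynomial: the sum of (d k^2 - n) r^(k^2) vanishes. Its
    value is -n at 0 and positive at 1, so the intermediate value theorem applies. *)
Lemma mean_solution (J d n : nat) : (1 <= d)%N -> (1 <= n)%N -> (2 * n <= J)%N ->
  exists r : R, 0 < r < 1 /\ d%:R * (\sum_i @pJ R J r i * (asq J i)%:R) = n%:R.
Proof.
move=> d1 n1 nJ; pose c (k : nat) : R := d%:R * k%:R - n%:R.
pose P : {poly R} := \sum_(i < J.*2.+1) c (asq J i) *: 'X^(asq J i).
have PE x : P.[x] = c 0%N * x ^+ 0 + 2 * \sum_(1 <= k < J.+1) c (k ^ 2)%N * x ^+ (k ^ 2).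
  rewrite horner_sum; under eq_bigr do rewrite hornerZ hornerXn.
  by rewrite (sum_sym J (fun k => c (k ^ 2)%N * x ^+ (k ^ 2))).
have P0 : P.[0] <= 0.
  rewrite PE big_nat big1 => [|k /andP[k1 _]].
    by rewrite mulr0 addr0 /c expr0 mulr1 mulr0 sub0r oppr_le0.
  by rewrite expr0n expn_eq0 (gtn_eqF k1) mulr0.
have P1 : 0 < P.[1].
  rewrite PE; under eq_bigr do rewrite expr1n mulr1.
  rewrite expr0 mulr1 {1}/c mulr0 sub0r sumrB sumr_const_natr subSS subn0.
  (* The term k = J alone outweighs the negative part, as J >= 2 n. *)
  have : (J ^ 2)%:R * d%:R <= \sum_(1 <= k < J.+1) d%:R * (k ^ 2)%:R :> R.
    rewrite big_nat_recr /=; last by clear -nJ n1; lia.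
    by rewrite mulrC lerDr sumr_ge0 // => k _; rewrite mulr_ge0.
  move: (\sum_(_ <= _ < _) _) => S hS.
  have : (n * (2 * J + 1))%:R < (2 * (J ^ 2 * d))%:R :> R by rewrite ltr_nat; clear -d1 n1 nJ; nia.
  by rewrite !natrM natrD !natrM; lra.
have [x /andP[x0 x1] /rootP rx] := @poly_ivt R P 0 1 ler01 (introT andP (conj P0 (ltW P1))).
have xn0 : x != 0.
  apply/eqP => x00; move: rx; rewrite x00 PE big_nat big1 => [|k /andP[k1 _]].
    rewrite mulr0 addr0 /c expr0 mulr1 mulr0 sub0r => /eqP.
    by rewrite oppr_eq0 pnatr_eq0; clear -n1; lia.
  by rewrite expr0n expn_eq0 (gtn_eqF k1) mulr0.
have xn1 : x != 1 by apply/eqP => x11; move: P1; rewrite -x11 rx ltxx.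
have x01 : 0 < x < 1 by rewrite !lt_neqAle eq_sym xn0 xn1 x0 x1.
exists x; split => //.
have th0 := thetaJ_gt0 J x01.
apply: (mulIf (lt0r_neq0 th0)); rewrite -mulrA mulr_suml.
move: rx; rewrite horner_sum /c.
under eq_bigr do rewrite hornerZ hornerXn mulrBl -mulrA.
rewrite sumrB -!mulr_sumr => /eqP; rewrite subr_eq0 => /eqP <-.
congr (_ * _); apply: eq_bigr => i _.
by rewrite /pJ mulrAC divfK ?lt0r_neq0 // mulrC.
Qed.

End MeanSolution.

(** * Cauchy's estimate and Lagrange interpolation *)

Section Interpolation.
Context {R : realType}.
Local Notation C := R[i].

(** [root_filter] writes the coefficient as an average over the circle of radius rho, which the
    triangle inequality bounds. *)
Lemma cauchy_coef (P : {poly C}) (rho B : R) m : 0 <= rho ->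
  (forall x, cmod x <= rho -> cmod P.[x] <= B) -> cmod P`_m * rho ^+ m <= B.
Proof.
move=> rho0 hB.
pose Q := maxn (size P) m.+1.
have sQ : (size P <= Q)%N by rewrite leq_maxl.
have mQ : (m < Q)%N by rewrite leq_maxr.
have Q0 : 0 < Q%:R :> R by rewrite ltr0n (leq_ltn_trans _ mQ).
have := root_filter rho%:C sQ mQ => /(congr1 (@cmod R)).
rewrite cmodM cmod_nat cmodM cmodX cmodR ger0_norm // => e.
rewrite -(ler_pM2l Q0) -e; apply: le_trans (cmod_sum _ _ _) _.
apply: le_trans (_ : \sum_(j < Q) B <= _); last by rewrite sumr_const card_ord mulr_natl.
apply: ler_sum => j _; rewrite cmodM cmodV !cmodX cmod_omega !expr1n invr1 mulr1.
by apply: hB; rewrite cmodM cmodX cmod_omega expr1n mulr1 cmodR ger0_norm.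
Qed.

Definition lagrange T (x : 'I_T -> C) (j : 'I_T) : {poly C} :=
  \prod_(i < T | i != j) ((x j - x i)^-1 *: ('X - (x i)%:P)).

Lemma size_lagrange T (x : 'I_T -> C) j : (size (lagrange x j) <= T)%N.
Proof.
have T0 : (0 < T)%N by apply: leq_ltn_trans (ltn_ord j).
have h (s : seq 'I_T) : (size (\prod_(i <- s | i != j) ((x j - x i)^-1 *: ('X - (x i)%:P)))%R
    <= (count (fun i => i != j) s).+1)%N.
  elim: s => [|i s IH]; first by rewrite big_nil size_poly1.
  rewrite big_cons /=; case: (i != j) => /=; rewrite ?add1n ?add0n //.
  apply: leq_trans (size_polyMleq _ _) _.
  have : (size ((x j - x i)^-1 *: ('X - (x i)%:P))%R <= 2)%N.
    by apply: leq_trans (size_scale_leq _ _) _; rewrite size_XsubC.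
  move: IH; set a := size _; set b := size _; set c := count _ _; clearbody a b c; lia.
apply: leq_trans (h _) _.
have -> : count (fun i => i != j) (index_enum 'I_T) = #|predC1 j|.
  by rewrite -sum1_count -sum1_card; apply: eq_bigl.
by rewrite cardC1 card_ord prednK.
Qed.

Lemma horner_lagrange T (x : 'I_T -> C) i j : injective x ->
  (lagrange x j).[x i] = (i == j)%:R.
Proof.
move=> xi; rewrite /lagrange horner_prod.
have [->|ij] := eqVneq i j.
  apply: big1 => k kj; rewrite hornerZ hornerXsubC mulVf // subr_eq0.
  by apply: contra kj => /eqP/xi ->.
by rewrite (bigD1 i) //= hornerZ hornerXsubC subrr mulr0 mul0r.
Qed.

Lemma lagrange_exact T (x : 'I_T -> C) (k : nat) (z : C) : injective x -> (k < T)%N ->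
  \sum_j (lagrange x j).[z] * x j ^+ k = z ^+ k.
Proof.
move=> xi kT; pose P := \sum_j x j ^+ k *: lagrange x j - 'X^k.
have sP : (size P <= T)%N.
  apply: leq_trans (size_polyD _ _) _; rewrite size_polyN size_polyXn geq_max kT andbT.
  apply: leq_trans (size_sum _ _ _) _; apply/bigmax_leqP => j _.
  by apply: leq_trans (size_scale_leq _ _) (size_lagrange _ _).
have P0 : P = 0.
  apply: (@roots_geq_poly_eq0 _ _ [seq x i | i <- enum 'I_T]).
  - apply/allP => _ /mapP [i _ ->]; apply/rootP; rewrite /P hornerD hornerN hornerXn horner_sum.
    rewrite (bigD1 i) //= hornerZ horner_lagrange // eqxx mulr1 big1 ?addr0 ?subrr // => j ji.
    by rewrite hornerZ horner_lagrange // eq_sym (negbTE ji) mulr0.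
  - by rewrite map_inj_uniq ?enum_uniq.
  - by rewrite size_map size_enum_ord.
have := congr1 (fun p : {poly C} => p.[z]) P0.
rewrite /P hornerD hornerN hornerXn horner_sum horner0 => /eqP.
rewrite subr_eq0 => /eqP <-; apply: eq_bigr => j _; by rewrite hornerZ mulrC.
Qed.

(** Interpolation is exact on monomials of degree below T; by Cauchy's estimate the monomial of
    degree m >= T contributes at most (1 + Lam) B q^m. *)
Lemma interp_error T (x : 'I_T -> C) (P : {poly C}) (z : C) (rho q B Lam : R) :
  injective x -> 0 <= rho -> 0 <= q <= 2^-1 ->
  (forall y, cmod y <= rho -> cmod P.[y] <= B) ->
  (forall j, cmod (x j) <= rho * q) -> cmod z <= rho * q ->
  \sum_j cmod (lagrange x j).[z] <= Lam ->
  cmod (P.[z] - \sum_j (lagrange x j).[z] * P.[x j]) <= 2 * (1 + Lam) * B * q ^+ T.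
Proof.
move=> xi rho0 /andP[q0 q1] hB hx hz hL.
have B0 : 0 <= B by apply: le_trans (hB 0 _); rewrite ?cmod_ge0 ?cmod0.
have L0 : 0 <= Lam by apply: le_trans hL; apply: sumr_ge0 => j _; exact: cmod_ge0.
have e : P.[z] - \sum_j (lagrange x j).[z] * P.[x j] =
    \sum_(0 <= m < size P) P`_m * (z ^+ m - \sum_j (lagrange x j).[z] * x j ^+ m).
  rewrite big_mkord horner_coef.
  have -> : \sum_j (lagrange x j).[z] * P.[x j] =
      \sum_j \sum_(i < size P) (lagrange x j).[z] * (P`_i * x j ^+ i).
    by apply: eq_bigr => j _; rewrite (horner_coef P) mulr_sumr.
  rewrite exchange_big -sumrB; apply: eq_bigr => m _ /=.
  rewrite mulrBr mulr_sumr; congr (_ - _); apply: eq_bigr => j _.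
  by rewrite mulrCA.
have hm m : cmod (P`_m * (z ^+ m - \sum_j (lagrange x j).[z] * x j ^+ m)) <=
    if (m < T)%N then 0 else (1 + Lam) * B * q ^+ m.
  case: ltnP => hmT; first by rewrite lagrange_exact // subrr mulr0 cmod0.
  have rq0 : 0 <= (rho * q) ^+ m by rewrite exprn_ge0 // mulr_ge0.
  have h1 : cmod (z ^+ m - \sum_j (lagrange x j).[z] * x j ^+ m) <= (1 + Lam) * (rho * q) ^+ m.
    apply: le_trans (cmodB _ _) _; rewrite mulrDl mul1r; apply: lerD.
      by rewrite cmodX lerXn2r ?nnegrE ?cmod_ge0 // mulr_ge0.
    apply: le_trans (cmod_sum _ _ _) _.
    apply: le_trans (_ : \sum_j cmod (lagrange x j).[z] * (rho * q) ^+ m <= _).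
      apply: ler_sum => j _; rewrite cmodM ler_wpM2l ?cmod_ge0 //.
      by rewrite cmodX lerXn2r ?nnegrE ?cmod_ge0 // mulr_ge0.
    by rewrite -mulr_suml ler_wpM2r.
  rewrite cmodM; apply: le_trans (ler_wpM2l (cmod_ge0 _) h1) _.
  have h2 := cauchy_coef m rho0 hB.
  rewrite exprMn [leLHS](_ : _ = (1 + Lam) * (cmod P`_m * rho ^+ m) * q ^+ m); last by ring.
  by rewrite ler_wpM2r ?exprn_ge0 // ler_wpM2l // addr_ge0.
(* Since q <= 1/2, q^N is at most 2 (q^N - q^(N + 1)), and the sum telescopes. *)
have geo N : \sum_(0 <= m < N) (if (m < T)%N then 0 else (1 + Lam) * B * q ^+ m) <=
   2 * ((1 + Lam) * B) * (q ^+ T - q ^+ maxn T N).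
  have X0 : 0 <= (1 + Lam) * B by rewrite mulr_ge0 // addr_ge0.
  move: (_ * B) X0 => X X0.
  elim: N => [|N IH]; first by rewrite big_geq // maxn0 subrr mulr0.
  rewrite big_nat_recr //=; apply: le_trans (lerD IH (lexx _)) _.
  case: ltnP => NT; first by rewrite addr0 (maxn_idPl NT).
  rewrite (maxn_idPr (leqW NT)) exprS.
  have : 0 <= X * q ^+ N by rewrite mulr_ge0 // exprn_ge0.
  by move: (q ^+ N) (q ^+ T) => u v; nra.
rewrite e; apply: le_trans (cmod_sum _ _ _) _.
apply: le_trans (ler_sum _ (fun m _ => hm m)) _; apply: le_trans (geo _) _.
rewrite [leRHS](_ : _ = 2 * ((1 + Lam) * B) * q ^+ T); last by ring.
have X0 : 0 <= (1 + Lam) * B by rewrite mulr_ge0 // addr_ge0.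
apply: ler_wpM2l; first by apply: mulr_ge0.
by rewrite gerBl exprn_ge0.
Qed.

Definition node (T : nat) (sig : R) (j : 'I_T) : C := (sig * (j.+1%:R / T%:R))%:C.

Lemma node_inj T sig : 0 < sig -> injective (@node T sig).
Proof.
move=> s0 i j /complexI h; apply: val_inj; apply: succn_inj; apply/eqP.
have T0 : T%:R != 0 :> R by rewrite pnatr_eq0 -lt0n (leq_ltn_trans _ (ltn_ord i)).
rewrite -(eqr_nat R); apply/eqP; apply: (mulIf (invr_neq0 T0)).
exact: (mulfI (lt0r_neq0 s0) h).
Qed.

Lemma node_le T (sig : R) (j : 'I_T) : 0 <= sig -> 0 <= sig * (j.+1%:R / T%:R) <= sig.
Proof.
move=> s0; have T0 : 0 < T%:R :> R by rewrite ltr0n (leq_ltn_trans _ (ltn_ord j)).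
rewrite mulr_ge0 ?divr_ge0 //= ler_piMr // ler_pdivrMr // mul1r ler_nat //.
Qed.

Definition lagrangeC (T : nat) : R := (2 * T%:R) ^+ T * T%:R.

(** Distinct nodes are at least sig / T apart and z is within 2 sig of each, so every factor of a
    Lagrange polynomial is at most 2 T. *)
Lemma lagrange_node_bound T sig z : 0 < sig -> cmod z <= sig ->
  \sum_j cmod (lagrange (@node T sig) j).[z] <= lagrangeC T.
Proof.
move=> s0 hz.
apply: le_trans (_ : \sum_(j < T) (2 * T%:R) ^+ T <= _); last first.
  by rewrite sumr_const card_ord /lagrangeC -[X in X <= _]mulr_natr.
apply: ler_sum => j _; rewrite /lagrange horner_prod cmod_prod.
have T0 : 0 < T%:R :> R by rewrite ltr0n (leq_ltn_trans _ (ltn_ord j)).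
have T1 : 1 <= 2 * T%:R :> R.
  have : 1 <= T%:R :> R by rewrite ler1n -(ltr0n R).
  by lra.
apply: (@le_trans _ _ (\prod_(i < T | i != j) (2 * T%:R))); last first.
  by rewrite prodr_const ler_weXn2l // -[leqRHS]card_ord max_card.
apply: ler_prod => i ij; apply/andP; split; first exact: cmod_ge0.
rewrite hornerZ hornerXsubC cmodM cmodV.
rewrite /node -rcB cmodR -mulrBr -mulrBl normrM (gtr0_norm s0) normrM normfV (gtr0_norm T0).
have d1 : 1 <= `|j.+1%:R - i.+1%:R| :> R.
  have [lij|lji|/val_inj eij] := ltngtP i j; last by rewrite eij eqxx in ij.
    by rewrite -natrB ?ltnS ?(ltnW lij) // normr_nat ler1n subn_gt0.
  by rewrite distrC -natrB ?ltnS ?(ltnW lji) // normr_nat ler1n subn_gt0.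
have d0 : 0 < sig * (`|j.+1%:R - i.+1%:R| / T%:R).
  by rewrite mulr_gt0 // divr_gt0 // (lt_le_trans ltr01).
rewrite mulrC ler_pdivrMr //.
apply: (@le_trans _ _ (2 * sig)).
  apply: le_trans (cmodB _ _) _; have /andP[n0 n1] := node_le i (ltW s0).
  by rewrite cmodR ger0_norm //; lra.
rewrite [leRHS](_ : _ = 2 * sig * `|j.+1%:R - i.+1%:R|); last by field; rewrite gt_eqF.
by rewrite ler_peMr // mulr_ge0 // ltW.
Qed.

End Interpolation.

(** * The normalised generating function on a disc around 1 *)

Section DiscEstimates.
Context {R : realType}.
Local Notation C := R[i].

Definition lawmean J (r : R) : R := \sum_(i < J.*2.+1) pJ r i * (asq J i)%:R.

Definition lawbin2 J (r : R) : R := \sum_(i < J.*2.+1) pJ r i * 'C(asq J i, 2)%:R.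

(* Truncation at order 2 of the inverse of the power series of phi0 at 1 + z. *)
Definition normpoly J (r : R) : {poly C} :=
  1 - (lawmean J r)%:C *: 'X + (lawmean J r ^+ 2 - lawbin2 J r)%:C *: 'X^2.

Definition phipoly J (r xi : R) : {poly C} :=
  \sum_(i < J.*2.+1)
    (pJ r i * cos (2 * pi * ((ks J i)%:~R * xi)))%:C *: (1 + 'X) ^+ asq J i.

Definition fpoly d J (r : R) (xi : 'rV[R]_d) : {poly C} :=
  \prod_(i < d) (normpoly J r * phipoly J r (xi 0 i)).

Lemma horner_normpoly J r z : (normpoly J r).[z] =
  1 - (lawmean J r)%:C * z + (lawmean J r ^+ 2 - lawbin2 J r)%:C * z ^+ 2.
Proof. by rewrite /normpoly !hornerE. Qed.

Lemma horner_phipoly J r xi z : (phipoly J r xi).[z] = phi1 J r xi (1 + z).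
Proof.
rewrite /phipoly horner_sum; apply: eq_bigr => i _.
by rewrite hornerZ horner_exp hornerD hornerX -polyC1 hornerC.
Qed.

Lemma horner_fpoly d J r (xi : 'rV[R]_d) z : (fpoly J r xi).[z] =
  (normpoly J r).[z] ^+ d * \prod_(i < d) phi1 J r (xi 0 i) (1 + z).
Proof.
rewrite /fpoly horner_prod; under eq_bigr do rewrite hornerM horner_phipoly.
by rewrite big_split /= prodr_const card_ord.
Qed.

Definition mc (n : nat) : R := 32 * momC n.

Lemma mc_ge0 n : 0 <= mc n.
Proof. by rewrite mulr_ge0 // momC_ge0. Qed.

(** [discH] bounds [normpoly]; [discE] and [discF] are the cubic coefficients in the bounds for
    normpoly phi0 - 1 and |normpoly phi1|^2 - 1. None depends on J or r. *)
Definition discH : R := 1 + mc 1 + (mc 1 ^+ 2 + mc 2).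
Definition discE : R :=
  discH * mc 3 + ((mc 1 ^+ 2 + mc 2) * mc 1 + mc 1 * mc 2 + (mc 1 ^+ 2 + mc 2) * mc 2).
Definition discF : R :=
  2 * discE + discE ^+ 2 + discH ^+ 2 * (256 * mc 3 * (1 + mc 1)).

Lemma discH_ge1 : 1 <= discH.
Proof.
by rewrite /discH -addrA lerDl !addr_ge0 ?mc_ge0 ?sqr_ge0.
Qed.

Lemma discE_ge0 : 0 <= discE.
Proof.
have h := discH_ge1; have h0 : 0 <= discH by lra.
by rewrite /discE !addr_ge0 // !mulr_ge0 ?addr_ge0 ?mc_ge0 ?sqr_ge0.
Qed.

Lemma discF_ge0 : 0 <= discF.
Proof.
have q : 0 <= 256 * mc 3 * (1 + mc 1).
  by apply: mulr_ge0; [apply: mulr_ge0; [exact: ler0n|exact: mc_ge0]|rewrite addr_ge0 ?mc_ge0].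
rewrite /discF; apply: addr_ge0; last by apply: mulr_ge0 q; exact: sqr_ge0.
by rewrite addr_ge0 ?sqr_ge0 // mulr_ge0 ?discE_ge0.
Qed.

Context (J : nat) (r : R).
Hypothesis r01 : 0 < r < 1.
Hypothesis hJ : 64 <= (1 - r) * J%:R ^+ 2.
Local Notation t := (1 - r).

Let r0 : 0 < r. Proof. by case/andP: r01. Qed.
Let t0 : 0 < t. Proof. by case/andP: r01 => ? ?; rewrite subr_gt0. Qed.

Lemma lawmean_ge0 : 0 <= lawmean J r.
Proof. by apply: sumr_ge0 => i _; rewrite mulr_ge0 // pJ_ge0 // ltW. Qed.

Lemma lawbin2_ge0 : 0 <= lawbin2 J r.
Proof. by apply: sumr_ge0 => i _; rewrite mulr_ge0 // pJ_ge0 // ltW. Qed.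

Lemma emom_upper n kap : (0 < n)%N -> 0 <= kap <= t / 4 ->
  emom (@pJ R J r) (asq J) n kap <= mc n * r / t ^+ n.
Proof. exact: moment_upper. Qed.

Let kap0 : (0 : R) <= 0 <= t / 4.
Proof. by apply/andP; split => //; rewrite divr_ge0 // ltW. Qed.

Lemma lawmean_upper : lawmean J r <= mc 1 * r / t.
Proof.
have := emom_upper (n := 1) isT kap0; rewrite expr1; apply: le_trans.
by apply: eqW_le; apply: eq_bigr => i _; rewrite expr1 addr0 expr1n mulr1.
Qed.

Lemma law_sqr_upper : \sum_(i < J.*2.+1) pJ r i * (asq J i)%:R ^+ 2 <= mc 2 * r / t ^+ 2.
Proof.
have := emom_upper (n := 2) isT kap0; apply: le_trans.
by apply: eqW_le; apply: eq_bigr => i _; rewrite addr0 expr1n mulr1.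
Qed.

Lemma law_cube_upper : \sum_(i < J.*2.+1) pJ r i * (asq J i)%:R ^+ 3 <= mc 3 * r / t ^+ 3.
Proof.
have := emom_upper (n := 3) isT kap0; apply: le_trans.
by apply: eqW_le; apply: eq_bigr => i _; rewrite addr0 expr1n mulr1.
Qed.

Lemma lawbin2_upper : lawbin2 J r <= mc 2 * r / t ^+ 2.
Proof.
apply: (le_trans _ law_sqr_upper); apply: ler_sum => i _.
rewrite ler_wpM2l ?pJ_ge0 ?(ltW r0) // -natrX ler_nat bin2.
apply: (@leq_trans (asq J i * (asq J i).-1)); first by rewrite -divn2 leq_div.
by rewrite -mulnn leq_mul2l leq_pred orbT.
Qed.

(** The inequality (1 + kap)^a <= 1 + kap a (1 + kap)^a reduces to the first moment, whose factor 1
    / t is absorbed by kap. *)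
Lemma emom0_upper kap : 0 <= kap <= t / 4 -> emom (@pJ R J r) (asq J) 0 kap <= 1 + mc 1.
Proof.
move=> hk; have /andP[k0 k1] := hk.
have h1 := emom_upper (n := 1) isT hk.
have hb a : (1 + kap) ^+ a <= 1 + kap * (a%:R * (1 + kap) ^+ a).
  elim: a => [|a IH]; first by rewrite expr0 mul0r mulr0 addr0.
  rewrite exprS -natr1; have : 1 <= (1 + kap) ^+ a by rewrite exprn_ege1 // lerDl.
  move: ((1 + kap) ^+ a) IH (ler0n R a) => X IH a0 X1.
  have : 0 <= kap * kap * (a%:R + 1) * X by rewrite !mulr_ge0 ?addr_ge0 //; lra.
  have : 0 <= kap * X by rewrite mulr_ge0 //; lra.
  by nra.
apply: (@le_trans _ _ (1 + kap * emom (@pJ R J r) (asq J) 1 kap)).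
  have <- : \sum_(i < J.*2.+1) pJ r i * (1 + kap * ((asq J i)%:R * (1 + kap) ^+ asq J i)) =
      1 + kap * emom (@pJ R J r) (asq J) 1 kap.
    transitivity (\sum_(i < J.*2.+1) pJ r i + kap * emom (@pJ R J r) (asq J) 1 kap).
      by rewrite /emom mulr_sumr -big_split; apply: eq_bigr => i _; rewrite expr1 /=; ring.
    by rewrite pJ_sum1 // ltW.
  apply: ler_sum => i _; rewrite expr0 mulr1.
  by rewrite ler_wpM2l ?pJ_ge0 ?(ltW r0).
rewrite lerD2l; rewrite expr1 in h1.
have c0 := mc_ge0 1.
apply: (@le_trans _ _ (t * (mc 1 * r / t))).
  apply: ler_pM => //; last by have := t0; lra.
  by apply: emom_ge0 => // i; rewrite pJ_ge0 // ltW.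
rewrite mulrCA divff ?gt_eqF // mulr1 ler_piMr //; have := t0; lra.
Qed.

Section Radius.
Context (kap : R) (z : C).
Hypothesis hk : 0 <= kap <= t / 4.
Hypothesis hz : cmod z <= kap.
Local Notation x := (kap / t).

Let x0 : 0 <= x. Proof. by case/andP: hk => ? _; rewrite divr_ge0 // ltW. Qed.
Let x4 : x <= 4^-1. Proof. by case/andP: hk => _ ?; rewrite ler_pdivrMr // mulrC. Qed.
Let r1 : r <= 1. Proof. by case/andP: r01 => _ /ltW. Qed.

Let mean_kap : lawmean J r * kap <= mc 1 * r * x.
Proof.
have k0 : 0 <= kap by case/andP: hk.
by apply: le_trans (ler_wpM2r k0 lawmean_upper) _; apply: eqW_le; ring.
Qed.

Let mean2_kap : lawmean J r ^+ 2 * kap ^+ 2 <= mc 1 ^+ 2 * r * x ^+ 2.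
Proof.
have k0 : 0 <= kap by case/andP: hk.
have a0 : 0 <= lawmean J r * kap by rewrite mulr_ge0 ?lawmean_ge0.
rewrite -exprMn; apply: (@le_trans _ _ ((mc 1 * r * x) ^+ 2)).
  by rewrite lerXn2r ?nnegrE // (le_trans a0).
rewrite [leLHS](_ : _ = mc 1 ^+ 2 * r * x ^+ 2 * r); last by ring.
by rewrite ler_piMr // mulr_ge0 ?sqr_ge0 // mulr_ge0 ?sqr_ge0 // ltW.
Qed.

Let bin2_kap : lawbin2 J r * kap ^+ 2 <= mc 2 * r * x ^+ 2.
Proof.
apply: le_trans (ler_wpM2r (sqr_ge0 kap) lawbin2_upper) _.
by apply: eqW_le; field; rewrite gt_eqF.
Qed.

Let nu_kap : `|lawmean J r ^+ 2 - lawbin2 J r| * kap ^+ 2 <= (mc 1 ^+ 2 + mc 2) * r * x ^+ 2.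
Proof.
apply: (@le_trans _ _ ((lawmean J r ^+ 2 + lawbin2 J r) * kap ^+ 2)).
  rewrite ler_wpM2r ?sqr_ge0 //; apply: le_trans (ler_normB _ _) _.
  by rewrite !ger0_norm ?sqr_ge0 ?lawbin2_ge0.
by have := mean2_kap; have := bin2_kap; lra.
Qed.

Let z0 : 0 <= cmod z. Proof. exact: cmod_ge0. Qed.

Let zk n : cmod z ^+ n <= kap ^+ n.
Proof. by rewrite lerXn2r ?nnegrE // (le_trans z0). Qed.

Lemma normpoly_le : cmod (normpoly J r).[z] <= discH.
Proof.
rewrite horner_normpoly; apply: le_trans (cmodD _ _) _.
apply: lerD.
  apply: le_trans (cmodB _ _) _; rewrite cmod1 lerD2l cmodM cmodR ger0_norm ?lawmean_ge0 //.
  apply: (@le_trans _ _ (lawmean J r * kap)); first by rewrite ler_wpM2l ?lawmean_ge0.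
  apply: (le_trans mean_kap); rewrite -mulrA ler_piMr ?mc_ge0 // mulr_ile1 ?(ltW r0) //.
  by have := x4; lra.
rewrite cmodM cmodR cmodX.
apply: (@le_trans _ _ (`|lawmean J r ^+ 2 - lawbin2 J r| * kap ^+ 2)).
  by rewrite ler_wpM2l.
apply: (le_trans nu_kap); rewrite -mulrA ler_piMr ?addr_ge0 ?sqr_ge0 ?mc_ge0 //.
rewrite mulr_ile1 ?(ltW r0) ?sqr_ge0 // expr_le1 //; have := x4; lra.
Qed.

Lemma normpoly_phi0 :
  cmod ((normpoly J r).[z] * phi0 J r (1 + z) - 1) <= discE * r * x ^+ 3.
Proof.
set m := lawmean J r; set b := lawbin2 J r.
set q : C := 1 + m%:C * z + b%:C * z ^+ 2.
have hT : cmod (phi0 J r (1 + z) - q) <= mc 3 * r * x ^+ 3.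
  have := @genfun_taylor2 R _ (@pJ R J r) (fun i => asq J i) z kap.
  move=> /(_ (fun i => pJ_ge0 i (ltW r0)) (pJ_sum1 J (ltW r0)) hz) h.
  apply: le_trans h _; apply: le_trans (ler_wpM2l _ (emom_upper (n := 3) isT hk)) _.
    by rewrite exprn_ge0 //; case/andP: hk.
  by apply: eqW_le; field; rewrite gt_eqF.
(* In the product of [normpoly] with the Taylor polynomial q the terms of order 1 and 2 cancel; the
   Taylor error and the terms of order 3 and 4 remain. *)
have -> : (normpoly J r).[z] * phi0 J r (1 + z) - 1 =
    (normpoly J r).[z] * (phi0 J r (1 + z) - q) +
     (((m ^+ 2 - b)%:C * z ^+ 2) * (m%:C * z) - (m%:C * z) * (b%:C * z ^+ 2)
       + ((m ^+ 2 - b)%:C * z ^+ 2) * (b%:C * z ^+ 2)).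
  by rewrite horner_normpoly -/m -/b /q rcB rcX; ring.
apply: le_trans (cmodD _ _) _.
rewrite (_ : discE * r * x ^+ 3 = discH * (mc 3 * r * x ^+ 3) +
  ((mc 1 ^+ 2 + mc 2) * mc 1 * r * x ^+ 3 + mc 2 * mc 1 * r * x ^+ 3 +
   (mc 1 ^+ 2 + mc 2) * mc 2 * r * x ^+ 3)); last by rewrite /discE; ring.
apply: lerD.
  by rewrite cmodM; apply: ler_pM; rewrite ?cmod_ge0 ?normpoly_le.
have A1 : cmod (m%:C * z) <= mc 1 * r * x.
  rewrite cmodM cmodR ger0_norm ?lawmean_ge0 //; apply: (le_trans _ mean_kap).
  by rewrite ler_wpM2l ?lawmean_ge0.
have A2 : cmod (b%:C * z ^+ 2) <= mc 2 * r * x ^+ 2.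
  rewrite cmodM cmodR ger0_norm ?lawbin2_ge0 //; apply: (le_trans _ bin2_kap).
  by rewrite ler_wpM2l ?lawbin2_ge0 // cmodX.
have A3 : cmod ((m ^+ 2 - b)%:C * z ^+ 2) <= (mc 1 ^+ 2 + mc 2) * r * x ^+ 2.
  rewrite cmodM cmodR; apply: (le_trans _ nu_kap).
  by rewrite ler_wpM2l // cmodX.
have rx3 (a a' : R) : 0 <= a -> 0 <= a' -> (a * r * x ^+ 2) * (a' * r * x) <= a * a' * r * x ^+ 3.
  move=> a0 a'0; rewrite [leLHS](_ : _ = a * a' * r * x ^+ 3 * r); last by ring.
  rewrite ler_piMr //; apply: mulr_ge0; last exact: exprn_ge0.
  by apply: mulr_ge0; [exact: mulr_ge0|exact: ltW].
have rx4 (a a' : R) : 0 <= a -> 0 <= a' -> (a * r * x ^+ 2) * (a' * r * x ^+ 2) <= a * a' * r * x ^+ 3.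
  move=> a0 a'0; rewrite [leLHS](_ : _ = a * a' * r * x ^+ 3 * (r * x)); last by ring.
  rewrite ler_piMr //.
    apply: mulr_ge0; last exact: exprn_ge0.
    by apply: mulr_ge0; [exact: mulr_ge0|exact: ltW].
  by rewrite mulr_ile1 ?(ltW r0) //; have := x4; lra.
have c1 := mc_ge0 1; have c2 := mc_ge0 2.
have c12 : 0 <= mc 1 ^+ 2 + mc 2 by rewrite addr_ge0 ?sqr_ge0.
apply: le_trans (cmodD _ _) _; apply: lerD; last first.
  by rewrite cmodM; apply: (le_trans _ (rx4 _ _ c12 c2)); apply: ler_pM; rewrite ?cmod_ge0.
apply: le_trans (cmodB _ _) _; apply: lerD.
  by rewrite cmodM; apply: (le_trans _ (rx3 _ _ c12 c1)); apply: ler_pM; rewrite ?cmod_ge0.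
rewrite cmodM mulrC; apply: (le_trans _ (rx3 _ _ c2 c1)); apply: ler_pM; rewrite ?cmod_ge0 //.
Qed.

(** [genfun_sqr_le] bounds |phi1|^2 by |phi0|^2 up to a cubic error, uniformly in xi, and normpoly
    phi0 is 1 up to a cubic error. Both errors are proportional to r. *)
Lemma normpoly_phi1 xi :
  cmod ((normpoly J r).[z] * phi1 J r xi (1 + z)) ^+ 2 <= 1 + discF * r * x ^+ 3.
Proof.
have kh : kap <= 2^-1 by case/andP: hk => _; have := r0; have := t0; lra.
have /andP[k0 _] := hk.
have cs (i : 'I_J.*2.+1) : `|cos (2 * pi * ((ks J i)%:~R * xi))| <= 1.
  by rewrite ler_norml cos_geN1 cos_le1.
have h := @genfun_sqr_le R _ (@pJ R J r) (fun i => asq J i) _ z kap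
  (fun i => pJ_ge0 i (ltW r0)) cs hz kh.
have e3 := emom_upper (n := 3) isT hk; have e0 := emom0_upper hk.
have E30 : 0 <= emom (@pJ R J r) (asq J) 3 kap.
  by apply: emom_ge0 => // i; rewrite pJ_ge0 // ltW.
have E00 : 0 <= emom (@pJ R J r) (asq J) 0 kap.
  by apply: emom_ge0 => // i; rewrite pJ_ge0 // ltW.
have h2 : 256 * kap ^+ 3 * emom (@pJ R J r) (asq J) 3 kap * emom (@pJ R J r) (asq J) 0 kap
    <= 256 * mc 3 * (1 + mc 1) * r * x ^+ 3.
  have q0 : 0 <= 256 * kap ^+ 3 by apply: mulr_ge0; [exact: ler0n|exact: exprn_ge0].
  apply: (@le_trans _ _ (256 * kap ^+ 3 * (mc 3 * r / t ^+ 3) * (1 + mc 1))).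
    apply: ler_pM => //; first exact: mulr_ge0.
    exact: ler_wpM2l.
  by apply: eqW_le; field; rewrite gt_eqF.
have hN := normpoly_le; have hE := normpoly_phi0.
have r3 : 0 <= r * x ^+ 3 by rewrite mulr_ge0 ?exprn_ge0 // ltW.
have r31 : r * x ^+ 3 <= 1.
  by rewrite mulr_ile1 ?exprn_ge0 ?(ltW r0) // expr_le1 //; have := x4; lra.
have hE1 : cmod ((normpoly J r).[z] * phi0 J r (1 + z)) <= 1 + discE * r * x ^+ 3.
  have := cmod_lerB ((normpoly J r).[z] * phi0 J r (1 + z)) 1; rewrite cmod1; lra.
have hE2 : cmod ((normpoly J r).[z] * phi0 J r (1 + z)) ^+ 2 <=
    1 + (2 * discE + discE ^+ 2) * r * x ^+ 3.
  apply: (@le_trans _ _ ((1 + discE * r * x ^+ 3) ^+ 2)).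
    by rewrite lerXn2r ?nnegrE ?cmod_ge0 // (le_trans (cmod_ge0 _) hE1).
  rewrite -!mulrA; move: (r * x ^+ 3) r3 r31 => y y0 y1.
  have : discE ^+ 2 * y * y <= discE ^+ 2 * y by rewrite ler_piMr // mulr_ge0 ?sqr_ge0.
  by lra.
rewrite cmodM exprMn; apply: (@le_trans _ _ (cmod (normpoly J r).[z] ^+ 2 *
   (cmod (phi0 J r (1 + z)) ^+ 2 + 256 * mc 3 * (1 + mc 1) * r * x ^+ 3))).
  rewrite ler_wpM2l ?sqr_ge0 //; apply: le_trans h _.
  by rewrite lerD2l.
rewrite mulrDr -exprMn -cmodM.
have h3 : cmod (normpoly J r).[z] ^+ 2 * (256 * mc 3 * (1 + mc 1) * r * x ^+ 3) <=
    discH ^+ 2 * (256 * mc 3 * (1 + mc 1)) * r * x ^+ 3.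
  rewrite [leRHS](_ : _ = discH ^+ 2 * (256 * mc 3 * (1 + mc 1) * r * x ^+ 3)); last by ring.
  apply: ler_wpM2r; last by rewrite lerXn2r ?nnegrE ?cmod_ge0 // (le_trans (cmod_ge0 _) hN).
  rewrite -mulrA; apply: mulr_ge0 r3; apply: mulr_ge0; last by rewrite addr_ge0 ?mc_ge0.
  by apply: mulr_ge0; [exact: ler0n|exact: mc_ge0].
rewrite /discF; lra.
Qed.

End Radius.
End DiscEstimates.

(** * Taylor bounds for sine and cosine; chords and arcs *)

Section TrigTaylor.
Context {R : realType}.
Implicit Types (x y : R).

Lemma ge0_deriv_le (f df : R -> R) x : (forall y, is_derive y 1 f (df y)) ->
  (forall y, 0 <= y -> 0 <= df y) -> 0 <= x -> f 0 <= f x.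
Proof.
move=> fd df0 x0.
have fc : {within `[0, x], continuous f}.
  by apply: derivable_within_continuous => y _; have [] := fd y.
have [c] := MVT_segment x0 (fun y _ => fd y) fc.
rewrite in_itv /= => /andP[c0 _] e.
by rewrite -subr_ge0 e subr0 mulr_ge0 // df0.
Qed.

Lemma is_derive_pow y n :
  is_derive y 1 (id ^+ n : R -> R) ((n%:R * y ^+ n.-1) *: 1).
Proof. exact: (is_deriveX n (is_derive_id y 1)). Qed.

Lemma sin_le_id x : 0 <= x -> sin x <= x.
Proof.
move=> x0.
have h y : is_derive y 1 (id - sin : R -> R) (1 - cos y).
  exact: (is_deriveB (is_derive_id y 1) (is_derive_sin y)).
have pos y : 0 <= y -> 0 <= 1 - cos y.
  move=> y0; rewrite ?expr1 /GRing.scale /=; have := cos_le1 y; lra.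
have := ge0_deriv_le h pos x0.
rewrite !fctE ?sin0 ?cos0 ?expr0n /GRing.scale /=; lra.
Qed.

Lemma cos_ge_quadratic x : 0 <= x -> 1 - x ^+ 2 / 2 <= cos x.
Proof.
move=> x0.
have h y : is_derive y 1 (cos + 2^-1 *: (id ^+ 2) : R -> R) (- sin y + 2^-1 *: ((2%:R * y ^+ 1) *: 1)).
  exact: (is_deriveD (is_derive_cos y) (is_deriveZ 2^-1 (is_derive_pow y 2))).
have pos y : 0 <= y -> 0 <= - sin y + 2^-1 *: ((2%:R * y ^+ 1) *: 1).
  move=> y0; rewrite ?expr1 /GRing.scale /=; have := sin_le_id y0; lra.
have := ge0_deriv_le h pos x0.
rewrite !fctE ?sin0 ?cos0 ?expr0n /GRing.scale /=; lra.
Qed.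

Lemma cos_ge_linear x : 0 <= x -> 1 - x <= cos x.
Proof.
move=> x0.
have h y : is_derive y 1 (cos + id : R -> R) (- sin y + 1).
  exact: (is_deriveD (is_derive_cos y) (is_derive_id y 1)).
have pos y : 0 <= y -> 0 <= - sin y + 1.
  move=> y0; rewrite ?expr1 /GRing.scale /=; have := sin_le1 y; lra.
have := ge0_deriv_le h pos x0.
rewrite !fctE ?sin0 ?cos0 ?expr0n /GRing.scale /=; lra.
Qed.

Lemma sin_ge_quadratic x : 0 <= x -> x - x ^+ 2 / 2 <= sin x.
Proof.
move=> x0.
have h y : is_derive y 1 (sin - id + 2^-1 *: (id ^+ 2) : R -> R) (cos y - 1 + 2^-1 *: ((2%:R * y
  ^+ 1) *: 1)).
  exact: (is_deriveD (is_deriveB (is_derive_sin y) (is_derive_id y 1)) (is_deriveZ 2^-1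
    (is_derive_pow y 2))).
have pos y : 0 <= y -> 0 <= cos y - 1 + 2^-1 *: ((2%:R * y ^+ 1) *: 1).
  move=> y0; rewrite ?expr1 /GRing.scale /=; have := cos_ge_linear y0; lra.
have := ge0_deriv_le h pos x0.
rewrite !fctE ?sin0 ?cos0 ?expr0n /GRing.scale /=; lra.
Qed.

Lemma sin_ge_cubic x : 0 <= x -> x - x ^+ 3 / 6 <= sin x.
Proof.
move=> x0.
have h y : is_derive y 1 (sin - id + 6^-1 *: (id ^+ 3) : R -> R) (cos y - 1 + 6^-1 *: ((3%:R * y
  ^+ 2) *: 1)).
  exact: (is_deriveD (is_deriveB (is_derive_sin y) (is_derive_id y 1)) (is_deriveZ 6^-1
    (is_derive_pow y 3))).
have pos y : 0 <= y -> 0 <= cos y - 1 + 6^-1 *: ((3%:R * y ^+ 2) *: 1).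
  move=> y0; rewrite ?expr1 /GRing.scale /=; have := cos_ge_quadratic y0; lra.
have := ge0_deriv_le h pos x0.
rewrite !fctE ?sin0 ?cos0 ?expr0n /GRing.scale /=; lra.
Qed.

Lemma cos_le_cubic x : 0 <= x -> cos x <= 1 - x ^+ 2 / 2 + x ^+ 3 / 6.
Proof.
move=> x0.
have h y : is_derive y 1 (6^-1 *: (id ^+ 3) - 2^-1 *: (id ^+ 2) - cos : R -> R) (6^-1 *: ((3%:R *
  y ^+ 2) *: 1) - 2^-1 *: ((2%:R * y ^+ 1) *: 1) - - sin y).
  exact: (is_deriveB (is_deriveB (is_deriveZ 6^-1 (is_derive_pow y 3)) (is_deriveZ 2^-1
    (is_derive_pow y 2))) (is_derive_cos y)).
have pos y : 0 <= y -> 0 <= 6^-1 *: ((3%:R * y ^+ 2) *: 1) - 2^-1 *: ((2%:R * y ^+ 1) *: 1) - - sin y.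
  move=> y0; rewrite ?expr1 /GRing.scale /=; have := sin_ge_quadratic y0; lra.
have := ge0_deriv_le h pos x0.
rewrite !fctE ?sin0 ?cos0 ?expr0n /GRing.scale /=; lra.
Qed.

Lemma cis_taylor x :
  cmod ((cos x +i* sin x) - ((1 - x ^+ 2 / 2) +i* x)) <= `|x| ^+ 3.
Proof.
apply: le_trans (cmod_le_ReIm _) _; rewrite ReB ImB /=.
have h y : 0 <= y -> `|cos y - (1 - y ^+ 2 / 2)| + `|sin y - y| <= y ^+ 3.
  move=> y0; have := cos_ge_quadratic y0; have := cos_le_cubic y0.
  have := sin_le_id y0; have := sin_ge_cubic y0; have : 0 <= y ^+ 3 by rewrite exprn_ge0.
  move=> h1 h2 h3 h4 h5; rewrite ger0_norm; last by lra.
  by rewrite ler0_norm; lra.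
have [x0|x0] := leP 0 x; first by rewrite (ger0_norm x0); exact: h.
have nx : 0 <= - x by lra.
have := h _ nx; rewrite cosN sinN sqrrN -opprD normrN (ltr0_norm x0).
by rewrite (_ : sin x + - x = sin x - x).
Qed.

Lemma sin_ge_third y : 0 <= y -> y <= 2 -> y / 3 <= sin y.
Proof.
move=> y0 y2; have := sin_ge_cubic y0; apply: le_trans.
have : y * y ^+ 2 <= y * 4 by rewrite ler_wpM2l //; nra.
by rewrite exprS; lra.
Qed.

Lemma expi2pi_dist (s : R) : cmod (expi2pi s - 1) = 2 * `|sin (pi * s)|.
Proof.
apply/eqP; rewrite -(@eqrXn2 _ 2) ?cmod_ge0 ?mulr_ge0 // cmod_sqr ReB ImB /=; apply/eqP.
rewrite exprMn real_normK ?num_real //.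
have -> : 2 * pi * s = (pi * s) *+ 2 by rewrite -mulrA mulr_natl.
rewrite cos_mulr2n sin_mulr2n.
have := cos2Dsin2 (pi * s); move: (cos _) (sin _) => c d h.
have -> : c ^+ 2 = 1 - d ^+ 2 by rewrite -h addrK.
rewrite subr0 (_ : (c * d *+ 2) ^+ 2 = 4 * c ^+ 2 * d ^+ 2); last by ring.
have -> : c ^+ 2 = 1 - d ^+ 2 by rewrite -h addrK.
ring.
Qed.

Lemma expi2pi_dist_le (s : R) : cmod (expi2pi s - 1) <= 2 * pi * `|s|.
Proof.
rewrite expi2pi_dist -mulrA ler_wpM2l //.
have h y : 0 <= y -> `|sin (pi * y)| <= pi * y.
  move=> y0; have py : 0 <= pi * y by rewrite mulr_ge0 // pi_ge0.
  have [p1|p1] := leP 1 (pi * y).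
    by apply: le_trans p1; rewrite ler_norml sin_le1 sin_geN1.
  rewrite ger0_norm; first exact: sin_le_id.
  by apply: le_trans (sin_ge_third py _); lra.
have [s0|s0] := leP 0 s; first by rewrite (ger0_norm s0) h.
have e : sin (pi * s) = - sin (pi * - s) by rewrite mulrN sinN opprK.
rewrite (ltr0_norm s0) e normrN h //; lra.
Qed.

Lemma expi2pi_dist_ge (s : R) : `|s| <= 2^-1 -> 2 * pi * `|s| / 3 <= cmod (expi2pi s - 1).
Proof.
move=> hs; rewrite expi2pi_dist -!mulrA ler_wpM2l // mulrA.
have h y : 0 <= y -> y <= 2^-1 -> pi * y / 3 <= `|sin (pi * y)|.
  move=> y0 y1; apply: le_trans (ler_norm _); apply: sin_ge_third.
    by rewrite mulr_ge0 // pi_ge0.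
  have := pihalf_lt2 R; have := pi_gt0 R; nra.
have [s0|s0] := leP 0 s; first by rewrite (ger0_norm s0) in hs *; exact: h.
have e : sin (pi * s) = - sin (pi * - s) by rewrite mulrN sinN opprK.
rewrite (ltr0_norm s0) in hs *; rewrite e normrN h //; lra.
Qed.

End TrigTaylor.

(** * Powers, exponentials and w^2 - 1 on the unit circle *)

Section PowerBounds.
Context {R : realType}.
Local Notation C := R[i].

Lemma cmod_subXX (a b : C) (m : R) d : cmod a <= m -> cmod b <= m ->
  cmod (a ^+ d - b ^+ d) <= d%:R * cmod (a - b) * m ^+ d.-1.
Proof.
move=> am bm; have m0 : 0 <= m by apply: le_trans am; exact: cmod_ge0.
case: d => [|d]; first by rewrite !expr0 subrr cmod0 mul0r mul0r.
elim: d => [|d IH]; first by rewrite !expr1 mul1r expr0 mulr1.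
rewrite exprS (exprS b) (_ : _ - _ = a * (a ^+ d.+1 - b ^+ d.+1) + (a - b) * b ^+ d.+1); last by ring.
apply: le_trans (cmodD _ _) _; rewrite !cmodM /=.
have h1 : cmod a * cmod (a ^+ d.+1 - b ^+ d.+1) <= m * (d.+1%:R * cmod (a - b) * m ^+ d).
  by apply: ler_pM; rewrite ?cmod_ge0.
have h2 : cmod (a - b) * cmod (b ^+ d.+1) <= cmod (a - b) * m ^+ d.+1.
  by rewrite ler_wpM2l ?cmod_ge0 // cmodX lerXn2r ?nnegrE ?cmod_ge0.
apply: le_trans (lerD h1 h2) _; apply: eqW_le.
by rewrite -(natr1 d.+1) exprS; ring.
Qed.

Lemma sqr_le_expR (x y : R) : 0 <= x -> x ^+ 2 <= 1 - y -> x <= expR (- (y / 2)).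
Proof.
move=> x0 h; rewrite -ler_sqr ?nnegrE ?expR_ge0 // -expRM_natl.
apply: (le_trans h); rewrite (_ : 2%:R * - (y / 2) = - y); last by field.
exact: expR_ge1Dx.
Qed.

(** Exponential decay is weakened to Lorentzian decay, whose sum over the roots of unity is
    [sum_lorentzian]. *)
Lemma expRN_lorentz (c v : R) : 0 < c -> c <= 1 -> 0 <= v ->
  expR (- (c * v)) <= c^-1 * (1 + v)^-1.
Proof.
move=> c0 c1 v0; rewrite expRN -invfM lef_pV2 ?posrE ?expR_gt0 ?mulr_gt0 //; last by lra.
have := expR_ge1Dx (c * v); nra.
Qed.

Lemma cmod_sqrB1_ge (w : C) : cmod (w - 1) <= 1 -> cmod (w - 1) <= cmod (w ^+ 2 - 1).
Proof.
move=> h; have -> : w ^+ 2 - 1 = (w + 1) * (w - 1) by ring.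
rewrite cmodM ler_peMl ?cmod_ge0 //.
have := cmod_lerB 2%:R (1 - w); rewrite cmod_nat (_ : 2%:R - (1 - w) = w + 1); last by ring.
by rewrite (cmod_distC 1 w); lra.
Qed.

(** On the unit circle |w - 1|^2 + |w + 1|^2 = 4, so one of the two factors of w^2 - 1 has modulus
    at least 1. *)
Lemma cmod_sqrB1_ge_min (w : C) (e : R) : cmod w = 1 -> e <= 1 ->
  e <= cmod (w - 1) -> e <= cmod (w + 1) -> e <= cmod (w ^+ 2 - 1).
Proof.
move=> w1 e1 h1 h2; have -> : w ^+ 2 - 1 = (w + 1) * (w - 1) by ring.
rewrite cmodM; move: (cmod_ge0 (w - 1)) (cmod_ge0 (w + 1)).
have : cmod (w - 1) ^+ 2 + cmod (w + 1) ^+ 2 = 4.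
  have : cmod w ^+ 2 = 1 by rewrite w1 expr1n.
  rewrite !cmod_sqr; case: (w) => a b /= h; lra.
move: (cmod (w - 1)) (cmod (w + 1)) h1 h2 => u v h1 h2 h u0 v0.
have [u1|u1] := leP 1 u; first by nra.
have : 1 <= v by rewrite leNgt; apply/negP => v1; nra.
by nra.
Qed.

End PowerBounds.

(** * Products over the coordinates on and off the arcs *)

Section MainArc.
Context {R : realType} (d J : nat) (r B : R).
Local Notation C := R[i].
Local Notation t := (1 - r).
Local Notation c := (@decayC R).

(** For the third centred moment of a = k^2 with mean m, through |a - m|^3 <= 4 (a^3 + m^3). *)
Definition cubeC : R := 4 * (mc 3 + mc 1 ^+ 3).

Hypothesis r01 : 0 < r < 1.
Hypothesis hJ : 64 <= (1 - r) * J%:R ^+ 2.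
Hypothesis hD : d%:R * r = B ^+ 18.
Hypothesis hB1 : 4 <= B.
Hypothesis hB2 : 108 * cubeC <= c * B.
Hypothesis hB3 : 9 * mc 2 <= 2 * B.
Hypothesis hB4 : 2 * discE <= B.
Hypothesis hB5 : mc 2 <= c * B.

(** The exponents fit D = B^18: D (width / t)^2 = 1, the scale of decay; D (arcrad / t)^2 = B^2, the
    exponent gained off the arcs; D (discrad / t)^3 = 1, the total cubic error; discrad / arcrad =
    B^2, the gain per interpolation node. *)
Definition width : R := t / B ^+ 9.
Definition arcrad : R := t / B ^+ 8.
Definition discrad : R := t / B ^+ 6.
Definition lor (w : C) : R := (1 + cmod (w - 1) ^+ 2 / width ^+ 2)^-1.

Let r0 : 0 < r. Proof. by case/andP: r01. Qed.
Let r1 : r <= 1. Proof. by case/andP: r01 => _ /ltW. Qed.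
Let t0 : 0 < t. Proof. by case/andP: r01 => ? ?; rewrite subr_gt0. Qed.
Let t1 : t < 1. Proof. have := r0; lra. Qed.
Let B1 : 1 <= B. Proof. by apply: le_trans hB1; rewrite ler1n. Qed.
Let B0 : 0 < B. Proof. exact: lt_le_trans ltr01 B1. Qed.
Let Bk k : (0 < k)%N -> B <= B ^+ k.
Proof. by move=> k0; rewrite -[leLHS]expr1 ler_weXn2l. Qed.
Let Bk1 k : 1 <= B ^+ k. Proof. by rewrite exprn_ege1. Qed.
Let Bk0 k : 0 < B ^+ k. Proof. by rewrite exprn_gt0. Qed.
Let d0 : (0 < d)%N.
Proof.
rewrite lt0n; apply/eqP => d00; have := Bk0 18.
by rewrite -hD d00 mul0r ltxx.
Qed.

Lemma decayC_gt0 : 0 < c.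
Proof.
by rewrite divr_gt0 ?exprn_gt0 ?invr_gt0 //; apply: (lt_le_trans ltr01 thetaM_ge1).
Qed.

Lemma decayC_le1 : c <= 1.
Proof.
have h := @thetaM_ge1 R.
rewrite /decayC ler_pdivrMr ?exprn_gt0 ?(lt_le_trans ltr01 h) // mul1r.
apply: (@le_trans _ _ 1); last by rewrite exprn_ege1.
by rewrite exprn_ile1 ?invr_ge0 // invf_le1 ?ler1n.
Qed.

Lemma lor_ge0 w : 0 <= lor w.
Proof. by rewrite invr_ge0 addr_ge0 // divr_ge0 ?sqr_ge0. Qed.

Lemma lor_arg w : cmod (w - 1) ^+ 2 / width ^+ 2 = d%:R * r * (cmod (w - 1) / t) ^+ 2.
Proof.
by rewrite hD /width; field; rewrite !gt_eqF.
Qed.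

Lemma prod_phi1_le (xi : 'I_d -> R) w : cmod w = 1 ->
  cmod (\prod_(i < d) phi1 J r (xi i) w) <=
  expR (- (c / 2 * (d%:R * r * Num.min 1 (cmod (w ^+ 2 - 1) / t) ^+ 2))).
Proof.
move=> w1; set m := Num.min _ _.
have h x : cmod (phi1 J r x w) <= expR (- (c * r * m ^+ 2 / 2)).
  by apply: sqr_le_expR; rewrite ?cmod_ge0 // phi1E phase_decay.
rewrite cmod_prod; apply: (@le_trans _ _ (\prod_(i < d) expR (- (c * r * m ^+ 2 / 2)))).
  by apply: ler_prod => i _; rewrite cmod_ge0 h.
rewrite prodr_const card_ord -expRM_natl; apply: eqW_le; congr expR; by field.
Qed.

Lemma prod_phi1_lor (xi : 'I_d -> R) w : cmod w = 1 -> cmod (w - 1) <= t ->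
  cmod (\prod_(i < d) phi1 J r (xi i) w) <= 2 / c * lor w.
Proof.
move=> w1 wt; apply: (le_trans (prod_phi1_le xi w1)).
have hc := decayC_gt0; have hc1 := decayC_le1.
apply: (@le_trans _ _ (expR (- (c / 2 * (cmod (w - 1) ^+ 2 / width ^+ 2))))).
  rewrite ler_expR lerN2; apply: ler_wpM2l; first by rewrite divr_ge0 // ltW.
  rewrite lor_arg; apply: ler_wpM2l; first by rewrite mulr_ge0 // ltW.
  rewrite lerXn2r ?nnegrE ?divr_ge0 ?cmod_ge0 ?(ltW t0) //.
    by rewrite le_min ler01 divr_ge0 ?cmod_ge0 // ltW.
  rewrite le_min ler_pdivrMr // mul1r wt /=.
  rewrite ler_pM2r ?invr_gt0 //; apply: cmod_sqrB1_ge; have := t1; lra.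
rewrite -(invf_div c 2).
apply: expRN_lorentz; [by rewrite divr_gt0|by lra|by rewrite divr_ge0 ?sqr_ge0].
Qed.

Lemma prod_phi1_minor (xi : 'I_d -> R) w : cmod w = 1 ->
  arcrad <= cmod (w - 1) -> arcrad <= cmod (w + 1) ->
  cmod (\prod_(i < d) phi1 J r (xi i) w) <= expR (- (c / 2 * B ^+ 2)).
Proof.
move=> w1 h1 h2; apply: (le_trans (prod_phi1_le xi w1)).
have hc := decayC_gt0.
have a1 : arcrad <= 1.
  by rewrite ler_pdivrMr // mul1r; apply: (le_trans (ltW t1)).
have h := cmod_sqrB1_ge_min w1 a1 h1 h2.
rewrite ler_expR lerN2; apply: ler_wpM2l; first by rewrite divr_ge0 // ltW.
rewrite hD.
have -> : B ^+ 2 = B ^+ 18 * (B ^+ 8)^-1 ^+ 2 by field; rewrite gt_eqF.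
apply: ler_wpM2l; first exact: ltW.
rewrite lerXn2r ?nnegrE ?invr_ge0 ?(ltW (Bk0 _)) //.
  by rewrite le_min ler01 divr_ge0 ?cmod_ge0 // ltW.
rewrite le_min invf_le1 // Bk1 /= ler_pdivlMr // mulrC //.
Qed.

(** The lower bound at xi = 0 needs the arc around -1 to be negligible too. There |phi0|^2 <= 1 - c
    r, with [hB5] absorbing the deviation from -1, and d factors give exp(-c D / 2). *)
Lemma phi0_opp_small w : cmod w = 1 -> cmod (w + 1) <= arcrad ->
  cmod (phi0 J r w) ^+ d <= expR (- (c / 2 * B ^+ 2)).
Proof.
move=> w1 hw; have hc := decayC_gt0.
have w1' : cmod (- w) = 1 by rewrite cmodN.
have := phi0_near_neg1 r01 hJ w1'; rewrite opprK -opprD cmodN => h.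
have h2 : cmod (phi0 J r w) ^+ 2 <= 1 - c * r.
  apply: (le_trans h).
  have : 32 * momC 2 * r / t ^+ 2 * cmod (w + 1) ^+ 2 <= c * r.
    apply: (@le_trans _ _ (32 * momC 2 * r / t ^+ 2 * arcrad ^+ 2)).
      apply: ler_wpM2l; first by rewrite divr_ge0 ?sqr_ge0 // mulr_ge0 ?(ltW r0) // mc_ge0.
      by rewrite lerXn2r ?nnegrE ?cmod_ge0 // (le_trans (cmod_ge0 _) hw).
    rewrite (_ : _ * arcrad ^+ 2 = mc 2 / B ^+ 16 * r); last first.
      by rewrite /arcrad /mc; field; rewrite !gt_eqF.
    rewrite ler_wpM2r ?(ltW r0) // ler_pdivrMr //; apply: (le_trans hB5).
    by rewrite ler_wpM2l ?(ltW hc) // Bk.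
  by lra.
have h3 := sqr_le_expR (cmod_ge0 _) h2.
apply: (@le_trans _ _ (expR (- (c * r / 2)) ^+ d)).
  by rewrite lerXn2r ?nnegrE ?cmod_ge0 ?expR_ge0.
rewrite -expRM_natl ler_expR.
rewrite (_ : _ * - _ = - (c / 2 * (d%:R * r))); last by field.
rewrite lerN2 hD; apply: ler_wpM2l; first by rewrite divr_ge0 // ltW.
by rewrite ler_weXn2l.
Qed.

Let arc_disc x : x <= arcrad -> x <= t / 4.
Proof.
move=> h; apply: (le_trans h); rewrite ler_wpM2l ?(ltW t0) // lef_pV2 ?posrE //.
by apply: (le_trans hB1); exact: Bk.
Qed.

(** On the arc N phi0 = 1 + O(y) with d y bounded, so |N|^(-d) is at most a constant times |phi0|^d
    and inherits its Lorentzian decay. This keeps the total weight in [arc_approx] of order Q W. *)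
Lemma normpoly_inv w : cmod w = 1 -> cmod (w - 1) <= arcrad ->
  cmod ((normpoly J r).[w - 1] ^- d) <= expR (2 * discE) * (2 / c * lor w)
  /\ (normpoly J r).[w - 1] != 0.
Proof.
move=> w1 hw; set z := w - 1 in hw *.
have e : 1 + z = w by rewrite addrC subrK.
have zk : 0 <= cmod z <= t / 4 by rewrite cmod_ge0 arc_disc.
have h := normpoly_phi0 r01 hJ zk (lexx _); rewrite e in h.
set N := (normpoly J r).[z] in h *.
set y := discE * r * (cmod z / t) ^+ 3 in h.
have hE := @discE_ge0 R.
have x0 : 0 <= cmod z / t by rewrite divr_ge0 ?cmod_ge0 // ltW.
have xB : cmod z / t <= (B ^+ 8)^-1 by rewrite ler_pdivrMr // mulrC.
have x3 : (cmod z / t) ^+ 3 <= (B ^+ 24)^-1.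
  rewrite (_ : 24 = 8 * 3)%N // exprM -exprVn.
  by rewrite lerXn2r ?nnegrE ?invr_ge0 ?(ltW (Bk0 _)).
have y0 : 0 <= y by rewrite mulr_ge0 ?exprn_ge0 // mulr_ge0 // ltW.
have y1 : y <= 2^-1.
  apply: (@le_trans _ _ (discE * 1 * (B ^+ 24)^-1)).
    apply: ler_pM => //; first by rewrite mulr_ge0 // ltW.
      exact: exprn_ge0.
    exact: ler_wpM2l.
  rewrite mulr1 ler_pdivrMr //; have := Bk (k := 24) isT; have := hB4; lra.
have yd : d%:R * y <= discE.
  rewrite /y (_ : _ * _ = discE * (d%:R * r * (cmod z / t) ^+ 3)); last by ring.
  rewrite ler_piMr // hD; apply: (@le_trans _ _ (B ^+ 18 * (B ^+ 24)^-1)).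
    by rewrite ler_wpM2l ?(ltW (Bk0 _)).
  by rewrite ler_pdivrMr // mul1r ler_weXn2l.
have hN : 1 - y <= cmod N * cmod (phi0 J r w).
  have := cmod_lerB 1 (N * phi0 J r w); rewrite cmod1 (cmod_distC 1) cmodM; lra.
have N0 : 0 < cmod N.
  rewrite lt_neqAle cmod_ge0 andbT; apply/eqP => n0; move: hN; rewrite -n0 mul0r; lra.
split; last by rewrite -cmod_eq0 gt_eqF.
have hNi : (cmod N)^-1 <= expR (2 * y) * cmod (phi0 J r w).
  rewrite -[leLHS]mul1r ler_pdivrMr // -mulrA (mulrC (cmod (phi0 _ _ _))).
  apply: (@le_trans _ _ (expR (2 * y) * (1 - y))).
    by have := expR_ge1Dx (2 * y); nra.
  by rewrite ler_wpM2l ?expR_ge0.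
rewrite cmodV cmodX -exprVn; apply: (@le_trans _ _ ((expR (2 * y) * cmod (phi0 J r w)) ^+ d)).
  by rewrite lerXn2r ?nnegrE ?invr_ge0 ?cmod_ge0 ?mulr_ge0 ?expR_ge0 ?cmod_ge0.
rewrite exprMn; apply: ler_pM; rewrite ?exprn_ge0 ?expR_ge0 ?cmod_ge0 //.
  rewrite -expRM_natl ler_expR; lra.
have wt : cmod (w - 1) <= t by have /andP[_] := zk; have := t0; rewrite -/z; lra.
have := @prod_phi1_lor (fun=> 0) w w1 wt.
by under eq_bigr do rewrite phi1_0; rewrite prodr_const card_ord cmodX.
Qed.

(** At this radius the cubic errors of the d coordinates add up to discF d r B^(-18) = discF. *)
Lemma fpoly_le (xi : 'rV[R]_d) z : cmod z <= discrad ->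
  cmod (fpoly J r xi).[z] <= expR discF.
Proof.
move=> hz; have rk : 0 <= discrad <= t / 4.
  rewrite divr_ge0 ?(ltW t0) ?(ltW (Bk0 _)) //= ler_wpM2l ?(ltW t0) // lef_pV2 ?posrE //.
  by apply: (le_trans hB1); exact: Bk.
have hF := @discF_ge0 R.
have xt : discrad / t = (B ^+ 6)^-1 by rewrite /discrad; field; rewrite !gt_eqF.
have h x : cmod ((normpoly J r).[z] * phi1 J r x (1 + z)) ^+ 2 <= expR (discF * r * (B ^+ 18)^-1).
  apply: le_trans (normpoly_phi1 r01 hJ rk hz x) _; rewrite xt exprVn -exprM.
  exact: expR_ge1Dx.
rewrite -ler_sqr ?nnegrE ?cmod_ge0 ?expR_ge0 // /fpoly horner_prod cmod_prod -prodrXl.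
apply: (@le_trans _ _ (\prod_(i < d) expR (discF * r * (B ^+ 18)^-1))).
  by apply: ler_prod => i _; rewrite sqr_ge0 hornerM horner_phipoly /=; exact: h.
rewrite prodr_const card_ord -!expRM_natl ler_expR.
rewrite (_ : d%:R * _ = discF * (d%:R * r) / B ^+ 18); last by ring.
rewrite hD mulfK ?gt_eqF //; lra.
Qed.

End MainArc.

(** * Central limit estimate for the d-th power at xi = 0 *)

Section CenteredLaw.
Context {R : realType} (d J : nat) (r B : R).
Local Notation C := R[i].
Local Notation t := (1 - r).
Local Notation c := (@decayC R).
Hypothesis r01 : 0 < r < 1.
Hypothesis hJ : 64 <= (1 - r) * J%:R ^+ 2.

(** The characteristic function of k^2 centred at its mean. *)
Definition cenlaw (s : R) : C :=
  \sum_(i < J.*2.+1) (pJ r i)%:C * expi2pi (s * ((asq J i)%:R - lawmean J r)).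

Definition lawvar : R := \sum_(i < J.*2.+1) pJ r i * ((asq J i)%:R - lawmean J r) ^+ 2.

(** Second-order Taylor polynomial of [cenlaw]; its d-th power stands for the limiting Gaussian. *)
Definition gaussq (s : R) : R := 1 - (2 * pi * s) ^+ 2 * lawvar / 2.

Let r0 : 0 < r. Proof. by case/andP: r01. Qed.
Let r1 : r <= 1. Proof. by case/andP: r01 => _ /ltW. Qed.
Let t0 : 0 < t. Proof. by case/andP: r01 => ? ?; rewrite subr_gt0. Qed.
Let p0 (i : 'I_J.*2.+1) : 0 <= pJ r i. Proof. by rewrite pJ_ge0 // ltW. Qed.
Let p1 : \sum_(i < J.*2.+1) pJ r i = 1. Proof. by rewrite pJ_sum1 // ltW. Qed.

Lemma phi0_cenlaw s : phi0 J r (expi2pi s) = expi2pi (s * lawmean J r) * cenlaw s.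
Proof.
rewrite /phi0 /genfun mulr_sumr; apply: eq_bigr => i _.
rewrite mulr1 mulrCA -expi2piD -expi2piMn; congr (_ * expi2pi _); ring.
Qed.

Lemma lawvarE : lawvar = \sum_(i < J.*2.+1) pJ r i * (asq J i)%:R ^+ 2 - lawmean J r ^+ 2.
Proof.
set m := lawmean J r.
transitivity (\sum_(i < J.*2.+1) (pJ r i * (asq J i)%:R ^+ 2 - 2 * m * (pJ r i * (asq J i)%:R)
   + m ^+ 2 * pJ r i)).
  by apply: eq_bigr => i _; rewrite -/m; ring.
rewrite big_split sumrB -!mulr_sumr /= p1 -/(lawmean J r) -/m; ring.
Qed.

Lemma lawvar_ge0 : 0 <= lawvar.
Proof. by apply: sumr_ge0 => i _; rewrite mulr_ge0 // sqr_ge0. Qed.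

Lemma lawvar_upper : lawvar <= mc 2 * r / t ^+ 2.
Proof. by apply: (le_trans _ (law_sqr_upper r01 hJ)); rewrite lawvarE gerBl sqr_ge0. Qed.

Lemma cenlaw_taylor s :
  cmod (cenlaw s - (gaussq s)%:C) <= cubeC * r * (2 * pi * `|s| / t) ^+ 3.
Proof.
set m := lawmean J r.
have m0 : 0 <= m by apply: sumr_ge0 => i _; rewrite mulr_ge0.
pose x (i : 'I_J.*2.+1) : R := 2 * pi * (s * ((asq J i)%:R - m)).
have e : (gaussq s)%:C = \sum_(i < J.*2.+1) (pJ r i)%:C * ((1 - x i ^+ 2 / 2) +i* x i).
  apply: complex_eqP; rewrite ?Re_sum ?Im_sum.
    under [RHS]eq_bigr do rewrite ReMr.
    rewrite /= /gaussq -[X in X - _]p1 mulr_sumr mulr_suml -sumrB; apply: eq_bigr => i _.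
    by rewrite /x -/m; ring.
  under [RHS]eq_bigr do rewrite ImMr.
  rewrite /=.
  (* The first-order term vanishes because the law is centred. *)
  transitivity (2 * pi * s * (\sum_(i < J.*2.+1) pJ r i * (asq J i)%:R - m * \sum_(i < J.*2.+1) pJ r i)).
    by rewrite p1 -/(lawmean J r) -/m mulr1 subrr mulr0.
  rewrite [m * _]mulr_sumr -sumrB mulr_sumr; apply: eq_bigr => i _; rewrite /x; ring.
rewrite e /cenlaw -sumrB; apply: le_trans (cmod_sum _ _ _) _.
have x3 : \sum_(i < J.*2.+1) pJ r i * `|x i| ^+ 3 <=
    (2 * pi * `|s|) ^+ 3 * \sum_(i < J.*2.+1) pJ r i * (4 * ((asq J i)%:R ^+ 3 + m ^+ 3)).
  rewrite mulr_sumr; apply: ler_sum => i _; rewrite [leRHS]mulrCA; apply: ler_wpM2l => //.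
  have -> : `|x i| = 2 * pi * `|s| * `|(asq J i)%:R - m|.
    by rewrite /x !normrM (ger0_norm (pi_ge0 R)) normr_nat; ring.
  rewrite exprMn ler_wpM2l ?exprn_ge0 ?mulr_ge0 ?pi_ge0 //.
  move: ((asq J i)%:R) (ler0n R (asq J i)) => a a0.
  apply: (@le_trans _ _ ((a + m) ^+ 3)).
    rewrite lerXn2r ?nnegrE ?addr_ge0 //; apply: le_trans (ler_normB _ _) _.
    by rewrite !ger0_norm.
  have : 0 <= (a + m) * (a - m) ^+ 2 by rewrite mulr_ge0 ?sqr_ge0 ?addr_ge0.
  by lra.
apply: (@le_trans _ _ (\sum_(i < J.*2.+1) pJ r i * `|x i| ^+ 3)).
  apply: ler_sum => i _; rewrite -mulrBr cmodM cmodR ger0_norm // ler_wpM2l //.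
  exact: cis_taylor.
apply: (le_trans x3).
have -> : \sum_(i < J.*2.+1) pJ r i * (4 * ((asq J i)%:R ^+ 3 + m ^+ 3)) =
   4 * (\sum_(i < J.*2.+1) pJ r i * (asq J i)%:R ^+ 3 + m ^+ 3 * \sum_(i < J.*2.+1) pJ r i).
  by rewrite mulrDr !mulr_sumr -big_split; apply: eq_bigr => i _ /=; ring.
have hm : m ^+ 3 <= mc 1 ^+ 3 * r / t ^+ 3.
  apply: (@le_trans _ _ ((mc 1 * r / t) ^+ 3)).
    by rewrite lerXn2r ?nnegrE ?(lawmean_upper r01 hJ) // (le_trans m0) // (lawmean_upper r01 hJ).
  rewrite [leLHS](_ : _ = mc 1 ^+ 3 * r / t ^+ 3 * r ^+ 2); last by field; rewrite gt_eqF.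
  rewrite ler_piMr ?expr_le1 ?(ltW r0) // divr_ge0 ?exprn_ge0 ?(ltW t0) //.
  by rewrite mulr_ge0 ?exprn_ge0 ?mc_ge0 ?(ltW r0).
have ha := law_cube_upper r01 hJ.
rewrite p1 mulr1 (_ : @cubeC R * r * _ = (2 * pi * `|s|) ^+ 3 * (@cubeC R * r / t ^+ 3)); last first.
  by field; rewrite gt_eqF.
apply: ler_wpM2l; first by rewrite exprn_ge0 // !mulr_ge0 ?pi_ge0.
by rewrite /cubeC; lra.
Qed.

Hypothesis hD : d%:R * r = B ^+ 18.
Hypothesis hB1 : 4 <= B.
Hypothesis hB2 : 108 * @cubeC R <= c * B.
Hypothesis hB3 : 9 * mc 2 <= 2 * B.

Let B1 : 1 <= B. Proof. by apply: le_trans hB1; rewrite ler1n. Qed.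
Let B0 : 0 < B. Proof. exact: lt_le_trans ltr01 B1. Qed.
Let Bk k : (0 < k)%N -> B <= B ^+ k.
Proof. by move=> k0; rewrite -[leLHS]expr1 ler_weXn2l. Qed.
Let Bk1 k : 1 <= B ^+ k. Proof. by rewrite exprn_ege1. Qed.
Let Bk0 k : 0 < B ^+ k. Proof. by rewrite exprn_gt0. Qed.
Let d0 : (0 < d)%N.
Proof.
rewrite lt0n; apply/eqP => d00; have := Bk0 18.
by rewrite -hD d00 mul0r ltxx.
Qed.

Lemma cubeC_ge0 : 0 <= @cubeC R.
Proof. by rewrite mulr_ge0 // addr_ge0 ?exprn_ge0 ?mc_ge0. Qed.

(** In the telescoped difference a^d - b^d, d |a - b| is O(D x^3) = O(B^(-6)), as x = |w - 1| / t <=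
    B^(-8) on the arc; the remaining d - 1 factors provide Lorentzian decay. *)
Lemma cenlaw_pow s (w := expi2pi s) : `|s| <= 2^-1 -> cmod (w - 1) <= arcrad r B ->
  0 <= gaussq s /\
  cmod (cenlaw s ^+ d - (gaussq s ^+ d)%:C) <= 216 * @cubeC R / c * B ^- 6 * lor r B w.
Proof.
move=> hs hw; have hc := @decayC_gt0 R; have hc1 := @decayC_le1 R; have K0 := cubeC_ge0.
set x := cmod (w - 1) / t; set th := 2 * pi * `|s|.
have x0 : 0 <= x by rewrite divr_ge0 ?cmod_ge0 // ltW.
have th0 : 0 <= th by rewrite !mulr_ge0 ?pi_ge0.
have tht0 : 0 <= th / t by rewrite divr_ge0 // ltW.
have x30 : 0 <= 3 * x by rewrite mulr_ge0.
(* For |s| <= 1/2 the chord is at least a third of the arc, so angles are controlled by |w - 1|. *)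
have thx : th / t <= 3 * x.
  have := expi2pi_dist_ge hs; rewrite -/th -/w => h.
  by rewrite /x mulrA ler_pM2r ?invr_gt0 //; lra.
have xB : x <= (B ^+ 8)^-1 by rewrite ler_pdivrMr // mulrC.
have B8 : (B ^+ 8)^-1 <= B^-1 by rewrite lef_pV2 ?posrE // Bk.
have x1 : x <= 1 by apply: (le_trans xB); rewrite invf_le1.
have w1 : cmod w = 1 by exact: cmod_expi2pi.
have wt : cmod (w - 1) <= t by move: x1; rewrite ler_pdivrMr // mul1r.
have hT : cmod (cenlaw s - (gaussq s)%:C) <= 27 * @cubeC R * r * x ^+ 3.
  apply: (le_trans (cenlaw_taylor s)); rewrite -/th.
  rewrite [leRHS](_ : _ = @cubeC R * r * (3 * x) ^+ 3); last by ring.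
  apply: ler_wpM2l; first by rewrite mulr_ge0 // ltW.
  by rewrite lerXn2r ?nnegrE.
have rx2 : 0 <= r * x ^+ 2 by rewrite mulr_ge0 ?sqr_ge0 // ltW.
have rx21 : r * x ^+ 2 <= 1 by rewrite mulr_ile1 ?sqr_ge0 ?(ltW r0) // expr_le1.
(* [hB2] makes the Taylor error at most half of the decay c r x^2 / 2 of [cenlaw], so [gaussq]
   decays as well. *)
have hT2 : 27 * @cubeC R * r * x ^+ 3 <= c / 4 * (r * x ^+ 2).
  rewrite [leLHS](_ : _ = 27 * @cubeC R * x * (r * x ^+ 2)); last by ring.
  apply: ler_wpM2r => //.
  have : @cubeC R * x <= @cubeC R * B^-1 by rewrite ler_wpM2l // (le_trans xB).
  have : @cubeC R * B^-1 <= c / 108 by rewrite ler_pdivrMr // mulrAC ler_pdivlMr // mulrC.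
  by lra.
have hA : cmod (cenlaw s) <= 1 - c / 2 * (r * x ^+ 2).
  have -> : cmod (cenlaw s) = cmod (phi0 J r w) by rewrite phi0_cenlaw cmodM cmod_expi2pi mul1r.
  have h : cmod (phi0 J r w) ^+ 2 <= 1 - c * (r * x ^+ 2).
    have -> : phi0 J r w = \sum_i (@pJ R J r i)%:C * phase J 0 w i by rewrite -phi1E phi1_0.
    apply: le_trans (phase_decay r01 hJ 0 w1) _; rewrite lerD2l lerN2 -mulrA.
    apply: ler_wpM2l; first exact: ltW.
    apply: ler_wpM2l; first exact: ltW.
    rewrite lerXn2r ?nnegrE // ?le_min ?ler01 ?x1 ?divr_ge0 ?cmod_ge0 ?(ltW t0) //=.
    by rewrite ler_pM2r ?invr_gt0 //; apply: cmod_sqrB1_ge; apply: (le_trans wt); have := r0; lra.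
  rewrite -ler_sqr ?nnegrE ?cmod_ge0 //; last first.
    by have := ler_wpM2l (ltW hc) rx21; lra.
  apply: (le_trans h); move: (r * x ^+ 2) => y.
  by have := sqr_ge0 (c / 2 * y); lra.
have hb0 : 0 <= gaussq s.
  rewrite /gaussq subr_ge0.
  have e : (2 * pi * s) ^+ 2 = th ^+ 2 by rewrite /th !exprMn real_normK ?num_real.
  rewrite e; apply: (@le_trans _ _ (th ^+ 2 * (mc 2 * r / t ^+ 2) / 2)).
    by rewrite ler_wpM2r // ler_wpM2l ?sqr_ge0 // lawvar_upper.
  rewrite (_ : _ / 2 = mc 2 / 2 * r * (th / t) ^+ 2); last by field; rewrite gt_eqF.
  have m2 := @mc_ge0 R 2.
  apply: (@le_trans _ _ (mc 2 / 2 * 1 * (3 * x) ^+ 2)).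
    apply: ler_pM; rewrite ?sqr_ge0 ?mulr_ge0 ?(ltW r0) //.
      by rewrite ler_wpM2l // divr_ge0.
    by rewrite lerXn2r ?nnegrE.
  have : x ^+ 2 <= B^-1 by rewrite expr2; apply: (@le_trans _ _ (x * 1));
    rewrite ?ler_wpM2l // mulr1 (le_trans xB).
  have : mc 2 * B^-1 <= 2 / 9 by rewrite ler_pdivrMr // mulrAC ler_pdivlMr // mulrC.
  move=> h1 h2; have := ler_wpM2l m2 h2; lra.
split=> //.
set m := 1 - c / 4 * (r * x ^+ 2).
have hb : cmod ((gaussq s)%:C : C) <= m.
  have := cmod_lerB ((gaussq s)%:C : C) (cenlaw s); rewrite cmod_distC /m; lra.
have hA' : cmod (cenlaw s) <= m.
  by apply: (le_trans hA); rewrite /m; have := mulr_ge0 (ltW hc) rx2; lra.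
have m12 : 2^-1 <= m by rewrite /m; have := ler_wpM2l (ltW hc) rx21; lra.
have m0 : 0 < m by lra.
rewrite rcX; apply: le_trans (cmod_subXX d hA' hb) _.
have md : m ^+ d.-1 <= 2 * m ^+ d.
  rewrite -[in leRHS](prednK d0) exprS mulrA ler_peMl ?exprn_ge0 ?(ltW m0) //; lra.
have ml : m ^+ d <= 4 / c * lor r B w.
  have q0 : 0 < c / 4 by rewrite divr_gt0.
  apply: (@le_trans _ _ (expR (- (c / 4 * (cmod (w - 1) ^+ 2 / width r B ^+ 2))))).
    rewrite (lor_arg r01 hD hB1) (_ : - _ = d%:R * (- (c / 4 * (r * x ^+ 2)))); last by rewrite /x; ring.
    rewrite expRM_natl lerXn2r ?nnegrE ?expR_ge0 ?(ltW m0) //.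
    exact: expR_ge1Dx.
  rewrite -(invf_div c 4); apply: expRN_lorentz => //; first by lra.
  by rewrite divr_ge0 ?sqr_ge0.
have hd : d%:R * cmod (cenlaw s - (gaussq s)%:C) <= 27 * @cubeC R * B ^- 6.
  apply: (@le_trans _ _ (d%:R * (27 * @cubeC R * r * x ^+ 3))); first by rewrite ler_wpM2l.
  rewrite (_ : _ * _ = 27 * @cubeC R * (d%:R * r * x ^+ 3)); last by ring.
  apply: ler_wpM2l; first by rewrite mulr_ge0.
  rewrite hD (_ : B ^- 6 = B ^+ 18 * (B ^+ 8)^-1 ^+ 3); last by field; rewrite gt_eqF.
  by apply: ler_wpM2l; [exact: ltW|rewrite lerXn2r ?nnegrE ?invr_ge0 // ltW].
apply: (@le_trans _ _ (27 * @cubeC R * B ^- 6 * (2 * (4 / c * lor r B w)))).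
  apply: ler_pM => //; rewrite ?mulr_ge0 ?cmod_ge0 ?exprn_ge0 ?(ltW m0) //.
  by apply: (le_trans md); rewrite ler_wpM2l.
by apply: eqW_le; ring.
Qed.

(** Since d [lawvar] W^2 <= mc 2, the Gaussian has not yet decayed at angles of a small multiple of
    the width W. *)
Lemma gaussq_pow_ge s : (2 * pi * s) ^+ 2 * mc 2 <= width r B ^+ 2 ->
  2^-1 <= gaussq s ^+ d.
Proof.
move=> h; have v0 := lawvar_ge0; have vu := lawvar_upper.
have q0 : 0 <= (2 * pi * s) ^+ 2 * lawvar / 2.
  by apply: divr_ge0 => //; apply: mulr_ge0 => //; exact: sqr_ge0.
have hq : d%:R * ((2 * pi * s) ^+ 2 * lawvar / 2) <= 2^-1.
  apply: (@le_trans _ _ (d%:R * ((2 * pi * s) ^+ 2 * (mc 2 * r / t ^+ 2) / 2))).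
    by rewrite ler_wpM2l // ler_wpM2r // ler_wpM2l ?sqr_ge0.
  rewrite (_ : _ * _ = (2 * pi * s) ^+ 2 * mc 2 / 2 * (d%:R * r / t ^+ 2)); last by ring.
  have -> : d%:R * r / t ^+ 2 = (width r B ^+ 2)^-1.
    by rewrite hD /width; field; rewrite !gt_eqF.
  have w0 : 0 < width r B ^+ 2 by rewrite exprn_gt0 // divr_gt0.
  by rewrite ler_pdivrMr //; lra.
have q1 : (2 * pi * s) ^+ 2 * lawvar / 2 <= 1.
  apply: (le_trans _ (le_trans hq _)); last by lra.
  by rewrite ler_peMl // ler1n.
by apply: le_trans (bernoulli_le d q1); lra.
Qed.

End CenteredLaw.

(** * The ball sum as a coefficient of a polynomial *)

Section BallSum.
Context {R : realType}.
Local Notation C := R[i].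
Implicit Types (d J n Q : nat).

Lemma expi2pi_sum I (s : seq I) (P : pred I) (F : I -> R) :
  expi2pi (\sum_(i <- s | P i) F i) = \prod_(i <- s | P i) expi2pi (F i).
Proof. by apply: big_morph; [exact: expi2piD|exact: expi2pi0]. Qed.

Definition boxvec d J (f : {ffun 'I_d -> 'I_J.*2.+1}) : 'rV[int]_d :=
  \row_i ks J (f i).

Definition boxsq d J (f : {ffun 'I_d -> 'I_J.*2.+1}) : nat := \sum_(i < d) asq J (f i).

Lemma boxvec_inj d J : injective (@boxvec d J).
Proof.
move=> f g /rowP h; apply/ffunP => i; have := h i; rewrite !mxE /ks => e.
by apply: ord_inj; move/addIr: e => [].
Qed.

Lemma normsq_boxvec d J (f : {ffun 'I_d -> 'I_J.*2.+1}) :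
  normsq (boxvec f) = (boxsq f)%:Z.
Proof.
rewrite /normsq /boxsq (big_morph Posz PoszD erefl); apply: eq_bigr => i _.
by rewrite mxE /asq; move: (ks _ _) => k; lia.
Qed.

Lemma asq_le J (i : 'I_J.*2.+1) : (asq J i <= J ^ 2)%N.
Proof. by rewrite /asq leq_sqr /ks; have := ltn_ord i; lia. Qed.

Lemma boxsq_le d J (f : {ffun 'I_d -> 'I_J.*2.+1}) : (boxsq f <= d * J ^ 2)%N.
Proof.
rewrite /boxsq -[d in leqRHS]card_ord -sum_nat_const; apply: leq_sum => i _; exact: asq_le.
Qed.

(** The coordinates of a vector of squared norm at most n are at most n <= J in absolute value, so
    the ball lies in the box. *)
Lemma sum_intball d J n (G : 'rV[int]_d -> C) : (n <= J)%N ->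
  \sum_(x <- fset_set (@intball d n)) G x =
  \sum_(f : {ffun 'I_d -> 'I_J.*2.+1} | (boxsq f <= n)%N) G (boxvec f).
Proof.
move=> nJ; rewrite (perm_big [seq boxvec f | f <- enum [pred f : {ffun 'I_d -> 'I_J.*2.+1} |
  (boxsq f <= n)%N]]).
  by rewrite big_map big_enum.
apply: uniq_perm; first exact: fset_uniq.
  by rewrite map_inj_uniq ?enum_uniq //; exact: boxvec_inj.
move=> x; rewrite in_fset_set; last exact: finite_intball.
apply/idP/mapP => [|[f]]; last first.
  rewrite mem_enum => hf ->; rewrite inE in hf.
  by apply: mem_set; rewrite /intball /= normsq_boxvec lez_nat.
move/set_mem; rewrite /intball /= => hx.
have hxi (i : 'I_d) : (absz (x ord0 i) <= J)%N.
  have hi : x ord0 i ^+ 2 <= n%:Z.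
    apply: le_trans hx; rewrite /normsq (bigD1 i) //= lerDl.
    by apply: sumr_ge0 => j _; exact: sqr_ge0.
  by move: (x ord0 i) hi => z hz; nia.
pose f : {ffun 'I_d -> 'I_J.*2.+1} := [ffun i => inord (absz (x ord0 i + J%:Z))].
have ex : x = boxvec f.
  apply/rowP => i; rewrite mxE ffunE /ks inordK; have := hxi i; move: (x ord0 i) => z hz; lia.
by exists f => //; rewrite mem_enum inE -(lez_nat) -normsq_boxvec -ex.
Qed.

Lemma sum_boxvec d J (xi : 'rV[R]_d) (z : C) :
  \sum_(f : {ffun 'I_d -> 'I_J.*2.+1}) expi2pi (dotp (boxvec f) xi) * z ^+ boxsq f =
  \prod_(i < d) \sum_(k < J.*2.+1) phase J (xi 0 i) z k.
Proof.
rewrite bigA_distr_bigA; apply: eq_bigr => f _.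
rewrite /dotp expi2pi_sum /boxsq expr_sum -big_split; apply: eq_bigr => i _.
by rewrite mxE /phase [RHS]mulrC.
Qed.

Definition ballpoly d J n (xi : 'rV[R]_d) : {poly C} :=
  \sum_(f : {ffun 'I_d -> 'I_J.*2.+1})
    expi2pi (dotp (boxvec f) xi) *: ('X^(boxsq f) * \sum_(i < n.+1) 'X^i).

Lemma size_ballpoly d J n (xi : 'rV[R]_d) : (size (ballpoly J n xi) <= d * J ^ 2 + n.+1)%N.
Proof.
apply: leq_trans (size_sum _ _ _) _; apply/bigmax_leqP => f _.
apply: leq_trans (size_scale_leq _ _) _; apply: leq_trans (size_polyMleq _ _) _.
rewrite size_polyXn; have := boxsq_le f.
have : (size ((\sum_(i < n.+1) 'X^i)%R : {poly C}) <= n.+1)%N.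
  apply: leq_trans (size_sum _ _ _) _; apply/bigmax_leqP => i _.
  by rewrite size_polyXn ltn_ord.
by move: (d * J ^ 2)%N (boxsq f) (size _) => a b e; clear; lia.
Qed.

Lemma coef_ballpoly d J n (xi : 'rV[R]_d) : (n <= J)%N ->
  (ballpoly J n xi)`_n = \sum_(x <- fset_set (@intball d n)) expi2pi (dotp x xi).
Proof.
move=> nJ; rewrite (sum_intball _ nJ) coef_sum [RHS]big_mkcond; apply: eq_bigr => f _.
rewrite coefZ coefXnM; case: ltnP => h; first by rewrite mulr0.
rewrite coef_sum (bigD1 (inord (n - boxsq f))) //= coefXn inordK ?ltnS ?leq_subr // eqxx.
rewrite big1 ?addr0 ?mulr1 // => i hi; rewrite coefXn.
case: eqP => // e; case/eqP: hi; apply: val_inj; rewrite /= inordK ?ltnS ?leq_subr //.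
Qed.

Lemma horner_ballpoly d J n (xi : 'rV[R]_d) z : (ballpoly J n xi).[z] =
  (\prod_(i < d) \sum_(k < J.*2.+1) phase J (xi 0 i) z k) * \sum_(i < n.+1) z ^+ i.
Proof.
rewrite /ballpoly horner_sum -sum_boxvec mulr_suml; apply: eq_bigr => f _.
rewrite hornerZ hornerM hornerXn horner_sum mulrA; congr (_ * _).
by apply: eq_bigr => i _; rewrite hornerXn.
Qed.

Lemma phase_scale J (r xi : R) (w : C) (i : nat) :
  phase J xi (r%:C * w) i = (r ^+ asq J i)%:C * phase J xi w i.
Proof. by rewrite /phase exprMn rcX mulrA. Qed.

Lemma sum_phase_scale J (r xi : R) (w : C) : 0 < r < 1 ->
  \sum_(k < J.*2.+1) phase J xi (r%:C * w) k = (thetaJ J r)%:C * phi1 J r xi w.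
Proof.
move=> r01; rewrite phi1E mulr_sumr; apply: eq_bigr => i _.
rewrite phase_scale mulrA -rcM; congr (_%:C * _).
by rewrite /pJ mulrC divfK // gt_eqF // thetaJ_gt0.
Qed.

(* The factor sum_(i <= n) z^i z^(-n) selects total degree at most n, and the filter is
   exact because Q exceeds all degrees involved. *)
Lemma ball_identity d J n Q (r : R) (xi : 'rV[R]_d) : 0 < r < 1 -> (n <= J)%N ->
  (d * J ^ 2 + n.+1 <= Q)%N ->
  \sum_(j < Q) (\prod_(i < d) phi1 J r (xi 0 i) (omega Q ^+ j)) *
     (\sum_(i < n.+1) (r%:C * omega Q ^+ j) ^+ i) * (omega Q ^+ j) ^- n =
  Q%:R * ((r ^+ n / thetaJ J r ^+ d)%:C *
    \sum_(x <- fset_set (@intball d n)) expi2pi (dotp x xi)).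
Proof.
move=> r01 nJ hQ; have th0 := thetaJ_gt0 J r01.
have thc : (thetaJ J r ^+ d)%:C != 0 :> C.
  by rewrite -cmod_eq0 cmodR normr_eq0 gt_eqF // exprn_gt0.
apply: (mulfI thc).
have nQ : (n < Q)%N by lia.
have := root_filter r%:C (leq_trans (size_ballpoly J n xi) hQ) nQ.
rewrite coef_ballpoly // => e.
transitivity (\sum_(j < Q) (ballpoly J n xi).[r%:C * omega Q ^+ j] * (omega Q ^+ j) ^- n).
  rewrite mulr_sumr; apply: eq_bigr => j _; rewrite horner_ballpoly !mulrA.
  do 2! congr (_ * _).
  under [RHS]eq_bigr do rewrite sum_phase_scale //.
  by rewrite big_split /= prodr_const card_ord -rcX.
rewrite e rcM rcV (rcX r n); move: (\sum_(x <- _) _) (r%:C ^+ n) => S X.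
by move: (thetaJ J r ^+ d)%:C thc => U U0; field.
Qed.

End BallSum.

(* Unconditional sums along an exhausting sequence of finite sets *)
#[local] Existing Instance totally_filter.

Section UnconditionalSums.
Context {R : realType} {I : choiceType}.
Local Notation C := R[i].
Context (Bx : nat -> {fset I}) (a : I -> R) (eps : nat -> R).
Hypothesis Bx_mono : forall J J' : nat, (J <= J')%N -> (Bx J `<=` Bx J')%fset.
Hypothesis Bx_exh : forall A : {fset I}, exists J, (A `<=` Bx J)%fset.
Hypothesis a0 : forall i, 0 <= a i.
Hypothesis tail : forall J J' : nat, (J <= J')%N ->
  \sum_(i <- Bx J') a i - \sum_(i <- Bx J) a i <= eps J.
Hypothesis eps0 : forall e : R, 0 < e -> exists J, eps J < e.

Lemma partial_sumE (V : zmodType) (x : I -> V) (A : {fset I}) :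
  partial_sum x A = \sum_(i <- A) x i.
Proof. by rewrite /partial_sum (big_seq_fsetE _ A xpredT). Qed.

Lemma fset_sum_split (V : zmodType) (x : I -> V) (A B : {fset I}) : (B `<=` A)%fset ->
  \sum_(i <- A) x i = \sum_(i <- B) x i + \sum_(i <- (A `\` B)%fset) x i.
Proof.
move=> BA; rewrite (big_fsetID _ (mem B) A); congr (_ + _); apply: eq_fbigl => i.
  by rewrite !inE /=; case: (boolP (i \in B)) => [/(fsubsetP BA) ->|]; rewrite ?andbF.
by rewrite !inE /= andbC.
Qed.

(** Every finite A lies in some larger [Bx], so the tail bound along the sequence controls arbitrary
    finite sets. *)
Lemma fset_tail J A : (Bx J `<=` A)%fset -> \sum_(i <- (A `\` Bx J)%fset) a i <= eps J.
Proof.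
move=> BA; have [J1 hA] := Bx_exh A.
have hA2 : (A `<=` Bx (maxn J J1))%fset.
  by apply: fsubset_trans hA (Bx_mono _); rewrite leq_maxr.
apply: le_trans (tail (leq_maxl J J1)).
rewrite (fset_sum_split a (fsubset_trans BA hA2)) addrC addKr.
have sub : (A `\` Bx J `<=` Bx (maxn J J1) `\` Bx J)%fset by apply: fsetSD.
rewrite [leRHS](fset_sum_split a sub) lerDl.
by apply: sumr_ge0 => i _; exact: a0.
Qed.

Lemma near_totally_sub (A : {fset I}) : \forall B \near @totally I, (A `<=` B)%fset.
Proof. by exists A. Qed.

Lemma real_sum_cvg (x : I -> R) : (forall i, `|x i| <= a i) ->
  cvg (partial_sum x @ @totally I).
Proof.
move=> xa; apply: cauchy_cvg; apply: cauchy_exP => e e0.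
have [J hJ] := eps0 e0; exists (partial_sum x (Bx J)).
apply: filterS (near_totally_sub (Bx J)) => A BA.
rewrite /ball /= !partial_sumE (fset_sum_split x BA) opprD addNKr normrN.
apply: le_lt_trans hJ; apply: le_trans (fset_tail BA).
by apply: le_trans (ler_norm_sum _ _ _) _; apply: ler_sum.
Qed.

Lemma complex_sum_cvg (x : I -> C) : (forall i, cmod (x i) <= a i) ->
  exists l : C, forall e : R, 0 < e ->
   \forall A \near @totally I, cmod (l - partial_sum x A) < e.
Proof.
move=> xa.
have hr : cvg (partial_sum (fun i => Re (x i)) @ @totally I).
  by apply: real_sum_cvg => i; apply: le_trans (Re_le_cmod _) (xa i).
have hi : cvg (partial_sum (fun i => Im (x i)) @ @totally I).
  by apply: real_sum_cvg => i; apply: le_trans (Im_le_cmod _) (xa i).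
set lr := lim (partial_sum (fun i => Re (x i)) @ @totally I).
set li := lim (partial_sum (fun i => Im (x i)) @ @totally I).
exists (lr +i* li) => e e0; have e20 : 0 < e / 2 by rewrite divr_gt0.
have h1 := (cvgrPdist_lt (partial_sum (fun i => Re (x i))) lr).1 hr _ e20.
have h2 := (cvgrPdist_lt (partial_sum (fun i => Im (x i))) li).1 hi _ e20.
apply: (@filterS2 _ _ _ _ _ _ _ (h1 _) (h2 _)) => A /=; rewrite !partial_sumE => k1 k2.
apply: le_lt_trans (cmod_le_ReIm _) _; rewrite ReB ImB Re_sum Im_sum /=.
by rewrite (splitr e) ltrD.
Qed.

Lemma complex_sum_dist (x : I -> C) J : (forall i, cmod (x i) <= a i) ->
  cmod (sum (x : I -> C^o) - \sum_(i <- Bx J) x i) <= eps J.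
Proof.
move=> xa; have [l hl] := complex_sum_cvg xa.
have -> : sum (x : I -> C^o) = l.
  apply: (@cvg_lim C^o); first exact: norm_hausdorff.
  (* Here epsilon is a positive element of [R[i]], that is, a positive real: its imaginary part
     vanishes. *)
  apply/cvgrPdist_lt => e; case: e => er ei; rewrite ltcE /= => /andP[/eqP -> er0].
  apply: (@filterS {fset I} (@totally I) _ _ _ _ (hl _ er0)) => A /= h.
  have e1 (z : C) : `|z| = (cmod z)%:C by case: z => u v; rewrite normc_def.
  by rewrite e1 ltcE /= eqxx.
apply/ler_addgt0Pr => e e0; rewrite [leRHS]addrC.
have [A [/= hA BA]] := @filter_ex {fset I} (@totally I) _ _ (filterI (hl e e0) (near_totally_sub
  (Bx J))).
rewrite partial_sumE in hA.
apply: le_trans (cmod_dist_trans (\sum_(i <- A) x i) _ _) _; apply: lerD; first exact: ltW.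
rewrite (fset_sum_split x BA) addrC addKr.
apply: le_trans (cmod_sum _ _ _) _; apply: le_trans (fset_tail BA).
exact: ler_sum.
Qed.

Lemma real_sum_dist (x : I -> R) J : (forall i, `|x i| <= a i) ->
  `|sum (x : I -> R^o) - \sum_(i <- Bx J) x i| <= eps J.
Proof.
move=> xa; have hc := real_sum_cvg xa.
apply/ler_addgt0Pr => e e0; rewrite [leRHS]addrC.
have h1 := (cvgrPdist_lt (partial_sum x) _).1 hc _ e0.
have [A [/= hA BA]] := @filter_ex {fset I} (@totally I) _ _ (filterI (h1 _) (near_totally_sub (Bx J))).
rewrite -[X in `|X|](subrKA (\sum_(i <- A) x i)).
apply: le_trans (ler_normD _ _) _; apply: lerD; first by rewrite -partial_sumE; exact: ltW.
rewrite (fset_sum_split x BA) addrC addKr.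
apply: le_trans (ler_norm_sum _ _ _) _; apply: le_trans (fset_tail BA).
exact: ler_sum.
Qed.

End UnconditionalSums.

(** * Gaussian transforms as limits of finite products *)

Section GaussTruncation.
Context {R : realType}.
Local Notation C := R[i].
Implicit Types (d J n : nat) (r : R).

Lemma geometric_small (c R0 e : R) : 0 <= c -> 0 < R0 < 1 -> 0 < e ->
  exists J0 : nat, forall J, (J0 <= J)%N -> c * R0 ^+ J < e.
Proof.
move=> c0 /andP[R00 R01] e0; set u := R0^-1 - 1.
have u0 : 0 < u by rewrite subr_gt0 invf_gt1.
have q0 : 0 <= c / (e * u) by rewrite divr_ge0 // mulr_ge0 // ltW.
have /andP[_ h] := truncn_itv q0; set K := Num.truncn _ in h.
exists K.+1 => J hJ.
have b : 1 + J%:R * u <= R0^-1 ^+ J.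
  have := @bernoulli_le R (- u) J; rewrite mulrN !opprK => b; apply: (le_trans (b _)).
    by lra.
  by apply: eqW_le; congr (_ ^+ _); rewrite /u; ring.
have RJ0 : 0 < R0 ^+ J by rewrite exprn_gt0.
rewrite exprVn in b.
have h2 : c < J%:R * u * e.
  move: h; rewrite ltr_pdivrMr ?mulr_gt0 // => h; apply: (lt_le_trans h).
  rewrite (_ : _ * (e * u) = K.+1%:R * (u * e)); last by ring.
  by rewrite -mulrA ler_wpM2r ?mulr_ge0 ?(ltW u0) ?(ltW e0) // ler_nat.
have h3 : (1 + J%:R * u) * R0 ^+ J <= 1 by rewrite -ler_pdivlMr // div1r.
have : c * R0 ^+ J <= J%:R * u * e * R0 ^+ J by rewrite ler_wpM2r // ltW.
have : e * ((1 + J%:R * u) * R0 ^+ J) <= e * 1 by rewrite ler_wpM2l // ltW.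
have : 0 < e * R0 ^+ J by rewrite mulr_gt0.
lra.
Qed.

Lemma geometric_tail (R0 : R) m n : 0 < R0 < 1 ->
  \sum_(m <= k < n) R0 ^+ k <= R0 ^+ m / (1 - R0).
Proof.
move=> /andP[R00 R01]; have t0 : 0 < 1 - R0 by rewrite subr_gt0.
rewrite ler_pdivlMr //; have [nm|mn] := leqP n m.
  by rewrite big_geq // mul0r exprn_ge0 // ltW.
suff h k : (\sum_(m <= i < m + k) R0 ^+ i) * (1 - R0) = R0 ^+ m - R0 ^+ (m + k).
  by rewrite -(subnKC (ltnW mn)) h gerBl exprn_ge0 // ltW.
elim: k => [|k IH]; first by rewrite addn0 big_geq // mul0r subrr.
by rewrite addnS big_nat_recr ?leq_addr //= mulrDl IH exprS; ring.
Qed.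

Lemma sub_pow_le (x y X : R) d : 1 <= X -> 0 <= x <= X -> 0 <= y <= X ->
  `|x ^+ d - y ^+ d| <= d%:R * `|x - y| * X ^+ d.
Proof.
move=> X1 /andP[x0 xX] /andP[y0 yX].
have := @cmod_subXX R x%:C y%:C X d; rewrite -!rcX -!rcB !cmodR (ger0_norm x0) (ger0_norm y0) => h.
apply: (le_trans (h xX yX)); apply: ler_wpM2l; first by rewrite mulr_ge0.
by rewrite ler_weXn2l // leq_pred.
Qed.

Section Uniform.
Context (R0 : R).
Hypothesis R01 : 0 < R0 < 1.
Let Rt : 0 < 1 - R0. Proof. by case/andP: R01 => _; rewrite subr_gt0. Qed.
Let Rp : 0 < R0. Proof. by case/andP: R01. Qed.

Definition thetaX : R := 3 / (1 - R0).
Definition thetaE J : R := 2 * (R0 ^+ J.+1 / (1 - R0)).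
Definition gaussE d J : R := d%:R * thetaE J * thetaX ^+ d.

Lemma thetaX_ge1 : 1 <= thetaX.
Proof. rewrite /thetaX ler_pdivlMr //; have := Rp; lra. Qed.

Lemma thetaE_ge0 J : 0 <= thetaE J.
Proof. by rewrite mulr_ge0 // divr_ge0 ?exprn_ge0 // ltW. Qed.

Lemma thetaE_small d e : 0 < e -> exists J0 : nat, forall J, (J0 <= J)%N ->
  thetaE J < e /\ gaussE d J < e.
Proof.
move=> e0; set c := (1 + d%:R) * (2 / (1 - R0)) * thetaX ^+ d * R0.
have X1 := thetaX_ge1.
have XX : 1 <= thetaX ^+ d by rewrite exprn_ege1.
have c0 : 0 <= c.
  have X0 : 0 <= thetaX ^+ d by apply: le_trans XX.
  apply: mulr_ge0; last exact: ltW.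
  apply: mulr_ge0 => //; apply: mulr_ge0; first by rewrite addr_ge0.
  by rewrite divr_ge0 // ltW.
have [J0 hJ] := geometric_small c0 R01 e0; exists J0 => J /hJ {}hJ.
have E0 := thetaE_ge0 J.
have hc : c * R0 ^+ J = (1 + d%:R) * thetaE J * thetaX ^+ d.
  by rewrite /c /thetaE exprS; field; rewrite gt_eqF.
have EX : thetaE J <= thetaE J * thetaX ^+ d by rewrite ler_peMr.
have dE : 0 <= d%:R * thetaE J * thetaX ^+ d.
  by apply: mulr_ge0; [exact: mulr_ge0|exact: le_trans XX].
rewrite /gaussE; split; apply: le_lt_trans hJ; rewrite hc.
  by rewrite mulrDl mul1r mulrDl; lra.
rewrite mulrDl mul1r mulrDl lerDr; apply: mulr_ge0 => //; exact: le_trans XX.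
Qed.

Lemma thetaJ_tail J J' r : (J <= J')%N -> 0 < r <= R0 ->
  0 <= thetaJ J' r - thetaJ J r <= thetaE J.
Proof.
move=> JJ /andP[r0 rR]; have r1 : r <= 1 by have := Rt; lra.
rewrite !thetaJE (_ : _ - _ = 2 * \sum_(J.+1 <= k < J'.+1) r ^+ (k ^ 2)); last first.
  by rewrite (big_cat_nat (n := J.+1)) //=; ring.
apply/andP; split.
  by rewrite mulr_ge0 // sumr_ge0 // => k _; rewrite exprn_ge0 // ltW.
rewrite ler_wpM2l //; apply: le_trans (geometric_tail J.+1 J'.+1 R01).
rewrite !big_nat; apply: ler_sum => k _; apply: (@le_trans _ _ (r ^+ k)).
  rewrite ler_wiXn2l ?(ltW r0) // -mulnn; case: k => // k; exact: leq_pmulr.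
by rewrite lerXn2r ?nnegrE ?(ltW r0) ?(ltW Rp).
Qed.

Lemma thetaJ_le J r : 0 < r <= R0 -> thetaJ J r <= thetaX.
Proof.
move=> hr; have /andP[_ h] := thetaJ_tail (leq0n J) hr.
have e0 : thetaJ 0 r = 1 by rewrite thetaJE big_geq // mulr0 addr0.
move: h; rewrite e0 lerBlDl => h; apply: (le_trans h).
rewrite /thetaE /thetaX expr1 ler_pdivlMr //.
have e : R0 / (1 - R0) * (1 - R0) = R0 by rewrite divfK // gt_eqF.
by have := Rp; have := Rt; lra.
Qed.

Definition zset J : {fset int} := [fset k in [seq ks J (nat_of_ord i) | i <- enum 'I_J.*2.+1]]%fset.

Definition boxset d J : {fset 'rV[int]_d} :=
  [fset x in [seq boxvec f | f <- enum {: {ffun 'I_d -> 'I_J.*2.+1}}]]%fset.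

Lemma sum_zset (V : zmodType) J (F : int -> V) :
  \sum_(k <- zset J) F k = \sum_(i < J.*2.+1) F (ks J i).
Proof.
rewrite (perm_big [seq ks J (nat_of_ord i) | i <- enum 'I_J.*2.+1]).
  by rewrite big_map big_enum.
apply: uniq_perm; first exact: fset_uniq.
  rewrite map_inj_uniq ?enum_uniq // => i j /addIr[] h; exact: ord_inj.
by move=> x; rewrite !inE.
Qed.

Lemma sum_boxset (V : zmodType) d J (F : 'rV[int]_d -> V) :
  \sum_(x <- boxset d J) F x = \sum_(f : {ffun 'I_d -> 'I_J.*2.+1}) F (boxvec f).
Proof.
rewrite (perm_big [seq boxvec f | f <- enum {: {ffun 'I_d -> 'I_J.*2.+1}}]).
  by rewrite big_map big_enum.
apply: uniq_perm; first exact: fset_uniq.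
  by rewrite map_inj_uniq ?enum_uniq //; exact: boxvec_inj.
by move=> x; rewrite !inE.
Qed.

Lemma mem_zset J k : (k \in zset J) = (absz k <= J)%N.
Proof.
rewrite !inE; apply/mapP/idP => [[i _ ->]|hk].
  by rewrite /ks; have := ltn_ord i; lia.
exists (inord (absz (k + J%:Z))); first by rewrite mem_enum.
by rewrite /ks inordK; lia.
Qed.

Lemma mem_boxset d J x : (x \in boxset d J) = [forall i : 'I_d, absz (x ord0 i) <= J]%N.
Proof.
rewrite !inE; apply/mapP/forallP => [[f _ ->] i|hx].
  by rewrite mxE /ks; move: (f i) => k; have := ltn_ord k; lia.
exists [ffun i => inord (absz (x ord0 i + J%:Z))]; first by rewrite mem_enum.
apply/rowP => i; rewrite mxE ffunE /ks inordK; have := hx i; move: (x ord0 i) => z hz; lia.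
Qed.

Lemma zset_mono J J' : (J <= J')%N -> (zset J `<=` zset J')%fset.
Proof. by move=> JJ; apply/fsubsetP => k; rewrite !mem_zset => /leq_trans; apply. Qed.

Lemma boxset_mono d J J' : (J <= J')%N -> (boxset d J `<=` boxset d J')%fset.
Proof.
move=> JJ; apply/fsubsetP => x; rewrite !mem_boxset => /forallP h.
by apply/forallP => i; exact: leq_trans (h i) JJ.
Qed.

Lemma zset_exh (A : {fset int}) : exists J, (A `<=` zset J)%fset.
Proof.
exists (\max_(k <- A) absz k)%N; apply/fsubsetP => k kA; rewrite mem_zset.
by apply: leq_bigmax_seq.
Qed.

Lemma boxset_exh d (A : {fset 'rV[int]_d}) : exists J, (A `<=` boxset d J)%fset.
Proof.
exists (\max_(x <- A) \max_(i < d) absz (x ord0 i))%N; apply/fsubsetP => x xA.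
rewrite mem_boxset; apply/forallP => i.
apply: leq_trans (leq_bigmax_seq _ xA isT).
by apply: (@leq_bigmax _ (fun i => absz (x ord0 i))).
Qed.

Lemma sum_zset_theta J r : \sum_(k <- zset J) r ^ (k ^+ 2) = thetaJ J r.
Proof.
rewrite sum_zset; apply: eq_bigr => i _; rewrite [RHS]exprnP; congr (r ^ _).
by rewrite /asq; move: (ks _ _) => k; lia.
Qed.

Lemma sum_boxset_theta d J r : \sum_(x <- boxset d J) r ^ normsq x = thetaJ J r ^+ d.
Proof.
rewrite sum_boxset -[d in RHS]card_ord -prodr_const bigA_distr_bigA.
apply: eq_bigr => f _; rewrite normsq_boxvec -exprnP /boxsq expr_sum.
by apply: eq_bigr.
Qed.

Lemma theta_dist J r : 0 < r <= R0 -> `|theta r - thetaJ J r| <= thetaE J.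
Proof.
move=> hr; have /andP[r0 rR] := hr; rewrite -sum_zset_theta.
apply: (@real_sum_dist R int zset (fun k => r ^ (k ^+ 2)) thetaE zset_mono zset_exh) => [k|J1 J2
  JJ|e e0|k].
- by rewrite exprz_ge0 // ltW.
- by rewrite !sum_zset_theta; case/andP: (thetaJ_tail JJ hr).
- by have [J0 /(_ J0 (leqnn _))[h _]] := thetaE_small 0 e0; exists J0.
- by rewrite ger0_norm // exprz_ge0 // ltW.
Qed.

Lemma theta_bounds r : 0 < r <= R0 -> 1 <= theta r <= thetaX.
Proof.
move=> hr; have /andP[r0 _] := hr; apply/andP; split; apply/ler_addgt0Pr => e e0;
  have [J0 /(_ J0 (leqnn _))[h _]] := thetaE_small 0 e0;
  have := theta_dist J0 hr; rewrite ler_norml => /andP[h1 h2].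
  by have := thetaJ_ge1 J0 (ltW r0); lra.
by have := thetaJ_le J0 hr; lra.
Qed.

(** Two errors of size [gaussE]: the mass outside the box, and [thetaJ] instead of [theta] in the
    normalisation. *)
Lemma gausshat_dist d J r (xi : 'rV[R]_d) : 0 < r <= R0 ->
  cmod (gausshat r xi - \prod_(i < d) phi1 J r (xi 0 i) 1) <= 2 * gaussE d J.
Proof.
move=> hr; have /andP[r0 rR] := hr.
have r01 : 0 < r < 1 by rewrite r0 (le_lt_trans rR) //; case/andP: R01.
have /andP[th1 thX] := theta_bounds hr.
have th0 : 0 < theta r by lra.
have thd1 : 1 <= theta r ^+ d by rewrite exprn_ege1.
have thd0 : 0 < theta r ^+ d by lra.
have tj1 := thetaJ_ge1 J (ltW r0); have tjX := thetaJ_le J hr.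
have tj0 : 0 < thetaJ J r by lra.
have tjd0 : 0 < thetaJ J r ^+ d by rewrite exprn_gt0.
have powE J1 (x : R) : 0 <= x <= thetaX -> `|x - thetaJ J1 r| <= thetaE J1 ->
    `|x ^+ d - thetaJ J1 r ^+ d| <= gaussE d J1.
  move=> hx hd; have tk : 0 <= thetaJ J1 r <= thetaX.
    by rewrite thetaJ_le // (le_trans ler01) // thetaJ_ge1 // ltW.
  apply: (le_trans (sub_pow_le d thetaX_ge1 hx tk)); rewrite /gaussE.
  by rewrite ler_wpM2r ?exprn_ge0 ?(le_trans ler01 thetaX_ge1) // ler_wpM2l.
pose F (x : 'rV[int]_d) : C := (gauss r x)%:C * expi2pi (dotp x xi).
have h1 : cmod (gausshat r xi - \sum_(x <- boxset d J) F x) <= gaussE d J.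
  apply: (@complex_sum_dist R _ (boxset d) (fun x => r ^ normsq x) (gaussE d)
     (@boxset_mono d) (@boxset_exh d)) => [x|J1 J2 JJ|e e0|x].
  - by rewrite exprz_ge0 // ltW.
  - rewrite !sum_boxset_theta; apply: le_trans (ler_norm _) _; apply: powE.
      by rewrite thetaJ_le // (le_trans ler01) // thetaJ_ge1 // ltW.
    by have /andP[q1 q2] := thetaJ_tail JJ hr; rewrite ger0_norm.
  - by have [J0 /(_ J0 (leqnn _))[_ h]] := thetaE_small d e0; exists J0.
  - rewrite cmodM cmod_expi2pi mulr1 cmodR /gauss ger0_norm.
      by rewrite ler_piMl ?exprz_ge0 ?(ltW r0) // invf_le1.
    by rewrite mulr_ge0 ?exprz_ge0 ?invr_ge0 ?exprn_ge0 // ltW.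
have e2 : \sum_(x <- boxset d J) F x =
    (theta r ^- d * thetaJ J r ^+ d)%:C * \prod_(i < d) phi1 J r (xi 0 i) 1.
  have := @sum_boxvec R d J xi r%:C.
  under [X in _ = X -> _]eq_bigr do rewrite -[r%:C]mulr1 sum_phase_scale //.
  rewrite big_split /= prodr_const card_ord -rcX => e.
  rewrite sum_boxset rcM -mulrA -e mulr_sumr; apply: eq_bigr => f _.
  rewrite /F /gauss normsq_boxvec -exprnP rcM rcX; ring.
apply: le_trans (cmod_dist_trans (\sum_(x <- boxset d J) F x) _ _) _.
rewrite mulr2n mulrDl mul1r; apply: lerD => //.
rewrite e2 -[X in _ - X]mul1r -mulrBl -[1]/(1%:C) -rcB cmodM cmodR.
have hp : cmod (\prod_(i < d) phi1 J r (xi 0 i) 1) <= 1.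
  rewrite cmod_prod; apply: prodr_ile1 => i _; rewrite cmod_ge0 /=.
  rewrite phi1E; apply: le_trans (cmod_sum _ _ _) _.
  rewrite -(pJ_sum1 J (ltW r0)); apply: ler_sum => k _.
  by rewrite cmodM cmodR ger0_norm ?pJ_ge0 ?(ltW r0) // phase_unit ?cmod1 // mulr1.
apply: (@le_trans _ _ (`|theta r ^- d * thetaJ J r ^+ d - 1|)).
  by rewrite ler_piMr.
have -> : theta r ^- d * thetaJ J r ^+ d - 1 = - (theta r ^- d * (theta r ^+ d - thetaJ J r ^+ d)).
  by field; rewrite gt_eqF.
rewrite normrN normrM ger0_norm ?invr_ge0 ?(ltW thd0) //.
apply: (@le_trans _ _ (`|theta r ^+ d - thetaJ J r ^+ d|)).
  by rewrite ler_piMl // invf_le1.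
by apply: powE; [rewrite thX (ltW th0)|exact: theta_dist].
Qed.

End Uniform.

(** J0 must serve all r <= R0 at once, because the parameters are determined only after J. *)
Lemma gausshat_approx d (R0 e : R) : 0 < R0 < 1 -> 0 < e ->
  exists J0 : nat, forall J, (J0 <= J)%N -> forall r, 0 < r <= R0 ->
  forall xi : 'rV[R]_d,
  cmod (gausshat r xi - \prod_(i < d) phi1 J r (xi 0 i) 1) <= e.
Proof.
move=> R01 e0; have e20 : 0 < e / 2 by rewrite divr_gt0.
have [J0 hJ] := thetaE_small R01 d e20; exists J0 => J /hJ[_ h] r hr xi.
by apply: (le_trans (@gausshat_dist _ R01 d J r xi hr)); lra.
Qed.

End GaussTruncation.

(** * The sum over the circle: approximation and lower bound *)

Section CircleSum.
Context {R : realType} (d n J P T : nat) (r B : R).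
Local Notation C := R[i].
Local Notation t := (1 - r).
Local Notation c := (@decayC R).
Local Notation Q := (P + P)%N.
Local Notation W := (width r B).

Hypothesis r01 : 0 < r < 1.
Hypothesis hJ : 64 <= (1 - r) * J%:R ^+ 2.
Hypothesis hD : d%:R * r = B ^+ 18.
Hypothesis hB1 : 4 <= B.
Hypothesis hB2 : 108 * @cubeC R <= c * B.
Hypothesis hB3 : 9 * mc 2 <= 2 * B.
Hypothesis hB4 : 2 * @discE R <= B.
Hypothesis hB5 : mc 2 <= c * B.
Hypothesis P0 : (0 < P)%N.
Hypothesis hQ : (1 - W) ^+ Q <= 2^-1.

Let r0 : 0 < r. Proof. by case/andP: r01. Qed.
Let t0 : 0 < t. Proof. by case/andP: r01 => ? ?; rewrite subr_gt0. Qed.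
Let t1 : t < 1. Proof. have := r0; lra. Qed.
Let B1 : 1 <= B. Proof. by apply: le_trans hB1; rewrite ler1n. Qed.
Let B0 : 0 < B. Proof. exact: lt_le_trans ltr01 B1. Qed.
Let Bk0 k : 0 < B ^+ k. Proof. by rewrite exprn_gt0. Qed.
Let Bk1 k : 1 <= B ^+ k. Proof. by rewrite exprn_ege1. Qed.
Let Q0 : 0 < (Q%:R : R). Proof. by rewrite ltr0n addn_gt0 P0. Qed.
Let W0 : 0 < W. Proof. by rewrite divr_gt0. Qed.
Let W1 : W < 1. Proof. by rewrite ltr_pdivrMr // mul1r (lt_le_trans t1). Qed.
Let c0 : 0 < c. Proof. exact: decayC_gt0. Qed.
Let WA : W <= arcrad r B.
Proof. by rewrite /arcrad ler_wpM2l ?(ltW t0) // lef_pV2 ?posrE // ler_weXn2l. Qed.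
Let At : arcrad r B <= t / 4.
Proof.
rewrite ler_wpM2l ?(ltW t0) // lef_pV2 ?posrE //; apply: (le_trans hB1).
by rewrite -[leLHS]expr1 ler_weXn2l.
Qed.
Let A0 : 0 < arcrad r B. Proof. by rewrite divr_gt0. Qed.

Definition Gn (z : C) : C := \sum_(i < n.+1) z ^+ i.

(** The factor t normalises: |Gn| <= 1 / t on the circle of radius r. *)
Definition cweight (w : C) : C := t%:C * Gn (r%:C * w) * w ^- n.

Lemma Gn_geo : t * \sum_(i < n.+1) r ^+ i = 1 - r ^+ n.+1.
Proof. by rewrite -opprB mulNr -subrX1 opprB. Qed.

Lemma tGn_le w : cmod w = 1 -> cmod (t%:C * Gn (r%:C * w)) <= 1.
Proof.
move=> w1; rewrite cmodM cmodR gtr0_norm //.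
apply: (@le_trans _ _ (t * \sum_(i < n.+1) r ^+ i)).
  rewrite ler_wpM2l ?(ltW t0) //; apply: le_trans (cmod_sum _ _ _) _.
  apply: ler_sum => i _.
  by rewrite cmodX cmodM w1 mulr1 cmodR (gtr0_norm r0).
by rewrite Gn_geo gerBl exprn_ge0 // ltW.
Qed.

Lemma cweight_le w : cmod w = 1 -> cmod (cweight w) <= 1.
Proof.
move=> w1; rewrite cmodM cmodV cmodX w1 expr1n invr1 mulr1; exact: tGn_le.
Qed.

(** Near w = 1 the geometric factor is almost the constant 1 - r^(n + 1), which [hrn] bounds below:
    the cut-off at degree n costs only a constant. *)
Lemma tGn_dist w : cmod w = 1 ->
  cmod (t%:C * Gn (r%:C * w) - (1 - r ^+ n.+1)%:C) <= cmod (w - 1) / t.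
Proof.
move=> w1; rewrite -Gn_geo rcM -mulrBr cmodM cmodR gtr0_norm //.
have r1 : r <= 1 by have := t0; lra.
(* Summation by parts: both sides have the same increments. *)
have h m : t * \sum_(i < m) i%:R * r ^+ i <= \sum_(i < m.+1) r ^+ i - m%:R * r ^+ m.
  elim: m => [|m IH]; first by rewrite big_ord0 mulr0 big_ord_recr big_ord0 /= mul0r subr0 add0r.
  rewrite big_ord_recr [X in _ <= X - _]big_ord_recr mulrDr /=.
  apply: le_trans (lerD IH (lexx _)) _; rewrite exprS -(natr1 m) -subr_ge0.
  by apply: eqW_le; ring.
have h2 : t * \sum_(i < n.+1) i%:R * r ^+ i <= t^-1.
  apply: le_trans (h n.+1) _; apply: (@le_trans _ _ (\sum_(i < n.+2) r ^+ i)).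
    by rewrite gerBl mulr_ge0 // exprn_ge0 // ltW.
  rewrite -[t^-1]mul1r ler_pdivlMr // mulrC -opprB mulNr -subrX1 opprB gerBl.
  by rewrite exprn_ge0 // ltW.
apply: (@le_trans _ _ (t * (cmod (w - 1) * \sum_(i < n.+1) i%:R * r ^+ i))).
  rewrite ler_wpM2l ?(ltW t0) // rc_sum -sumrB mulr_sumr.
  apply: le_trans (cmod_sum _ _ _) _; apply: ler_sum => i _.
  rewrite exprMn -rcX -[X in _ - X]mulr1 -mulrBr cmodM cmodR ger0_norm ?exprn_ge0 ?(ltW r0) //.
  rewrite mulrA mulrC; apply: ler_wpM2r; first by rewrite exprn_ge0 // ltW.
  by rewrite mulrC; apply: unit_pow_dist; rewrite w1.
by rewrite mulrCA ler_wpM2l ?cmod_ge0.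
Qed.

Lemma sum_lor_le : \sum_(j < Q) lor r B (omega Q ^+ j) <= Q%:R * (4 * W).
Proof. by apply: sum_lorentzian; rewrite ?W0 ?W1. Qed.

Definition mainarc (w : C) : bool := cmod (w - 1) <= arcrad r B.

Definition Lam : R := @lagrangeC R T.
Definition mainC : R := expR (2 * discE) * (2 / c) * 4.

Lemma Lam_ge0 : 0 <= Lam.
Proof. by rewrite mulr_ge0 // exprn_ge0 // mulr_ge0. Qed.

(* Coefficients of the functional obtained from the main-arc sum when fpoly is replaced
   by its Lagrange interpolant at the nodes. *)
Definition arccoef (v : C -> C) (k : 'I_T) : C :=
  \sum_(j < Q | mainarc (omega Q ^+ j)) v (omega Q ^+ j) *
    (normpoly J r).[omega Q ^+ j - 1] ^- d *
    (lagrange (@node R T (arcrad r B)) k).[omega Q ^+ j - 1].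

Let main_weight_sum :
  \sum_(j < Q | mainarc (omega Q ^+ j)) expR (2 * @discE R) * (2 / c * lor r B (omega Q ^+ j))
  <= Q%:R * (mainC * W).
Proof.
apply: (@le_trans _ _ (\sum_(j < Q) expR (2 * @discE R) * (2 / c) * lor r B (omega Q ^+ j))).
  rewrite [leLHS]big_mkcond; apply: ler_sum => j _; rewrite mulrA; case: ifP => // _.
  by rewrite mulr_ge0 ?lor_ge0 // mulr_ge0 ?expR_ge0 // divr_ge0 // ltW.
rewrite -mulr_sumr; apply: le_trans (ler_wpM2l _ sum_lor_le) _.
  by rewrite mulr_ge0 ?expR_ge0 // divr_ge0 // ltW.
by apply: eqW_le; rewrite /mainC; ring.
Qed.

Lemma arccoef_sum (v : C -> C) : (forall w, cmod w = 1 -> cmod (v w) <= 1) ->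
  \sum_k cmod (arccoef v k) <= Lam * (Q%:R * (mainC * W)).
Proof.
move=> hv; apply: (@le_trans _ _ (\sum_(k < T) \sum_(j < Q | mainarc (omega Q ^+ j))
   expR (2 * @discE R) * (2 / c * lor r B (omega Q ^+ j)) *
   cmod (lagrange (@node R T (arcrad r B)) k).[omega Q ^+ j - 1])).
  apply: ler_sum => k _; apply: le_trans (cmod_sum _ _ _) _; apply: ler_sum => j hj.
  have w1 := cmod_omegaX (R := R) Q j.
  have [h _] := normpoly_inv r01 hJ hD hB1 hB4 w1 hj.
  rewrite !cmodM ler_wpM2r ?cmod_ge0 //.
  by rewrite -[leRHS]mul1r; apply: ler_pM; rewrite ?cmod_ge0 ?hv.
rewrite exchange_big /= [leRHS]mulrC.
apply: le_trans (ler_wpM2r Lam_ge0 main_weight_sum); rewrite mulr_suml.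
apply: ler_sum => j hj; rewrite -mulr_sumr; apply: ler_wpM2l.
  by rewrite mulr_ge0 ?expR_ge0 // mulr_ge0 ?lor_ge0 // divr_ge0 // ltW.
exact: lagrange_node_bound.
Qed.

(** The bound of [interp_error] with rho = discrad and q = B^(-2), since discrad B^(-2) = arcrad. *)
Definition interpE : R := 2 * (1 + Lam) * expR discF * B ^- 2 ^+ T.

Lemma interpE_ge0 : 0 <= interpE.
Proof.
have := Lam_ge0 => L0; rewrite /interpE mulr_ge0 ?exprn_ge0 ?invr_ge0 ?(ltW (Bk0 _)) //.
by rewrite mulr_ge0 ?expR_ge0 // mulr_ge0 // addr_ge0.
Qed.

(** On the arc the product is N^(-d) [fpoly], and only [fpoly] depends on xi. Interpolating it
    leaves T values of [fpoly], with coefficients independent of xi. *)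
Lemma arc_approx (xi : 'rV[R]_d) (v : C -> C) : (forall w, cmod w = 1 -> cmod (v w) <= 1) ->
  cmod (\sum_(j < Q | mainarc (omega Q ^+ j))
          (\prod_(i < d) phi1 J r (xi 0 i) (omega Q ^+ j)) * v (omega Q ^+ j)
        - \sum_k arccoef v k * (fpoly J r xi).[@node R T (arcrad r B) k])
  <= Q%:R * (mainC * W) * interpE.
Proof.
move=> hv.
have -> : \sum_k arccoef v k * (fpoly J r xi).[@node R T (arcrad r B) k] =
  \sum_(j < Q | mainarc (omega Q ^+ j)) v (omega Q ^+ j) * (normpoly J r).[omega Q ^+ j - 1] ^- d *
    \sum_k (lagrange (@node R T (arcrad r B)) k).[omega Q ^+ j - 1] *
      (fpoly J r xi).[@node R T (arcrad r B) k].
  under eq_bigr do rewrite /arccoef mulr_suml.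
  rewrite exchange_big; apply: eq_bigr => j _ /=; rewrite mulr_sumr.
  by apply: eq_bigr => k _; rewrite mulrA.
rewrite -sumrB; apply: le_trans (cmod_sum _ _ _) _.
apply: le_trans (ler_wpM2r interpE_ge0 main_weight_sum); rewrite mulr_suml.
apply: ler_sum => j hj; have w1 := cmod_omegaX (R := R) Q j.
have [h nz] := normpoly_inv r01 hJ hD hB1 hB4 w1 hj.
have e : \prod_(i < d) phi1 J r (xi 0 i) (omega Q ^+ j) =
   (normpoly J r).[omega Q ^+ j - 1] ^- d * (fpoly J r xi).[omega Q ^+ j - 1].
  by rewrite horner_fpoly mulKf ?expf_neq0 // (addrC 1) subrK.
rewrite e [X in X - _](_ : _ = v (omega Q ^+ j) * (normpoly J r).[omega Q ^+ j - 1] ^- d *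
   (fpoly J r xi).[omega Q ^+ j - 1]); last by rewrite mulrC mulrA.
rewrite -mulrBr cmodM; apply: ler_pM; rewrite ?cmod_ge0 //.
  by rewrite cmodM -[leRHS]mul1r; apply: ler_pM; rewrite ?cmod_ge0 ?hv.
have rq : discrad r B * B ^- 2 = arcrad r B.
  by rewrite /discrad /arcrad; field; rewrite gt_eqF.
have q1 : 0 <= B ^- 2 <= 2^-1.
  rewrite invr_ge0 (ltW (Bk0 2)) /= lef_pV2 ?posrE //; apply: (@le_trans _ _ B).
    by apply: le_trans hB1; rewrite ler_nat.
  by rewrite -[leLHS]expr1 ler_weXn2l.
apply: (@interp_error _ _ _ _ _ (discrad r B)) => //.
- exact: node_inj.
- by rewrite divr_ge0 // ltW.
- by move=> y hy; exact: (fpoly_le r01 hJ hD hB1).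
- move=> k; rewrite rq /node cmodR; have /andP[q2 q3] := node_le k (ltW A0).
  by rewrite ger0_norm.
- by rewrite rq.
- exact: lagrange_node_bound.
Qed.

Definition minorE : R := expR (- (c / 2 * B ^+ 2)).

Lemma arcs_disjoint w : mainarc w -> mainarc (- w) -> False.
Proof.
rewrite /mainarc -opprD cmodN => h1 h2.
have := cmodD (1 - w) (w + 1); rewrite (_ : 1 - w + (w + 1) = 2%:R); last by ring.
rewrite cmod_nat (cmod_distC 1 w); have := At; have := t1; lra.
Qed.

Lemma minor_small (xi : 'I_d -> R) w : cmod w = 1 -> ~~ mainarc w -> ~~ mainarc (- w) ->
  cmod (\prod_(i < d) phi1 J r (xi i) w) <= minorE.
Proof.
rewrite /mainarc -opprD cmodN -!ltNge => w1 /ltW h1 /ltW h2.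
exact: prod_phi1_minor.
Qed.

Lemma circle_approx (xi : 'rV[R]_d) :
  cmod (\sum_(j < Q) (\prod_(i < d) phi1 J r (xi 0 i) (omega Q ^+ j)) * cweight (omega Q ^+ j)
    - \sum_k arccoef cweight k * (fpoly J r xi).[@node R T (arcrad r B) k]
    - \sum_k arccoef (fun w => cweight (- w)) k *
        (fpoly J r (xi - halfvec d)).[@node R T (arcrad r B) k])
  <= Q%:R * (2 * (mainC * W * interpE) + minorE).
Proof.
pose F (w : C) := (\prod_(i < d) phi1 J r (xi 0 i) w) * cweight w.
have split3 : \sum_(j < Q) F (omega Q ^+ j) =
   \sum_(j < Q | mainarc (omega Q ^+ j)) F (omega Q ^+ j) +
   \sum_(j < Q) (if mainarc (- omega Q ^+ j) then F (omega Q ^+ j) else 0) +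
   \sum_(j < Q) (if mainarc (omega Q ^+ j) || mainarc (- omega Q ^+ j) then 0 else F (omega Q ^+ j)).
  rewrite [X in _ = X + _ + _]big_mkcond -!big_split; apply: eq_bigr => j _ /=.
  have := @arcs_disjoint (omega Q ^+ j).
  case: (mainarc (omega Q ^+ j)); case: (mainarc (- omega Q ^+ j)) => //= h.
  - by case: h.
  - by rewrite !addr0.
  - by rewrite add0r addr0.
  - by rewrite !add0r.
have anti : \sum_(j < Q) (if mainarc (- omega Q ^+ j) then F (omega Q ^+ j) else 0) =
   \sum_(j < Q | mainarc (omega Q ^+ j))
      (\prod_(i < d) phi1 J r ((xi - halfvec d) 0 i) (omega Q ^+ j)) * cweight (- omega Q ^+ j).
  rewrite -(sum_omega_opp (fun w => if mainarc (- w) then F w else 0) P0) [RHS]big_mkcond.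
  apply: eq_bigr => j _; rewrite opprK; case: ifP => // _; rewrite /F; congr (_ * _).
  by apply: eq_bigr => i _; rewrite phi1_opp !mxE.
have h1 := @arc_approx xi cweight cweight_le.
have h2 := @arc_approx (xi - halfvec d) (fun w => cweight (- w)).
have {}h2 := h2 (fun w w1 => cweight_le (etrans (cmodN w) w1)).
have h3 : cmod (\sum_(j < Q) (if mainarc (omega Q ^+ j) || mainarc (- omega Q ^+ j)
    then 0 else F (omega Q ^+ j))) <= Q%:R * minorE.
  apply: le_trans (cmod_sum _ _ _) _; apply: (@le_trans _ _ (\sum_(j < Q) minorE)); last first.
    by rewrite sumr_const card_ord mulr_natl.
  apply: ler_sum => j _; have w1 := cmod_omegaX (R := R) Q j.
  case: ifP => [_|/negbT]; first by rewrite cmod0 expR_ge0.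
  rewrite negb_or => /andP[m1 m2]; rewrite cmodM -[leRHS]mulr1.
  by apply: ler_pM; rewrite ?cmod_ge0 ?cweight_le ?minor_small.
have key (X1 X2 X3 Y1 Y2 : C) (a b : R) : cmod (X1 - Y1) <= a -> cmod (X2 - Y2) <= a ->
    cmod X3 <= b -> cmod (X1 + X2 + X3 - Y1 - Y2) <= a + a + b.
  move=> k1 k2 k3; have -> : X1 + X2 + X3 - Y1 - Y2 = (X1 - Y1) + (X2 - Y2) + X3 by ring.
  apply: le_trans (cmodD _ _) _; apply: lerD => //.
  by apply: le_trans (cmodD _ _) _; exact: lerD.
rewrite [leRHS](_ : _ = Q%:R * (mainC * W) * interpE + Q%:R * (mainC * W) * interpE
  + Q%:R * minorE); last by ring.
by rewrite [X in cmod (X - _ - _)]split3 anti; exact: key.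
Qed.

Hypothesis hmean : d%:R * lawmean J r = n%:R.
Hypothesis hrn : r ^+ n.+1 <= 2^-1.

(** [lowK] B^(-6) measures the error of the Gaussian approximation on the arc; [lowq] W is a quarter
    of the angle [del] in [circle_lower]. *)
Definition lowK : R := 216 * @cubeC R / c + 2 / c.
Definition lowq : R := (32 * (1 + mc 2))^-1.

Lemma lowK_ge0 : 0 <= lowK.
Proof.
apply: addr_ge0; apply: divr_ge0; rewrite ?(ltW c0) //.
by apply: mulr_ge0; rewrite ?ler0n ?cubeC_ge0.
Qed.

Hypothesis hB6 : 16 * lowK <= lowq * B.
Hypothesis hB7 : minorE <= lowq / 4 * W.

(** The representative of j / Q modulo 1 that satisfies the bound |s| <= 1/2 of [cenlaw_pow]. *)
Definition angle (j : nat) : R := if (j <= P)%N then j%:R / Q%:R else j%:R / Q%:R - 1.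

Lemma angle_le j : (j < Q)%N -> `|angle j| <= 2^-1.
Proof.
move=> jQ; rewrite /angle; case: leqP => h.
  rewrite ger0_norm ?divr_ge0 // ler_pdivrMr // natrD.
  have : j%:R <= P%:R :> R by rewrite ler_nat.
  by lra.
rewrite -[X in _ / _ - X](@divff _ Q%:R) ?gt_eqF // -mulrBl normrM normfV (gtr0_norm Q0).
rewrite ler_pdivrMr // distrC -natrB ?(ltnW jQ) // normr_nat.
have : (Q - j)%:R <= P%:R :> R by rewrite ler_nat leq_subLR leq_add2r ltnW.
by rewrite natrD; lra.
Qed.

Lemma omega_angle j : omega Q ^+ j = expi2pi (angle j) :> C.
Proof.
rewrite omegaXE /angle; case: leqP => // _.
by rewrite -(expi2piDint (_ - 1) 1) subrK.
Qed.

Lemma term_lower j : (j < Q)%N ->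
  (if mainarc (omega Q ^+ j) then (1 - r ^+ n.+1) * gaussq J r (angle j) ^+ d else 0)
   - lowK * B ^- 6 * lor r B (omega Q ^+ j) - minorE
  <= Re (phi0 J r (omega Q ^+ j) ^+ d * cweight (omega Q ^+ j)).
Proof.
move=> jQ; have w1 := cmod_omegaX (R := R) Q j.
have L0 := lor_ge0 r B (omega Q ^+ j : C).
have lK0 := lowK_ge0.
have lL0 : 0 <= lowK * B ^- 6 * lor r B (omega Q ^+ j : C).
  by rewrite !mulr_ge0 // invr_ge0 ltW.
have E0 : 0 <= minorE by exact: expR_ge0.
have cpr : cmod (phi0 J r (omega Q ^+ j) ^+ d) =
   cmod (\prod_(i < d) phi1 J r ((fun=> 0) i) (omega Q ^+ j)).
  by under [in RHS]eq_bigr do rewrite phi1_0; rewrite prodr_const card_ord.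
have small : cmod (phi0 J r (omega Q ^+ j) ^+ d) <= minorE ->
    - minorE <= Re (phi0 J r (omega Q ^+ j) ^+ d * cweight (omega Q ^+ j)).
  move=> h; have := Re_le_cmod (phi0 J r (omega Q ^+ j) ^+ d * cweight (omega Q ^+ j)).
  rewrite ler_norml => /andP[h1 _]; apply: le_trans h1; rewrite lerN2 cmodM -[leRHS]mulr1.
  by apply: ler_pM; rewrite ?cmod_ge0 ?cweight_le.
case: ifP => [hm|/negbT hm]; last first.
  apply: (le_trans _ (small _)); first by lra.
  have [ha|ha] := boolP (mainarc (- omega Q ^+ j)); last by rewrite cpr minor_small.
  rewrite cmodX; apply: (phi0_opp_small r01 hJ hD hB1 hB5) => //.
  by move: ha; rewrite /mainarc -opprD cmodN.
set s := angle j; set w := omega Q ^+ j in w1 L0 lL0 cpr hm *.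
have ws : w = expi2pi s by exact: omega_angle.
have hm' : cmod (expi2pi s - 1) <= arcrad r B by rewrite -ws.
have [g0 hg] := cenlaw_pow r01 hJ hD hB1 hB2 hB3 (angle_le jQ) hm'.
rewrite -/s -ws in g0 hg.
(* This is what the choice of r is for: phi0^d carries the phase w^(d mean) = w^n, which cancels the
   factor w^(-n) of [cweight]. *)
have e : phi0 J r w ^+ d * cweight w = cenlaw J r s ^+ d * (t%:C * Gn (r%:C * w)).
  have -> : phi0 J r w ^+ d = expi2pi (s * n%:R) * cenlaw J r s ^+ d.
    by rewrite ws phi0_cenlaw exprMn -expi2piMn -mulrA (mulrC _ d%:R) hmean.
  rewrite expi2piMn -ws /cweight.
  have wn : w ^+ n != 0 by rewrite -cmod_eq0 cmodX w1 expr1n oner_eq0.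
  by field.
have Ale : cmod (cenlaw J r s ^+ d) <= 2 / c * lor r B w.
  have -> : cmod (cenlaw J r s ^+ d) = cmod (phi0 J r w ^+ d).
    by rewrite !cmodX ws phi0_cenlaw cmodM cmod_expi2pi mul1r.
  rewrite cpr; apply: prod_phi1_lor => //.
  by apply: (le_trans hm); apply: (le_trans At); have := t0; lra.
set gg := 1 - r ^+ n.+1.
have gg0 : 0 <= gg by rewrite subr_ge0 exprn_ile1 ?(ltW r0) //; have := t0; lra.
have gg1 : gg <= 1 by rewrite gerBl exprn_ge0 // ltW.
have key : cmod (cenlaw J r s ^+ d * (t%:C * Gn (r%:C * w)) - (gg * gaussq J r s ^+ d)%:C)
   <= lowK * B ^- 6 * lor r B w.
  have -> : cenlaw J r s ^+ d * (t%:C * Gn (r%:C * w)) - (gg * gaussq J r s ^+ d)%:C =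
    (cenlaw J r s ^+ d - (gaussq J r s ^+ d)%:C) * gg%:C +
    cenlaw J r s ^+ d * (t%:C * Gn (r%:C * w) - gg%:C) by rewrite rcM; ring.
  apply: le_trans (cmodD _ _) _.
  rewrite [leRHS](_ : _ = 216 * @cubeC R / c * B ^- 6 * lor r B w * 1
     + 2 / c * lor r B w * B ^- 6); last by rewrite /lowK mulrDl mulrDl mulr1 [X in _ + X]mulrAC.
  apply: lerD; rewrite cmodM.
    apply: ler_pM; rewrite ?cmod_ge0 //.
    by rewrite cmodR ger0_norm.
  apply: ler_pM; rewrite ?cmod_ge0 //; apply: le_trans (tGn_dist w1) _.
  rewrite ler_pdivrMr //; apply: (le_trans hm); rewrite /arcrad mulrC ler_wpM2r ?(ltW t0) //.
  by rewrite lef_pV2 ?posrE // ler_weXn2l.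
rewrite e; have := Re_le_cmod (cenlaw J r s ^+ d * (t%:C * Gn (r%:C * w)) - (gg * gaussq J r s ^+ d)%:C).
rewrite ReB /= ler_norml => /andP[h1 _].
have : gg * gaussq J r s ^+ d - lowK * B ^- 6 * lor r B w <=
   Re (cenlaw J r s ^+ d * (t%:C * Gn (r%:C * w))) by lra.
lra.
Qed.

(* The points at angle at most del contribute a positive multiple of W; the other ones are
   only bounded below, by the errors of term_lower. *)
Lemma circle_lower : Q%:R * (lowq / 2 * W) <=
  Re (\sum_(j < Q) phi0 J r (omega Q ^+ j) ^+ d * cweight (omega Q ^+ j)).
Proof.
have m2 := @mc_ge0 R 2.
have q0 : 0 < lowq by rewrite invr_gt0 mulr_gt0 // ltr_pwDl.
(* As pi <= 4, an angle s <= del satisfies 2 pi s (1 + mc 2) <= W, which is enough for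
   [gaussq_pow_ge]. *)
pose del : R := W / (8 * (1 + mc 2)).
have m1 : 0 < 1 + mc 2 :> R by rewrite ltr_pwDl.
have del0 : 0 < del by rewrite divr_gt0 // mulr_gt0.
have delW : del * (8 * (1 + mc 2)) = W by rewrite divfK // gt_eqF // mulr_gt0.
have del2 : del <= 2^-1.
  have := W1; have : 0 <= del * mc 2 by rewrite mulr_ge0 // ltW.
  by lra.
rewrite Re_sum.
pose good (j : nat) := j%:R / Q%:R <= del.
have hgood (j : 'I_Q) : good j -> angle j = j%:R / Q%:R /\ 0 <= angle j <= del.
  move=> gj; have jP : (j <= P)%N.
    rewrite -(ler_nat R); have : j%:R / Q%:R <= 2^-1 :> R by apply: le_trans gj del2.
    by rewrite ler_pdivrMr // natrD; lra.
  by rewrite /angle jP; split=> //; rewrite divr_ge0.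
have pi4 : pi <= 4 :> R by have := pihalf_lt2 R; lra.
have pi0 := pi_gt0 R.
have term (j : 'I_Q) : (if good j then 4^-1 else 0)
    - lowK * B ^- 6 * lor r B (omega Q ^+ j) - minorE <=
   Re (phi0 J r (omega Q ^+ j) ^+ d * cweight (omega Q ^+ j)).
  apply: le_trans (term_lower (ltn_ord j)); rewrite !lerD2r.
  have gq0 : mainarc (omega Q ^+ j) -> 0 <= gaussq J r (angle j).
    move=> hm; rewrite /mainarc omega_angle in hm.
    by have [] := cenlaw_pow r01 hJ hD hB1 hB2 hB3 (angle_le (ltn_ord j)) hm.
  have rn1 : 2^-1 <= 1 - r ^+ n.+1 by have := hrn; lra.
  case: ifP => gj; last first.
    case: ifP => // hm; rewrite mulr_ge0 ?exprn_ge0 ?gq0 //; lra.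
  have [_ /andP[s0 s1]] := hgood j gj.
  have h2 : 2 * pi * angle j <= W.
    apply: (@le_trans _ _ (8 * del)).
      apply: ler_pM => //; first by rewrite mulr_ge0 // ltW.
      by lra.
    have : 0 <= del * mc 2 by rewrite mulr_ge0 // ltW.
    by lra.
  have h20 : 0 <= 2 * pi * angle j by rewrite !mulr_ge0 // ltW.
  have hm : mainarc (omega Q ^+ j).
    rewrite /mainarc omega_angle; apply: le_trans (expi2pi_dist_le _) _.
    by rewrite ger0_norm //; exact: le_trans h2 WA.
  rewrite hm.
  have hgq : 2^-1 <= gaussq J r (angle j) ^+ d.
    apply: (gaussq_pow_ge r01 hJ hD hB1).
    have h3 : 2 * pi * angle j * (1 + mc 2) <= W.
      rewrite -delW (_ : del * _ = 8 * del * (1 + mc 2)); last by ring.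
      rewrite ler_wpM2r ?(ltW m1) //.
      apply: ler_pM => //; first by rewrite mulr_ge0 // ltW.
      by lra.
    apply: (@le_trans _ _ ((2 * pi * angle j * (1 + mc 2)) ^+ 2)).
      rewrite [leRHS]exprMn; apply: ler_wpM2l; first exact: sqr_ge0.
      by move: m2; move: (mc 2 : R) => u ?; nra.
    by rewrite lerXn2r ?nnegrE ?(ltW W0) // mulr_ge0 // ltW.
  apply: (@le_trans _ _ (2^-1 * 2^-1)); first by lra.
  by apply: ler_pM.
apply: (le_trans _ (ler_sum _ (fun j _ => term j))).
rewrite !sumrB -mulr_sumr sumr_const card_ord -[minorE *+ _]mulr_natl.
(* The indices from 0 to the integer part of Q del are good, so there are more than Q del of
   them. *)
have cnt : Q%:R * del * 4^-1 <= \sum_(j < Q) (if good j then 4^-1 else 0).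
  have qd0 : 0 <= Q%:R * del by rewrite mulr_ge0 ?(ltW Q0) // ltW.
  have /andP[k1 k2] := truncn_itv qd0; set k := Num.truncn _ in k1 k2.
  have kQ : (k.+1 <= Q)%N.
    rewrite -(ltr_nat R); apply: (le_lt_trans k1); rewrite gtr_pMr //.
    by apply: (le_lt_trans del2); lra.
  rewrite -(big_mkord xpredT (fun j => if good j then 4^-1 else 0)).
  have kk : (0 <= k.+1 <= Q)%N by [].
  have nn j : 0 <= (if good j then 4^-1 else 0) :> R by case: ifP => //; rewrite invr_ge0.
  apply: le_trans (@ler_subsum_nat R (fun j => if good j then 4^-1 else 0) 0 k.+1 Q nn kk).
  apply: (@le_trans _ _ (\sum_(0 <= j < k.+1) 4^-1)).
    by rewrite sumr_const_natr subn0 ler_wpM2r ?invr_ge0 // ltW.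
  apply: ler_sum_nat => j /andP[_ jk]; rewrite ifT //.
  rewrite /good ler_pdivrMr // mulrC; apply: le_trans k1; rewrite ler_nat -ltnS //.
apply: (@le_trans _ _ (Q%:R * del * 4^-1 - lowK * B ^- 6 * (Q%:R * (4 * W)) - Q%:R * minorE));
  last first.
  rewrite lerD2r; apply: lerD => //; rewrite lerN2; apply: ler_wpM2l sum_lor_le.
  by rewrite mulr_ge0 ?lowK_ge0 // invr_ge0 (ltW (Bk0 _)).
have e1 : Q%:R * del * 4^-1 = Q%:R * (lowq * W).
  by rewrite /del /lowq; field; rewrite gt_eqF.
rewrite e1.
have h6 : lowK * B ^- 6 * 4 <= lowq / 4.
  rewrite mulrAC ler_pdivrMr //.
  have : lowq / 4 * B <= lowq / 4 * B ^+ 6.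
    rewrite ler_wpM2l ?divr_ge0 ?(ltW q0) //.
    by rewrite -[leLHS]expr1 ler_weXn2l.
  by have := hB6; lra.
have := ler_wpM2r (ltW W0) h6 => h6W.
rewrite [X in _ - X - _](_ : _ = Q%:R * (lowK * B ^- 6 * 4 * W)); last by ring.
rewrite -!mulrBr ler_wpM2l ?(ltW Q0) //; have := hB7; lra.
Qed.

End CircleSum.

(** * The multiplier as a quotient of circle sums *)

Section Approximation.
Context {R : realType}.
Local Notation C := R[i].

Lemma phi1_scale J (r x y : R) : 0 < r < 1 -> 0 < r * (1 + x) < 1 ->
  phi1 J r y (1 + x%:C) =
  (thetaJ J (r * (1 + x)) / thetaJ J r)%:C * phi1 J (r * (1 + x)) y 1.
Proof.
move=> r01 s01; have h0 := thetaJ_gt0 J r01.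
have nz : (thetaJ J r)%:C != 0 :> C by rewrite fmorph_eq0 gt_eqF.
apply: (mulfI nz); rewrite -sum_phase_scale // mulrA -rcM mulrCA divff ?gt_eqF // mulr1.
rewrite -sum_phase_scale // mulr1; apply: eq_bigr => k _; congr phase.
by rewrite [RHS]rcM rcD.
Qed.

Lemma phi0_1 J (r : R) : 0 <= r -> phi0 J r 1 = 1.
Proof.
move=> r0; rewrite -phi1_0 phi1E.
under eq_bigr do rewrite /phase expr1n mulr0 expi2pi0 !mulr1.
by rewrite -rc_sum pJ_sum1.
Qed.

(* This is why real nodes are used: there fpoly is again the transform of a Gaussian, of
   parameter r (1 + x), up to a factor independent of xi. *)
Lemma fpoly_scale d J (r x : R) (xi : 'rV[R]_d) : 0 < r < 1 -> 0 < r * (1 + x) < 1 ->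
  (fpoly J r xi).[x%:C] =
  (fpoly J r (0 : 'rV[R]_d)).[x%:C] * \prod_(i < d) phi1 J (r * (1 + x)) (xi 0 i) 1.
Proof.
move=> r01 s01; rewrite !horner_fpoly -mulrA; congr (_ * _).
rewrite -big_split; apply: eq_bigr => i _ /=.
rewrite !phi1_scale // mxE phi1_0 phi0_1 ?mulr1 //.
by case/andP: s01 => /ltW.
Qed.

Context (d n J P T : nat) (r B : R).
Local Notation t := (1 - r).
Local Notation Q := (P + P)%N.
Local Notation W := (width r B).

Hypothesis r01 : 0 < r < 1.
Hypothesis hJ : 64 <= t * J%:R ^+ 2.
Hypothesis hD : d%:R * r = B ^+ 18.
Hypothesis hB1 : 4 <= B.
Hypothesis hB2 : 108 * @cubeC R <= @decayC R * B.
Hypothesis hB3 : 9 * mc 2 <= 2 * B.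
Hypothesis hB4 : 2 * @discE R <= B.
Hypothesis hB5 : mc 2 <= @decayC R * B.
Hypothesis hB6 : 16 * @lowK R <= lowq * B.
Hypothesis hB7 : minorE B <= lowq / 4 * W.
Hypothesis P0 : (0 < P)%N.
Hypothesis hQ : (1 - W) ^+ Q <= 2^-1.
Hypothesis hmean : d%:R * lawmean J r = n%:R.
Hypothesis hrn : r ^+ n.+1 <= 2^-1.
Hypothesis nJ : (n <= J)%N.
Hypothesis hPQ : (d * J ^ 2 + n.+1 <= Q)%N.

Let r0 : 0 < r. Proof. by case/andP: r01. Qed.
Let t0 : 0 < t. Proof. by case/andP: r01 => ? ?; rewrite subr_gt0. Qed.
Let B0 : 0 < B. Proof. by apply: lt_le_trans hB1. Qed.
Let W0 : 0 < W. Proof. by rewrite divr_gt0 // exprn_gt0. Qed.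
Let Q0 : 0 < (Q%:R : R). Proof. by rewrite ltr0n addn_gt0 P0. Qed.
Let lowq0 : 0 < @lowq R.
Proof. by rewrite invr_gt0 mulr_gt0 // ltr_pwDl // mc_ge0. Qed.

Definition circsum (xi : 'rV[R]_d) : C :=
  \sum_(j < Q) (\prod_(i < d) phi1 J r (xi 0 i) (omega Q ^+ j)) * cweight n r (omega Q ^+ j).

Lemma circsum_ball (xi : 'rV[R]_d) : circsum xi =
  (t * Q%:R * (r ^+ n / thetaJ J r ^+ d))%:C *
  \sum_(x <- fset_set (@intball d n)) expi2pi (dotp x xi).
Proof.
have h := ball_identity xi r01 nJ hPQ.
rewrite (rcM (t * Q%:R)) (rcM t) rc_nat -!mulrA -h mulr_sumr; apply: eq_bigr => j _.
by rewrite /cweight /Gn; ring.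
Qed.

Lemma circsum0_ge : Q%:R * (lowq / 2 * W) <= cmod (circsum 0).
Proof.
apply: le_trans (circle_lower r01 hJ hD hB1 hB2 hB3 hB5 P0 hQ hmean hrn hB6 hB7) _.
apply: le_trans (ler_norm _) _; rewrite [leRHS](_ : _ = cmod (\sum_(j < Q)
  phi0 J r (omega Q ^+ j) ^+ d * cweight n r (omega Q ^+ j))); first exact: Re_le_cmod.
congr cmod; apply: eq_bigr => j _; congr (_ * _).
under eq_bigr do rewrite mxE phi1_0.
by rewrite prodr_const card_ord.
Qed.

Let cs0 : 0 < Q%:R * (@lowq R / 2 * W).
Proof. by rewrite mulr_gt0 // mulr_gt0 // divr_gt0. Qed.

Lemma circsum0_neq0 : circsum 0 != 0.
Proof. by rewrite -cmod_eq0 gt_eqF // (lt_le_trans cs0) // circsum0_ge. Qed.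

(** At xi = 0 the exponential sum is the cardinality of the ball, and the common factor of
    [circsum_ball] cancels. *)
Lemma ballmult_circsum (xi : 'rV[R]_d) : ballmult n xi = circsum xi / circsum 0.
Proof.
have nz := circsum0_neq0.
have e : \sum_(x <- fset_set (@intball d n)) expi2pi (dotp x (0 : 'rV[R]_d)) =
    #|` fset_set (@intball d n)|%:R :> C.
  have e0 (x : 'rV[int]_d) : expi2pi (dotp x (0 : 'rV[R]_d)) = 1.
    by rewrite /dotp big1 ?expi2pi0 // => i _; rewrite mxE mulr0.
  under eq_bigr do rewrite e0.
  by rewrite big_const_seq count_predT iter_addr_0.
have e2 := circsum_ball 0; rewrite e in e2.
move: nz; rewrite /ballmult e2 circsum_ball mulf_eq0 negb_or => /andP[k1 k2].
by rewrite invfM mulrACA divff // mul1r mulrC.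
Qed.

(** The widths cancel: before normalisation each family sums to at most Lam mainC exp(discF) Q W,
    and the divisor is at least Q W lowq / 2. So the bound depends on T alone; the leading 2 counts
    alpha and beta. *)
Definition coefC : R := 2 * (Lam T * mainC * expR discF * 2 / lowq).
Definition arcE : R := (2 * (mainC * W * interpE T B) + minorE B) / (lowq / 2 * W).

Lemma ballmult_approx (e : R) :
  (forall s, 0 < s <= 1 - t / 2 -> forall xi : 'rV[R]_d,
     cmod (gausshat s xi - \prod_(i < d) phi1 J s (xi 0 i) 1) <= e) ->
  exists (alpha beta : 'I_T -> C) (s : 'I_T -> R),
    [/\ forall k, 0 < s k < 1,
        \sum_k (cmod (alpha k) + cmod (beta k)) <= coefC &
        forall xi : 'rV[R]_d, cmod (ballmult n xi - \sum_k alpha k * gausshat (s k) xi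
          - \sum_k beta k * gausshat (s k) (xi - halfvec d)) <= arcE + coefC * e].
Proof.
move=> he; have nz := circsum0_neq0.
have A0 : 0 < arcrad r B by rewrite divr_gt0 // exprn_gt0.
have B1 : 1 <= B by apply: le_trans hB1; rewrite ler1n.
have At : arcrad r B <= t / 4.
  rewrite ler_wpM2l ?(ltW t0) // lef_pV2 ?posrE ?exprn_gt0 //; apply: (le_trans hB1).
  by rewrite -[leLHS]expr1 ler_weXn2l.
have AD : arcrad r B <= discrad r B.
  by rewrite ler_wpM2l ?(ltW t0) // lef_pV2 ?posrE ?exprn_gt0 // ler_weXn2l.
pose x (k : 'I_T) : R := arcrad r B * (k.+1%:R / T%:R).
have x01 k : 0 <= x k <= arcrad r B by exact: node_le (ltW A0).
pose s k := r * (1 + x k).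
(* Since x <= arcrad <= t / 4, the parameter r (1 + x) keeps distance at least t / 2 from 1. *)
have hs k : 0 < s k <= 1 - t / 2.
  have /andP[x0 x1] := x01 k; rewrite mulr_gt0 ?ltr_pwDl //=.
  have : r * x k <= x k by rewrite ler_piMl //; have := t0; lra.
  by rewrite /s mulrDr mulr1; lra.
have s01 k : 0 < s k < 1 by have /andP[-> h] := hs k; have := t0; lra.
have e0 : 0 <= e by apply: le_trans (cmod_ge0 _) (he _ (_ : 0 < 1 - t / 2 <= _) 0);
  rewrite lexx andbT; have := r0; lra.
pose kap k := (fpoly J r (0 : 'rV[R]_d)).[(x k)%:C].
have kapE (xi : 'rV[R]_d) k : (fpoly J r xi).[@node R T (arcrad r B) k] =
    kap k * \prod_(i < d) phi1 J (s k) (xi 0 i) 1.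
  by rewrite /kap /s -fpoly_scale //; exact: s01.
have kap_le k : cmod (kap k) <= expR discF.
  have /andP[x0 x1] := x01 k; refine (fpoly_le r01 hJ hD hB1 _ _).
  by rewrite cmodR ger0_norm // (le_trans x1).
pose co v k := arccoef d J P r B v k * kap k / circsum 0.
have hco v : (forall w, cmod w = 1 -> cmod (v w) <= 1) ->
    \sum_(k < T) cmod (co v k) <= Lam T * mainC * expR discF * 2 / lowq.
  move=> hv; have h := arccoef_sum T r01 hJ hD hB1 hB4 hQ hv.
  apply: (@le_trans _ _ (\sum_(k < T) cmod (arccoef d J P r B v k) * (expR discF / (Q%:R * (lowq
    / 2 * W))))).
    apply: ler_sum => k _; rewrite /co !cmodM cmodV -mulrA ler_wpM2l ?cmod_ge0 //.
    apply: ler_pM; rewrite ?invr_ge0 ?cmod_ge0 // lef_pV2 ?posrE // ?circsum0_ge //.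
    exact: lt_le_trans cs0 circsum0_ge.
  rewrite -mulr_suml; apply: le_trans (ler_wpM2r _ h) _.
    by apply: divr_ge0; [exact: expR_ge0|exact: ltW cs0].
  by apply: eqW_le; field; rewrite -natrD (gt_eqF Q0) (gt_eqF W0) (gt_eqF lowq0).
pose c1 := cweight n r; pose c2 := fun w => cweight n r (- w).
have hc1 w : cmod w = 1 -> cmod (c1 w) <= 1 by move=> w1; exact: cweight_le.
have hc2 w : cmod w = 1 -> cmod (c2 w) <= 1.
  by move=> w1; apply: cweight_le => //; rewrite cmodN.
have hsum : \sum_k (cmod (co c1 k) + cmod (co c2 k)) <= coefC.
  by rewrite big_split /coefC mulr_natl mulr2n; apply: lerD; exact: hco.
exists (co c1), (co c2), s; split=> // xi.
pose Pr k (y : 'rV[R]_d) := \prod_(i < d) phi1 J (s k) (y 0 i) 1.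
(* The finite products [Pr] stand in between: the first part is the circle error divided by
   [circsum 0], the second replaces each [Pr] by [gausshat]. *)
have -> : ballmult n xi - \sum_k co c1 k * gausshat (s k) xi
    - \sum_k co c2 k * gausshat (s k) (xi - halfvec d) =
  (circsum xi - \sum_k arccoef d J P r B c1 k * (fpoly J r xi).[@node R T (arcrad r B) k]
    - \sum_k arccoef d J P r B c2 k * (fpoly J r (xi - halfvec d)).[@node R T (arcrad r B) k])
    / circsum 0 -
  \sum_k (co c1 k * (gausshat (s k) xi - Pr k xi) +
          co c2 k * (gausshat (s k) (xi - halfvec d) - Pr k (xi - halfvec d))).
  have ee v y : (\sum_k arccoef d J P r B v k * (fpoly J r y).[@node R T (arcrad r B) k]) / circsum 0
      = \sum_k co v k * Pr k y.
    by rewrite mulr_suml; apply: eq_bigr => k _; rewrite kapE /co /Pr; ring.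
  rewrite ballmult_circsum !mulrBl !ee big_split /=.
  under [X in _ = _ - (X + _)]eq_bigr do rewrite mulrBr.
  under [X in _ = _ - (_ + X)]eq_bigr do rewrite mulrBr.
  by rewrite !sumrB; ring.
apply: le_trans (cmodB _ _) _; apply: lerD.
  rewrite cmodM cmodV /arcE.
  have h := circle_approx n T r01 hJ hD hB1 hB4 P0 hQ xi.
  have le1 : (cmod (circsum 0))^-1 <= (Q%:R * (lowq / 2 * W))^-1.
    by rewrite lef_pV2 ?posrE ?circsum0_ge // (lt_le_trans cs0) ?circsum0_ge.
  apply: le_trans (ler_pM (cmod_ge0 _) _ h le1) _; first by rewrite invr_ge0 cmod_ge0.
  by rewrite invfM mulrACA divff ?gt_eqF // mul1r.
apply: le_trans (cmod_sum _ _ _) _; apply: le_trans (ler_wpM2r e0 hsum); rewrite mulr_suml.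
apply: ler_sum => k _; apply: le_trans (cmodD _ _) _; rewrite mulrDl.
rewrite (cmodM (co c1 k)) (cmodM (co c2 k)).
by apply: lerD; (apply: ler_wpM2l; first exact: cmod_ge0); exact: (he _ (hs k)).
Qed.

End Approximation.

(** * Constants, and errors as powers of B *)

Section ScaleConstants.
Context {R : realType}.
Local Notation C := R[i].
Local Notation c := (@decayC R).

(** The constant of [mean_lower_scale]. *)
Definition lowA : R := 16^-1 ^+ 4 / 8.

Lemma lowA_gt0 : 0 < lowA.
Proof. by rewrite divr_gt0 // exprn_gt0 // invr_gt0. Qed.

Lemma lowA_le1 : lowA <= 1.
Proof.
by rewrite /lowA; lra.
Qed.

Lemma lowq_gt0 : 0 < @lowq R.
Proof. by rewrite invr_gt0 mulr_gt0 // ltr_pwDl // mc_ge0. Qed.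

Definition minorC (K : nat) : R := (2 * K%:R / c) ^+ K.

Lemma minorC_ge0 K : 0 <= minorC K.
Proof.
apply: exprn_ge0; apply: divr_ge0; last exact: ltW decayC_gt0.
by rewrite mulr_ge0 // ler0n.
Qed.

(** Writing the exponent as K y, exp(-K y) <= y^(-K). *)
Lemma minorE_le (B : R) K : 0 < B -> (0 < K)%N -> minorE B <= minorC K * B ^- (2 * K).
Proof.
move=> B0 K0; have c0 := @decayC_gt0 R.
have K0' : 0 < K%:R :> R by rewrite ltr0n.
pose y : R := c / 2 * B ^+ 2 / K%:R.
have y0 : 0 < y by rewrite /y divr_gt0 // mulr_gt0 ?exprn_gt0 // divr_gt0.
have -> : minorC K * B ^- (2 * K) = y ^- K.
  rewrite /minorC exprM -!exprVn -exprMn; congr (_ ^+ _).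
  by rewrite /y; field; rewrite !gt_eqF.
rewrite /minorE expRN lef_pV2 ?posrE ?expR_gt0 ?exprn_gt0 //.
rewrite (_ : c / 2 * B ^+ 2 = K%:R * y); last by rewrite /y [RHS]mulrC divfK // gt_eqF.
rewrite expRM_natl; apply: lerXn2r; rewrite ?nnegrE ?expR_ge0 ?(ltW y0) //.
by apply: le_trans (expR_ge1Dx y); rewrite lerDr.
Qed.

(* With 9 N nodes and B^18 = d r, the interpolation error is of order
   B^(-18 N) = (d r)^(-N). *)
Definition minorK N := (9 * N + 32)%N.

Definition arcC N : R :=
  4 * mainC * (2 * (1 + Lam (9 * N)) * expR discF) / lowq +
  32 * minorC (minorK N) / (lowq * lowA).

Lemma width_ge (r B : R) : 0 < B -> lowA <= 16 * B ^+ 54 * (1 - r) ->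
  lowA / 16 * B ^- 63 <= width r B.
Proof.
move=> B0 h; have Bk k : 0 < B ^+ k by rewrite exprn_gt0.
rewrite /width ler_pdivlMr // [leLHS](_ : _ = lowA / 16 / B ^+ 54).
  by rewrite ler_pdivrMr // ler_pdivrMr //; lra.
rewrite [in LHS](_ : 63 = 54 + 9)%N // exprD.
by move: (Bk 54) (Bk 9); move: (B ^+ 54) (B ^+ 9) => u v u0 v0; field; rewrite !gt_eqF.
Qed.

(** 2 minorK N = (18 N + 1) + 63: the 63 = 54 + 9 powers pay for the width ([width_ge]), 18 N give
    the accuracy, and the spare one makes [minorE] small against the width. *)
Lemma minorE_width N (r B : R) : 1 <= B -> lowA <= 16 * B ^+ 54 * (1 - r) ->
  minorE B <= 16 * minorC (minorK N) / lowA * B ^- (18 * N).+1 * width r B.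
Proof.
move=> B1 h; have B0 : 0 < B by lra.
have Bk k : 0 < B ^+ k by rewrite exprn_gt0.
have m0 := minorC_ge0 (minorK N); have a0 := lowA_gt0.
apply: (le_trans (minorE_le B0 (_ : (0 < minorK N)%N))); first by rewrite addn_gt0 orbT.
apply: le_trans (ler_wpM2l _ (width_ge B0 h)); last first.
  by rewrite mulr_ge0 ?invr_ge0 ?(ltW (Bk _)) // divr_ge0 ?mulr_ge0 // ltW.
rewrite (_ : 2 * minorK N = (18 * N).+1 + 63)%N; last by rewrite /minorK; lia.
rewrite exprD invfM; apply: eqW_le.
set u := B ^- _; set v := B ^- _; field; rewrite ?gt_eqF //.
Qed.

Lemma arcE_le N (r B : R) : 0 < r < 1 -> 1 <= B -> lowA <= 16 * B ^+ 54 * (1 - r) ->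
  arcE (9 * N) r B <= arcC N * B ^- (18 * N).
Proof.
move=> /andP[r0 r1] B1 h; have B0 : 0 < B by lra.
have Bk k : 0 < B ^+ k by rewrite exprn_gt0.
have a0 := lowA_gt0; have q0 := lowq_gt0.
have W0 : 0 < width r B by rewrite divr_gt0 // subr_gt0.
have m0 := minorC_ge0 (minorK N).
have hm := minorE_width N B1 h.
have hm2 : 16 * minorC (minorK N) / lowA * B ^- (18 * N).+1 <=
    16 * minorC (minorK N) / lowA * B ^- (18 * N).
  apply: ler_wpM2l; first by rewrite divr_ge0 ?mulr_ge0 // ltW.
  by rewrite lef_pV2 ?posrE // ler_weXn2l.
have {hm2}{}hm : minorE B <= 16 * minorC (minorK N) / lowA * B ^- (18 * N) * width r B.
  by apply: (le_trans hm); rewrite ler_wpM2r // ltW.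
rewrite /arcE ler_pdivrMr; last by rewrite mulr_gt0 // divr_gt0.
have -> : arcC N * B ^- (18 * N) * (lowq / 2 * width r B) =
  2 * (mainC * width r B * interpE (9 * N) B) +
  16 * minorC (minorK N) / lowA * B ^- (18 * N) * width r B.
  rewrite /arcC /interpE exprVn -exprM (_ : 2 * (9 * N) = 18 * N)%N; last by lia.
  set u := B ^- _; set l := Lam _; set F := expR _; set m := minorC _.
  by field; rewrite !gt_eqF.
exact: lerD.
Qed.

(** A sum of nonnegative thresholds, so that B >= [scaleB] exceeds each of them. The last one, 1 /
    lowA, serves to make n (1 - r) >= 1. *)
Definition scaleB N : R :=
  4 + 108 * @cubeC R / c + 9 * mc 2 + 2 * @discE R + mc 2 / c + 16 * @lowK R / lowq +
  64 * minorC (minorK N) / (lowq * lowA) + lowA^-1.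

Lemma scaleB_prop N (B : R) : scaleB N <= B ->
  [/\ 4 <= B, 108 * @cubeC R <= c * B, 9 * mc 2 <= 2 * B, 2 * @discE R <= B &
    [/\ mc 2 <= c * B, 16 * @lowK R <= lowq * B,
        64 * minorC (minorK N) / (lowq * lowA) <= B & lowA^-1 <= B]].
Proof.
have c0 := @decayC_gt0 R; have q0 := lowq_gt0; have a0 := lowA_gt0.
have dv (x y : R) : 0 <= x -> 0 < y -> 0 <= x / y.
  by move=> x0 y0; rewrite divr_ge0 // ltW.
have ml k (y : R) : 0 <= y -> 0 <= k%:R * y by move=> y0; rewrite mulr_ge0.
have h1 : 0 <= 108 * @cubeC R / c by exact: (dv _ _ (ml _ _ cubeC_ge0) c0).
have h2 := @mc_ge0 R 2.
have h3 := @discE_ge0 R.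
have h4 : 0 <= mc 2 / c by exact: dv.
have h5 : 0 <= 16 * @lowK R / lowq.
  apply: (dv _ _ _ q0); apply: (ml); apply: addr_ge0; apply: (dv _ _ _ c0) => //.
  by apply: (ml); exact: cubeC_ge0.
have h6 : 0 <= 64 * minorC (minorK N) / (lowq * lowA).
  by apply: (dv); [exact: (ml _ _ (minorC_ge0 _))|exact: mulr_gt0].
have h7 : 0 <= lowA^-1 by rewrite invr_ge0 ltW.
rewrite /scaleB => hB.
have aux (x y : R) : 0 < y -> x / y <= B -> x <= y * B.
  by move=> y0; rewrite ler_pdivrMr // mulrC.
have part (x1 x2 x3 x4 x5 x6 x7 : R) : 0 <= x1 -> 0 <= x2 -> 0 <= x3 -> 0 <= x4 ->
    0 <= x5 -> 0 <= x6 -> 0 <= x7 -> 4 + x1 + 9 * x2 + 2 * x3 + x4 + x5 + x6 + x7 <= B ->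
    [/\ 4 <= B, x1 <= B, 9 * x2 <= 2 * B, 2 * x3 <= B & [/\ x4 <= B, x5 <= B, x6 <= B & x7 <= B]].
  by move=> *; split; [lra|lra|lra|lra|split; lra].
have [p1 p2 p3 p4 [p5 p6 p7 p8]] := part _ _ _ _ _ _ _ h1 h2 h3 h4 h5 h6 h7 hB.
by split=> //; [exact: aux c0 p2|split=> //; [exact: aux c0 p5|exact: aux q0 p6]].
Qed.

End ScaleConstants.

(** * Choice of the parameters and conclusion *)

Section Choice.
Context {R : realType}.
Local Notation C := R[i].

Lemma root_ex k (x : R) : (0 < k)%N -> 0 <= x -> exists2 y : R, 0 <= y & y ^+ k = x.
Proof.
move=> k0 x0; exists (x `^ k%:R^-1); first exact: powR_ge0.
by rewrite -powR_mulrn ?powR_ge0 // -powRrM mulVf ?powRr1 // pnatr_eq0 -lt0n.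
Qed.

Lemma nat_ge3 a b m : exists J, [/\ (a <= J)%N, (b <= J)%N & (m <= J)%N].
Proof. by exists (a + b + m)%N; split; lia. Qed.

Lemma cmod_ballmult_le1 d n (xi : 'rV[R]_d) : cmod (ballmult n xi) <= 1.
Proof.
rewrite /ballmult cmodM cmodV cmod_nat; set A := fset_set _.
have h : cmod (\sum_(x <- A) expi2pi (dotp x xi)) <= #|` A|%:R.
  have cm : forall s : seq 'rV[int]_d,
      cmod (\sum_(x <- s) expi2pi (dotp x xi)) <= (size s)%:R.
    elim=> [|x s IH]; first by rewrite big_nil cmod0.
    rewrite big_cons -natr1 addrC; apply: le_trans (cmodD _ _) _.
    by apply: lerD; rewrite ?cmod_expi2pi.
  exact: cm.
have [->|A0] := eqVneq (#|` A|) 0; first by rewrite invr0 mul0r.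
by rewrite mulrC ler_pdivrMr ?mul1r // ltr0n lt0n.
Qed.

(** The constant in min(d, n) <= widthC d r. *)
Definition widthC : R := 2 + 2 * mc 1.

Lemma arcC_ge0 N : 0 <= @arcC R N.
Proof.
have c0 := @decayC_gt0 R; have q0 := @lowq_gt0 R; have a0 := @lowA_gt0 R.
have L0 := @Lam_ge0 R (9 * N); have m0 := @minorC_ge0 R (minorK N).
have C0 : 0 <= @mainC R.
  by rewrite mulr_ge0 // mulr_ge0 ?expR_ge0 // divr_ge0 // ltW.
apply: addr_ge0; apply: divr_ge0; rewrite ?(ltW q0) //.
- apply: mulr_ge0; first by rewrite mulr_ge0.
  by rewrite mulr_ge0 ?expR_ge0 // mulr_ge0 // addr_ge0.
- by rewrite mulr_ge0.
- by rewrite mulr_ge0 // ltW.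
Qed.

(** The order of choices matters: m0 depends on n / d alone and bounds 1 - r from below in advance,
    so R0 and J are fixed before r. Then r solves the mean equation for this J, B is the 18th root
    of d r, and P comes last. *)
Lemma ballmult_approx_large N d n : (1 <= d)%N -> (1 <= n <= d ^ 4)%N ->
  widthC * scaleB N ^+ 18 <= (minn d n)%:R ->
  exists (alpha beta : 'I_(9 * N) -> C) (s : 'I_(9 * N) -> R),
    [/\ forall k, 0 < s k < 1,
        \sum_k (cmod (alpha k) + cmod (beta k)) <= coefC (9 * N) &
        forall xi : 'rV[R]_d, cmod (ballmult n xi - \sum_k alpha k * gausshat (s k) xi
          - \sum_k beta k * gausshat (s k) (xi - halfvec d)) <=
          (arcC N * widthC ^+ N + coefC (9 * N)) * (minn d n)%:R ^- N].
Proof.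
move=> d1 /andP[n1 nd] hM.
have d0 : 0 < d%:R :> R by rewrite ltr0n.
have n0 : 0 < n%:R :> R by rewrite ltr0n.
have M0 : 0 < (minn d n)%:R :> R by rewrite ltr0n leq_min d1.
have Md : (minn d n)%:R <= d%:R :> R by rewrite ler_nat geq_minl.
have Mn : (minn d n)%:R <= n%:R :> R by rewrite ler_nat geq_minr.
have mc1 := @mc_ge0 R 1.
have a0 := @lowA_gt0 R; have a1 := @lowA_le1 R.
have [m0 m1 hm0] : exists2 m0, (1 < m0)%N & 2 * (n%:R / d%:R) < m0%:R ^+ 2 * 16^-1 ^+ 4 :> R.
  have q0 : 0 <= 2 * (n%:R / d%:R) / 16^-1 ^+ 4 :> R.
    by apply: divr_ge0; rewrite ?exprn_ge0 ?invr_ge0 // mulr_ge0 // divr_ge0.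
  have /andP[_ k2] := truncn_itv q0; set k := Num.truncn _ in k2.
  exists k.+2 => //; rewrite -ltr_pdivrMr ?exprn_gt0 ?invr_gt0 //; apply: (lt_trans k2).
  apply: (@lt_le_trans _ _ k.+2%:R); first by rewrite ltr_nat.
  by rewrite -[leLHS]expr1 ler_weXn2l // ler1n.
have m00 : 0 < m0%:R :> R by rewrite ltr0n ltnW.
have m02 : 1 < m0%:R ^+ 2 :> R by rewrite exprn_egt1 // ltr1n.
(* The parameters of the final Gaussians are at most 1 - t / 2, hence below R0 once t > 1 / m0^2. *)
pose R0 : R := 1 - (2 * m0%:R ^+ 2)^-1.
have m2i : 0 < (2 * m0%:R ^+ 2)^-1 :> R by rewrite invr_gt0 mulr_gt0 // exprn_gt0.
have m2i1 : (2 * m0%:R ^+ 2)^-1 < 1 :> R.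
  by rewrite invf_lt1 ?mulr_gt0 ?exprn_gt0 //; lra.
have R01 : 0 < R0 < 1 by apply/andP; rewrite /R0; split; lra.
have e0 : 0 < (minn d n)%:R ^- N :> R by rewrite invr_gt0 exprn_gt0.
have [J0 hJ0] := gausshat_approx d R01 e0.
have [J [/hJ0 {}hJ0 J8 Jn]] := nat_ge3 J0 (8 * m0) (2 * n).
have [r [r01 hr]] := @mean_solution R J d n d1 n1 Jn.
have /andP[r0 r1] := r01; have t0 : 0 < 1 - r by lra.
have mean_eq : lawmean J r = n%:R / d%:R.
  by rewrite -hr mulrC mulKf // gt_eqF.
have hscale : 1 < m0%:R ^+ 2 * (1 - r).
  have h2 : (m0.*2 <= J)%N by rewrite -mul2n (leq_trans _ J8) // leq_mul2r orbT.
  by apply: (scale_lower r01 m1 h2 _ hm0); rewrite -mean_eq.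
have hJ : 64 <= (1 - r) * J%:R ^+ 2.
  apply: (@le_trans _ _ ((1 - r) * (8 * m0%:R) ^+ 2)).
    rewrite exprMn (_ : 8 ^+ 2 = 64 :> R); last by ring.
    by rewrite mulrCA; move: hscale; rewrite mulrC; lra.
  rewrite ler_wpM2l ?(ltW t0) // ler_pXn2r ?nnegrE ?mulr_ge0 //.
  by rewrite -natrM ler_nat.
have mlow : lowA * (r / (1 - r)) <= n%:R / d%:R.
  by rewrite -mean_eq; exact: mean_lower_scale r01 hJ.
have mupp : n%:R / d%:R <= mc 1 * r / (1 - r).
  by rewrite -mean_eq; exact: lawmean_upper.
have dr0 : 0 <= d%:R * r by rewrite mulr_ge0 // ltW.
have [B Bge0 hB] := root_ex (isT : (0 < 18)%N) dr0.
pose D := d%:R * r.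
have nup : n%:R * (1 - r) <= mc 1 * D.
  move: mupp; rewrite ler_pdivrMr // mulrAC ler_pdivlMr //.
  by rewrite /D => h; apply: le_trans h _; apply: eqW_le; ring.
have nlow : lowA * D <= n%:R * (1 - r).
  move: mlow; rewrite ler_pdivlMr // mulrA mulrAC ler_pdivrMr //.
  by apply: le_trans; apply: eqW_le; rewrite /D; ring.
(* If r >= 1/2 then d <= 2 D; otherwise n <= 2 n (1 - r) <= 2 mc 1 D by the upper bound on the
   mean. *)
have DM : (minn d n)%:R <= widthC * D.
  rewrite /widthC mulrDl; have D0 : 0 <= D by [].
  have [rh|rh] := lerP 2^-1 r.
    have : d%:R * 2^-1 <= D by rewrite ler_wpM2l.
    have : 0 <= 2 * mc 1 * D by rewrite mulr_ge0 // mulr_ge0.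
    by lra.
  have : n%:R * 2^-1 <= n%:R * (1 - r) by rewrite ler_wpM2l //; lra.
  by lra.
have wC : 0 < widthC by rewrite /widthC; lra.
have sB : scaleB N <= B.
  rewrite -(@ler_pXn2r _ 18) ?nnegrE //.
    by rewrite hB -(ler_pM2l wC); exact: le_trans hM DM.
  by have [h _ _ _ _] := scaleB_prop (lexx (scaleB N : R)); lra.
have [hB1 hB2 hB3 hB4 [hB5 hB6 hB7 hB8]] := scaleB_prop sB.
have B1 : 1 <= B by lra.
have B0 : 0 < B by lra.
have Bk k : 0 < B ^+ k by rewrite exprn_gt0.
have BD : B <= D by rewrite /D -hB -[leLHS]expr1 ler_weXn2l.
have hn4 : n%:R <= d%:R ^+ 4 :> R by rewrite -natrX ler_nat.
(* The use of n <= d^4: lowA D <= n t <= d^4 t and, for r >= 1/2, d <= 2 D bound t below by a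
   multiple of D^(-3) = B^(-54). *)
have ht : lowA <= 16 * B ^+ 54 * (1 - r).
  have -> : B ^+ 54 = D ^+ 3 by rewrite /D -hB -exprM.
  have D3 : 1 <= D ^+ 3 by rewrite exprn_ege1 //; lra.
  have [rh|rh] := lerP 2^-1 r; last first.
    apply: (le_trans a1); apply: (@le_trans _ _ (16 * 1 * 2^-1)); first by lra.
    by apply: ler_pM; rewrite ?mulr_ge0 ?invr_ge0 ?ler_pM2l //; lra.
  have h1 : lowA * r <= d%:R ^+ 3 * (1 - r).
    rewrite -(ler_pM2l d0) mulrCA; apply: (le_trans nlow).
    by rewrite mulrA -exprS ler_wpM2r // ltW.
  have h2 : d%:R ^+ 3 <= (2 * D) ^+ 3.
    have hdD : d%:R <= 2 * D.
      have : d%:R * 2^-1 <= D by rewrite ler_wpM2l.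
      by lra.
    by apply: lerXn2r; rewrite ?nnegrE // mulr_ge0.
  have h3 : d%:R ^+ 3 * (1 - r) <= 8 * D ^+ 3 * (1 - r).
    rewrite ler_wpM2r ?(ltW t0) //; apply: (le_trans h2).
    by rewrite exprMn; apply: eqW_le; ring.
  have : lowA * 2^-1 <= lowA * r by rewrite ler_wpM2l // ltW.
  by lra.
(* From 1 / lowA <= B <= D one gets n t >= 1; then (1 + t)^(n + 1) >= 2 by Bernoulli, while r (1 +
   t) = 1 - t^2 <= 1. *)
have hrn : r ^+ n.+1 <= 2^-1.
  have h1 : 1 <= n%:R * (1 - r).
    apply: le_trans nlow; rewrite -(ler_pdivrMl _ _ a0) mulr1.
    exact: le_trans hB8 BD.
  have h2 : 2 <= (1 + (1 - r)) ^+ n.+1.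
    have := @bernoulli_le R (- (1 - r)) n.+1; rewrite opprK => h2.
    apply: le_trans (h2 _); last by lra.
    by rewrite -natr1; lra.
  have h3 : (r * (1 + (1 - r))) ^+ n.+1 <= 1.
    apply: exprn_ile1; first by apply: mulr_ge0; [exact: ltW|apply: addr_ge0 => //; exact: ltW].
    by nra.
  rewrite exprMn in h3; have rn : 0 <= r ^+ n.+1 by rewrite exprn_ge0 // ltW.
  have := ler_wpM2l rn h2; lra.
have hmE : minorE B <= lowq / 4 * width r B.
  have W0 : 0 <= width r B by rewrite divr_ge0 ?(ltW t0) // ltW.
  apply: (le_trans (minorE_width N B1 ht)); apply: ler_wpM2r => //.
  have q0 := @lowq_gt0 R.
  apply: (@le_trans _ _ (16 * minorC (minorK N) / lowA * B^-1)).
    apply: ler_wpM2l; first by rewrite divr_ge0 ?mulr_ge0 ?minorC_ge0 // ltW.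
    by rewrite lef_pV2 ?posrE // -[leLHS]expr1 ler_weXn2l.
  rewrite ler_pdivrMr //.
  have e (m a q : R) : 0 < a -> 0 < q -> 16 * m / a = q / 4 * (64 * m / (q * a)).
    by move=> a00 q00; field; rewrite !gt_eqF.
  rewrite (e _ _ _ a0 q0).
  by apply: ler_wpM2l => //; rewrite divr_ge0 // ltW.
have W0 : 0 < width r B by rewrite divr_gt0.
have W1 : width r B < 1.
  rewrite ltr_pdivrMr // mul1r; apply: (@lt_le_trans _ _ 1); first lra.
  by rewrite exprn_ege1.
have W01 : 0 < 1 - width r B < 1 by rewrite subr_gt0 W1 gtrBl.
have half0 : 0 < 2^-1 :> R by rewrite invr_gt0.
(* Q must exceed all degrees and be so large that the roots resolve the width. *)
have [P1 hP1] := geometric_small ler01 W01 half0.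
have [P [PP1 PQ P0]] := nat_ge3 P1 (d * J ^ 2 + n.+1) 1.
have {}PQ : (d * J ^ 2 + n.+1 <= P + P)%N by rewrite (leq_trans PQ) // leq_addr.
have {hP1}hQ : (1 - width r B) ^+ (P + P) <= 2^-1.
  have := hP1 (P + P)%N; rewrite mul1r => h; apply/ltW/h.
  by rewrite (leq_trans PP1) // leq_addr.
have hmean : d%:R * lawmean J r = n%:R by exact: hr.
have nJ : (n <= J)%N by rewrite (leq_trans _ Jn) // leq_pmull.
have he s : 0 < s <= 1 - (1 - r) / 2 -> forall xi : 'rV[R]_d,
    cmod (gausshat s xi - \prod_(i < d) phi1 J s (xi 0 i) 1) <= (minn d n)%:R ^- N.
  move=> /andP[s0 s1]; apply: hJ0; rewrite s0 (le_trans s1) // /R0 lerD2l lerN2.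
  rewrite invfM mulrC ler_wpM2r ?invr_ge0 //.
  by rewrite -[leLHS]mul1r ler_pdivrMr ?exprn_gt0 // mulrC ltW.
have [alpha [beta [s [hs hsum herr]]]] := ballmult_approx (9 * N) r01 hJ (esym hB) hB1 hB2
  hB3 hB4 hB5 hB6 hmE P0 hQ hmean hrn nJ PQ he.
exists alpha, beta, s; split=> // xi; apply: (le_trans (herr xi)).
rewrite mulrDl; apply: lerD => //.
apply: (le_trans (arcE_le N r01 B1 ht)); rewrite -mulrA; apply: ler_wpM2l; first exact: arcC_ge0.
(* B^(18 N) = D^N, and D >= min(d, n) / widthC. *)
rewrite exprM hB -/D -ler_pdivrMl ?exprn_gt0 // -!exprVn -exprMn.
apply: lerXn2r; rewrite ?nnegrE ?invr_ge0 ?mulr_ge0 ?invr_ge0 ?(ltW wC) ?(ltW M0) //.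
rewrite -invfM lef_pV2 ?posrE ?mulr_gt0 //; lra.
Qed.

End Choice.

Theorem proposition4 (R : realType) (N : nat) (hN : (1 <= N)%N) :
  exists (L : nat) (C : R), (1 <= L)%N /\ 0 < C /\
    forall (d n : nat), (1 <= d)%N -> (1 <= n <= d ^ 4)%N ->
      exists (alpha beta : 'I_L -> R[i]) (r rt : 'I_L -> R),
        (forall nu : 'I_L, 0 < r nu < 1 /\ 0 < rt nu < 1) /\
        \sum_(nu < L) (cmod (alpha nu) + cmod (beta nu)) <= C /\
        (ereal_sup [set (cmod (ballmult n xi
              - \sum_(nu < L) alpha nu * gausshat (r nu) xi
              - \sum_(nu < L) beta nu
                  * gausshat (rt nu) (xi - halfvec d)))%:E
            | xi in [set: 'rV[R]_d]]
          <= (C * (minn n d)%:R ^- N)%:E)%E.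
Proof.
pose M1 : R := widthC * scaleB N ^+ 18.
pose C1 : R := arcC N * widthC ^+ N + coefC (9 * N).
exists (9 * N)%N, (1 + `|coefC (9 * N)| + `|C1| + `|M1| ^+ N); split; first by rewrite muln_gt0.
have a1 := normr_ge0 (coefC (9 * N) : R); have a2 := normr_ge0 C1.
have a3 : 0 <= `|M1| ^+ N by rewrite exprn_ge0.
split; first by lra.
move=> d n d1 nd; rewrite minnC; have n1 : (1 <= n)%N by case/andP: nd.
have M0 : 0 < (minn d n)%:R :> R by rewrite ltr0n leq_min d1.
have Mi : 0 <= (minn d n)%:R ^- N :> R by rewrite invr_ge0 exprn_ge0 // ltW.
suff [alpha [beta [r [rt [hr hs herr]]]]] : exists (alpha beta : 'I_(9 * N) -> R[i])
    (r rt : 'I_(9 * N) -> R),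
    [/\ forall nu, 0 < r nu < 1 /\ 0 < rt nu < 1,
        \sum_nu (cmod (alpha nu) + cmod (beta nu)) <= `|coefC (9 * N)| &
        forall xi : 'rV[R]_d, cmod (ballmult n xi - \sum_nu alpha nu * gausshat (r nu) xi
          - \sum_nu beta nu * gausshat (rt nu) (xi - halfvec d)) <=
          (`|C1| + `|M1| ^+ N) * (minn d n)%:R ^- N].
  exists alpha, beta, r, rt; split=> //; split; first by apply: (le_trans hs); lra.
  apply: ge_ereal_sup => _ [xi _ <-]; rewrite lee_fin; apply: (le_trans (herr xi)).
  by apply: ler_wpM2r => //; lra.
(* Below M1 the statement is trivial: |M1|^N min(d, n)^(-N) >= 1 bounds the multiplier, so zero
   coefficients suffice, with 1/2 as a dummy parameter. *)
have [hM|hM] := lerP M1 (minn d n)%:R.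
  have [alpha [beta [s [hs hsum herr]]]] := ballmult_approx_large d1 nd hM.
  exists alpha, beta, s, s; split=> //; first by apply: (le_trans hsum); exact: ler_norm.
  move=> xi; apply: (le_trans (herr xi)); apply: ler_wpM2r => //.
  by rewrite -/C1; apply: (le_trans (ler_norm C1)); rewrite lerDl.
have half01 : 0 < (2^-1 : R) < 1 by rewrite invr_gt0 ltr0n invf_lt1 ?ltr1n.
exists (fun=> 0), (fun=> 0), (fun=> 2^-1), (fun=> 2^-1); split=> //.
  by rewrite big1 // => k _; rewrite cmod0 addr0.
move=> xi; rewrite !big1; try by move=> k _; rewrite mul0r.
rewrite !subr0; apply: (le_trans (cmod_ballmult_le1 _ _)).
rewrite -[leLHS](divff (lt0r_neq0 (exprn_gt0 N M0))); apply: ler_wpM2r => //.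
apply: (@le_trans _ _ (`|M1| ^+ N)); last by rewrite lerDr.
rewrite lerXn2r ?nnegrE ?(ltW M0) //; apply: (le_trans (ltW hM)); exact: ler_norm.
Qed.
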